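(* Let $\mathcal P\subset\mathbb{R}^d$ be a simple convex polytope with vertex set $\mathcal V$. Then its normalized moment generating function satisfies $$F_{\mathcal P}(\mathbf u)=(-1)^d\sum_{\mathbf v\in\mathcal V}\frac{\langle \mathbf v,\mathbf u\rangle^d\,|\det K_{\mathbf v}|}{\prod_{j=1}^d\langle w_j(\mathbf v),\mathbf u\rangle}\cdot\frac{1}{1-\langle\mathbf v,\mathbf u\rangle} =(-1)^d\sum_{\mathbf v\in\mathcal V}\frac{|\det K_{\mathbf v}|}{\prod_{j=1}^d\langle w_j(\mathbf v),\mathbf u\rangle}\cdot\frac{1}{1-\langle\mathbf v,\mathbf u\rangle}.$$
   Context: $\langle\cdot,\cdot\rangle$ is the standard scalar product on $\mathbb{R}^d$. A convex polytope is the convex hull of a finite set not contained in any affine hyperplane of $\mathbb{R}^d$; it is simple if every vertex $\mathbf v$ has exactly $d$ incident edges $\mathbf v\mathbf v_{e_1},\dots,\mathbf v\mathbf v_{e_d}$. Put $w_k(\mathbf v)=\mathbf v_{e_k}-\mathbf v$, $1\le k\le d$; $K_{\mathbf v}$ is the tangent cone (non-negative real span of $w_1(\mathbf v),\dots,w_d(\mathbf v)$), and $|\det K_{\mathbf v}|=|\det(w_1(\mathbf v),\dots,w_d(\mathbf v))|$ is the volume of the parallelepiped formed by $w_1(\mathbf v),\dots,w_d(\mathbf v)$. The normalized moment generating function of $\mathcal P$ is $$F_{\mathcal P}(\mathbf u)=\sum_{I=(i_1,\dots,i_d)\ge0}\frac{(|I|+d)!}{i_1!\cdots i_d!}\left(\int_{\mathcal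 P}\mathbf x^I\,d\mathbf x\right)\mathbf u^I,$$ where $\mathbf x^I=x_1^{i_1}\cdots x_d^{i_d}$, $|I|=i_1+\dots+i_d$. It converges near $\mathbf u=0$; the equalities are equalities of rational functions of $\mathbf u$, i.e. the power series is the expansion at the origin of the rational function on the right. *)

(* Defs.v *)
(* [mpoly] has to be imported before
   MathComp-Analysis: in the other order their notations clash. *)
From HB Require Import structures.
From mathcomp Require Export all_boot all_order all_algebra.
From mathcomp Require Export mpoly.
From mathcomp Require Export all_classical all_reals all_analysis.

Set Implicit Arguments.
Unset Strict Implicit.
Unset Printing Implicit Defensive.

Import Order.TTheory GRing.Theory Num.Theory.
Import numFieldNormedType.Exports.

Local Open Scope classical_set_scope.
Local Open Scope ring_scope.

Section LebesgueTuple.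
Variable R : realType.
Local Notation RR := (measurableTypeR R).

Section Step.
Variables (n : nat) (mu : {sigma_finite_measure set (n.-tuple RR) -> \bar R}).

Definition cons_pair (p : RR * n.-tuple RR) : n.+1.-tuple RR :=
  [tuple of p.1 :: p.2].

Let mcons : measurable_fun [set: RR * n.-tuple RR] cons_pair.
Proof. exact: measurable_cons. Qed.

Definition lebesgue_cons : set (n.+1.-tuple RR) -> \bar R :=
  pushforward (@lebesgue_measure R \x mu)%E cons_pair.

Let lebesgue_cons0 : lebesgue_cons set0 = 0%E.
Proof. by rewrite /lebesgue_cons /pushforward preimage_set0 measure0. Qed.

Let lebesgue_cons_ge0 A : (0 <= lebesgue_cons A)%E.
Proof. exact: measure_ge0. Qed.

Let lebesgue_cons_sigma_additive : semi_sigma_additive lebesgue_cons.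
Proof.
exact: (@measure_semi_sigma_additive _ _ _
  (measure_function_pushforward__canonical__measure_function_Measure
     (@lebesgue_measure R \x mu)%E mcons)).
Qed.

HB.instance Definition _ := isMeasure.Build _ _ _ lebesgue_cons
  lebesgue_cons0 lebesgue_cons_ge0 lebesgue_cons_sigma_additive.

Let lebesgue_cons_sigma_finite : sigma_finite setT lebesgue_cons.
Proof.
have /sigma_finiteP[F [FT ndF Foo]] := sigma_finiteT (@lebesgue_measure R).
have /sigma_finiteP[G [GT ndG Goo]] := sigma_finiteT mu.
pose g (t : n.+1.-tuple RR) := (thead t, [tuple of behead t]).
have mg : measurable_fun setT g.
  by apply/measurable_fun_pairP; split;
    [exact: measurable_tnth|exact: measurable_behead].
exists (fun i => g @^-1` (F i `*` G i)).
  rewrite predeqE => t; split=> // _.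
  have [i _ Fi] : (\bigcup_i F i) (thead t) by rewrite -FT.
  have [j _ Gj] : (\bigcup_i G i) [tuple of behead t] by rewrite -GT.
  exists (maxn i j) => //; split => /=.
  - by move: Fi; exact/subsetPset/ndF/leq_maxl.
  - by move: Gj; exact/subsetPset/ndG/leq_maxr.
move=> i; have [mF Fi] := Foo i; have [mG Gi] := Goo i; split.
  by rewrite -[X in measurable X]setTI; apply: mg => //; exact: measurableX.
rewrite /lebesgue_cons /pushforward -comp_preimage.
rewrite (_ : g \o cons_pair = id); last first.
  by apply/funext => -[x t] /=; congr pair; apply/val_inj.
by rewrite preimage_id product_measure1E// lte_mul_pinfty// ge0_fin_numE.
Qed.

HB.instance Definition _ := Measure_isSigmaFinite.Build _ _ _ lebesgue_cons
  lebesgue_cons_sigma_finite.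

End Step.

(* Lebesgue measure on R^n, as the n-fold product of the one on R. *)
Fixpoint lebesgue_tuple n :
    {sigma_finite_measure set (n.-tuple RR) -> \bar R} :=
  match n with
  | 0 => \d_ [tuple]
  | n'.+1 => lebesgue_cons (lebesgue_tuple n')
  end.

End LebesgueTuple.

Section Polytopes.
Variables (R : realType) (d : nat).
Implicit Types (A F P : set 'rV[R]_d) (u v w : 'rV[R]_d).

Definition dot u v : R := \sum_i u 0 i * v 0 i.

Definition conv_hull A : set 'rV[R]_d := smallest (@convex_set R 'rV[R]_d) A.

Definition affine_hyperplane A :=
  exists u b, u != 0 /\ A = [set x | dot u x = b].

Definition convex_polytope P :=
  exists A, [/\ finite_set A, P = conv_hull A &
    forall H, affine_hyperplane H -> ~ A `<=` H].

(* The linear form [u] may vanish, so that P is a face of itself; this is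
   needed for d = 1, where P is its own unique edge. *)
Definition face P F :=
  exists u b, P `<=` [set x | dot u x <= b] /\
              F = P `&` [set x | dot u x = b].

Definition vertices P : set 'rV[R]_d := [set v | face P [set v]].

(* The vertices joined to v by an edge of P, i.e. the endpoints other than v of
   the edges incident to v. *)
Definition neighbours P v : set 'rV[R]_d :=
  [set w | [/\ vertices P w, w != v & face P (conv_hull [set v; w])]].

Definition simple_polytope P :=
  forall v, vertices P v -> (neighbours P v #= `I_d)%card.

(* [e v] lists the endpoints v_{e_1}, ..., v_{e_d} of the edges incident to the
   vertex v, in an arbitrary order. *)
Definition edge_labelling P (e : 'rV[R]_d -> 'I_d -> 'rV[R]_d) :=
  forall v, vertices P v -> set_bij [set: 'I_d] (neighbours P v) (e v).

Definition edge_vector (e : 'rV[R]_d -> 'I_d -> 'rV[R]_d) v (k : 'I_d) :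
  'rV[R]_d := e v k - v.

(* |det K_v| = |det (w_1(v), ..., w_d(v))|; the vectors are the rows here. *)
Definition absdetK (e : 'rV[R]_d -> 'I_d -> 'rV[R]_d) v : R :=
  `| \det (\matrix_(k < d) edge_vector e v k) |.

(* [lebesgue_tuple] lives on d.-tuple R, which carries the library's product
   sigma-algebra; P is transported there coordinatewise. *)
Definition moment P (I : 'X_{1..d}) : R :=
  \int[lebesgue_tuple R d]_(x in [set x | P (\row_i tnth x i)])
    \prod_(i < d) tnth x i ^+ I i.

(* The coefficient of u^I in the normalized moment generating function F_P. *)
Definition nmgf_coef P (I : 'X_{1..d}) : R :=
  (mdeg I + d)`!%:R / (\prod_(i < d) (I i)`!%:R) * moment P I.

End Polytopes.

Section RationalFunctions.
Variables (R : realType) (d : nat).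

Definition ratfun := {fraction {mpoly R[d]}}.

Definition rat_const (c : R) : ratfun := tofrac c%:MP.

Definition rat_form (v : 'rV[R]_d) : ratfun := tofrac (\sum_i v 0 i *: 'X_i).

(* The multivariate power series with coefficients f is the expansion at the
   origin of r: r = p / q with q(0) != 0, so that q is invertible as a power
   series, and q * f = p as power series. *)
Definition expansion_at0 (f : 'X_{1..d} -> R) (r : ratfun) :=
  exists p q : {mpoly R[d]},
    [/\ q@_0%MM != 0, r = tofrac p / tofrac q &
        forall m : 'X_{1..d},
          \sum_(k : 'X_{1..d < (mdeg m).+1} | (k <= m)%MM)
             q@_k * f (m - k)%MM = p@_m].

Definition converges_near0 (f : 'X_{1..d} -> R) :=
  \forall u \near (0 : 'rV[R]_d),
    summable [set: 'X_{1..d}]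
      (fun I : 'X_{1..d} => (f I * \prod_(i < d) (u : 'rV[R]_d) 0 i ^+ I i)%:E).

End RationalFunctions.

(* Main.v *)
Require Import Defs.
From mathcomp Require Import measurable_realfun ring lra.
Import Order.TTheory GRing.Theory Num.Theory.
Import numFieldNormedType.Exports.
Set Implicit Arguments.
Unset Strict Implicit.
Unset Printing Implicit Defensive.
Local Open Scope classical_set_scope.
Local Open Scope ring_scope.

(** Write l_v for the linear form <v, u> attached to a vertex v, and c_v for the
    rational function |det K_v| / prod_j <w_j(v), u>. By the multinomial theorem,
    the part of degree k of F_P is the integral over P of
    (k + d)! / k! * <x, u>^k, which is the d-th derivative of X^(k + d) at <x, u>
    ([ev_homog_part]). The theorem thus reduces to Brion's formula ([brion]):
    for every m, the integral over P of the d-th derivative of X^m at <x, u> is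
    (-1)^d sum_v c_v l_v^m. For m = k + d, summing over k the geometric series of
    the l_v gives the first expression of F_P ([graded_expansion]). For m < d the
    derivative is zero, hence so is sum_v c_v l_v^m; since
    (1 - l^d) / (1 - l) = 1 + l + ... + l^(d-1), the numerators l_v^d can be
    replaced by 1 ([rat_vertex_numerators]).

    Brion's formula holds for simplices: by the Hermite-Genocchi formula
    ([integral_std_simplex], [integral_convpts]) the integral of the d-th
    derivative of g is, up to the determinant of the simplex, the divided
    difference of g at the values of the form at the vertices. To pass to P,
    triangulate it without new vertices. The contributions of the simplices at a
    vertex v then have to add up to c_v ([rat_vertexE]). This is an identity
    between rational functions of u, and it is enough to prove it when u is
    positive on the edges at v. There both sides are volumes: a hyperplane
    <x - v, u> = eps cuts off P a simplex with volume proportional to c_v, and it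
    cuts the simplices of the triangulation in the same way ([local_volumes]).

    The triangulation is a regular one ([regular_triangulation]). Give generic
    heights to the vertices; for a point x of P, among the simplices that contain
    x, choose the one whose interpolation of the heights is lowest at x. An
    exchange argument as in the simplex method ([optimal_basis]) shows that this
    interpolation is below all the heights, and the genericity makes the simplex
    unique for x outside finitely many hyperplanes.

    From the geometry of P one needs that its vertices form a finite set which
    spans it, and that the edge vectors at a vertex form a basis and span the
    tangent cone ([simple_polytope_structure]); this follows from Gordan's theorem
    of the alternative ([gordan]). The series converges because the moments grow
    at most geometrically with the degree ([nmgf_converges]). *)

(** * Scalar products *)

Section ScalarProduct.
Variables (R : realType) (d : nat).
Implicit Types (u v x y : 'rV[R]_d).

Lemma dotE u x : dot u x = (u *m x^T) 0 0.
Proof. by rewrite /dot mxE; apply: eq_bigr => i _; rewrite mxE. Qed.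

Lemma dotC u x : dot u x = dot x u.
Proof. by apply: eq_bigr => i _; rewrite mulrC. Qed.

Lemma dotDr u x y : dot u (x + y) = dot u x + dot u y.
Proof. by rewrite -big_split; apply: eq_bigr => i _; rewrite mxE mulrDr. Qed.

Lemma dotZr u c x : dot u (c *: x) = c * dot u x.
Proof. by rewrite mulr_sumr; apply: eq_bigr => i _; rewrite mxE mulrCA. Qed.

Lemma dotBr u x y : dot u (x - y) = dot u x - dot u y.
Proof. by rewrite -scaleN1r dotDr dotZr mulN1r. Qed.

Lemma dot0r u : dot u 0 = 0.
Proof. by rewrite -(subrr 0) dotBr subrr. Qed.

Lemma dot_sumr u (I : Type) (r : seq I) (Q : pred I) (f : I -> 'rV[R]_d) :
  dot u (\sum_(i <- r | Q i) f i) = \sum_(i <- r | Q i) dot u (f i).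
Proof. by apply: (big_morph (dot u)); [exact: dotDr|exact: dot0r]. Qed.

Lemma dotDl u v x : dot (u + v) x = dot u x + dot v x.
Proof. by rewrite !(dotC _ x) dotDr. Qed.

Lemma dotZl c u x : dot (c *: u) x = c * dot u x.
Proof. by rewrite !(dotC _ x) dotZr. Qed.

Lemma dotBl u v x : dot (u - v) x = dot u x - dot v x.
Proof. by rewrite !(dotC _ x) dotBr. Qed.

Lemma dotNl u x : dot (- u) x = - dot u x.
Proof. by rewrite -scaleN1r dotZl mulN1r. Qed.

Lemma dot0l x : dot 0 x = 0.
Proof. by rewrite dotC dot0r. Qed.

Lemma dotNr u x : dot u (- x) = - dot u x.
Proof. by rewrite !(dotC u) dotNl. Qed.

Lemma dot_gt0 x : x != 0 -> 0 < dot x x.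
Proof.
move=> x0; have [i xi] : exists i, x 0 i != 0.
  by apply/existsP; apply: contraR x0 => /existsPn H; apply/eqP/rowP => i;
    rewrite mxE; apply/eqP; have := H i; rewrite negbK.
rewrite /dot (bigD1 i)//= ltr_pwDl//; first by rewrite -expr2 exprn_even_gt0.
by apply: sumr_ge0 => j _; rewrite -expr2 sqr_ge0.
Qed.

End ScalarProduct.

(** * Slices and affine maps *)

Section Slices.
Variable R : realType.
Local Notation RR := (measurableTypeR R).
Local Notation mu := (@lebesgue_measure R).
Local Notation lam n := (lebesgue_tuple R n).

Lemma measurable_affine1 (a c : R) :
  measurable_fun [set: RR] ((fun x => a * x + c) : RR -> RR).
Proof.
apply: (@measurable_funD _ _ R setT (fun x : RR => a * x) (cst c)).
  exact: measurable_funM.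
exact: measurable_cst.
Qed.

(** By the uniqueness of Lebesgue measure, it is enough to compare the two
    sides on intervals. *)
Lemma lebesgue_affine1 (a c : R) (A : set RR) : a != 0 -> measurable A ->
  mu ((fun x => a * x + c) @^-1` A) = (`|a|^-1%:E * mu A)%E.
Proof.
move=> a0 mA.
have na : 0 <= `|a| by [].
pose nu := mscale (NngNum na)
  (measure_function_pushforward__canonical__measure_function_Measure
     mu (measurable_affine1 a c)).
suff H X : ocitv X -> mu X = nu X.
  rewrite (@lebesgue_measure_unique R nu H A mA).
  by rewrite /nu /mscale /= muleA -EFinM mulVf ?normr_eq0// mul1e.
move=> [[x y] _ <-] /=; rewrite [nu _]/(`|a|%:E * mu ((fun x => a * x + c)%R @^-1` `]x, y]))%E.
rewrite lebesgue_measure_itv /= !lte_fin.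
have [a_gt0|] := ltP 0 a; last rewrite le_eqVlt (negbTE a0) /= => a_lt0.
- rewrite [X in mu X](_ : _ =
      `](x - c) / a, (y - c) / a]%classic); last first.
    apply/seteqP; split => z /=; rewrite !in_itv /=;
     by rewrite ltr_pdivrMr// ler_pdivlMr// ltrBlDr lerBrDr mulrC.
  rewrite lebesgue_measure_itv /= lte_fin ltr_pM2r ?invr_gt0// ltrD2r.
  case: ltP => _; last by rewrite /= mulr0.
  by rewrite /= gtr0_norm//; congr (_%:E); field.
- rewrite [X in mu X](_ : _ =
      `[(y - c) / a, (x - c) / a[%classic); last first.
    apply/seteqP; split => z /=; rewrite !in_itv /=;
    rewrite ltr_ndivlMr// ler_ndivrMr// ltrBlDr lerBrDr mulrC andbC //.
  rewrite lebesgue_measure_itv /= lte_fin ltr_nM2r ?invr_lt0// ltrD2r.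
  case: ltP => _; last by rewrite /= mulr0.
  by rewrite /= ltr0_norm//; congr (_%:E); field.
Qed.

Lemma ge0_integral_affine1 (a c : R) (f : RR -> \bar R) : a != 0 ->
  measurable_fun setT f -> (forall x, 0 <= f x)%E ->
  (\int[mu]_x f (a * x + c)%R = `|a|^-1%:E * \int[mu]_x f x)%E.
Proof.
move=> a0 mf f0.
have na : 0 <= `|a|^-1 by rewrite invr_ge0.
rewrite -[`|a|^-1]/((NngNum na)%:num) -ge0_integral_mscale//.
transitivity (\int[pushforward mu (fun x : RR => (a * x + c)%R : RR)]_x f x)%E.
  rewrite (@ge0_integral_pushforward _ _ RR RR R _ (measurable_affine1 a c) mu setT f)//.
apply: (@eq_measure_integral _ RR _ setT (mscale (NngNum na) mu)
  (measure_function_pushforward__canonical__measure_function_Measure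
     mu (measurable_affine1 a c))) => A mA _.
exact: lebesgue_affine1.
Qed.

Lemma measurable_cons_pair n :
  measurable_fun [set: RR * n.-tuple RR] (@cons_pair R n).
Proof. exact: measurable_cons. Qed.

Lemma lebesgue_slice n (A : set (n.+1.-tuple RR)) :
  lam n.+1 A = (\int[mu]_x lam n [set t | A (cons_pair (x, t))])%E.
Proof.
rewrite /= /lebesgue_cons /pushforward /product_measure1 /=.
apply: eq_integral => x _ /=; congr (lebesgue_tuple R n _).
by apply/seteqP; split => t /=; rewrite /xsection /= ?inE.
Qed.

Lemma lebesgue_slice_swap n (A : set (n.+1.-tuple RR)) : measurable A ->
  lam n.+1 A = (\int[lam n]_t mu [set x | A (cons_pair (x, t))])%E.
Proof.
move=> mA; rewrite lebesgue_slice.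
pose B := @cons_pair R n @^-1` A.
have mB : measurable B.
  by rewrite -[B]setTI; apply: measurable_cons_pair.
have := @indic_fubini_tonelli _ _ _ _ R mu (lam n) B mB.
rewrite indic_fubini_tonelli_FE// indic_fubini_tonelli_GE// => H.
transitivity (\int[mu]_x (lam n \o xsection B) x)%E.
  apply: eq_integral => x _ /=; congr (lebesgue_tuple R n _).
  by apply/seteqP; split => t /=; rewrite /xsection /= ?inE.
rewrite H; apply: eq_integral => x _ /=; congr (mu _).
by apply/seteqP; split => t /=; rewrite /ysection /= ?inE.
Qed.

Definition row_of n (t : n.-tuple R) : 'rV[R]_n := \row_i tnth t i.
Definition tuple_of n (x : 'rV[R]_n) : n.-tuple R := [tuple x 0 i | i < n].

Lemma row_ofK n : cancel (@row_of n) (@tuple_of n).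
Proof. by move=> t; apply: eq_from_tnth => i; rewrite tnth_mktuple mxE. Qed.

Lemma tuple_ofK n : cancel (@tuple_of n) (@row_of n).
Proof. by move=> x; apply/rowP => i; rewrite mxE tnth_mktuple. Qed.

Lemma row_of_cons n (x : R) (t : n.-tuple R) :
  row_of (cons_pair (x, t)) = row_mx (x%:M : 'rV_1) (row_of t).
Proof.
apply/rowP => i; rewrite !mxE; case: splitP => j ij; rewrite !mxE.
  by rewrite ord1 eqxx mulr1n (_ : i = ord0) // ; apply/val_inj => /=; rewrite ij ord1.
by rewrite (_ : i = lift ord0 j) ?tnthS//; apply/val_inj.
Qed.

Lemma tuple_of_row_mx n (x : R) (y : 'rV[R]_n) :
  tuple_of (row_mx (x%:M : 'rV_1) y : 'rV_n.+1) = cons_pair (x, tuple_of y).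
Proof.
by apply: (can_inj (@row_ofK _)); rewrite row_of_cons !tuple_ofK.
Qed.

Definition affine n (M : 'M[R]_n) (c : 'rV[R]_n) (t : n.-tuple RR) : n.-tuple RR :=
  tuple_of (row_of t *m M + c).

Lemma affine_comp n (M N : 'M[R]_n) b c :
  affine N c \o affine M b = affine (M *m N) (b *m N + c).
Proof.
apply/funext => t /=; rewrite /affine tuple_ofK mulmxDl mulmxA addrA //.
Qed.

Lemma measurable_affine n (M : 'M[R]_n) (c : 'rV[R]_n) :
  measurable_fun [set: n.-tuple RR] (affine M c).
Proof.
apply/measurable_fun_tnthP => i.
rewrite (_ : _ \o _ = fun t : n.-tuple RR => \sum_j tnth t j * M j i + c 0 i).
  apply: (@measurable_funD _ _ R setT (fun t : n.-tuple RR => \sum_j tnth t j * M j i)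
    (cst (c 0 i))).
    apply: (@measurable_sum _ _ R setT) => j.
    apply: (@measurable_funM _ _ R setT (fun t : n.-tuple RR => tnth t j) (cst (M j i))).
      exact: measurable_tnth.
    exact: measurable_cst.
  exact: measurable_cst.
apply/funext => t /=; rewrite tnth_mktuple !mxE; congr (_ + _).
by apply: eq_bigr => j _; rewrite mxE.
Qed.

Lemma measurable_affine_preimage n (M : 'M[R]_n) (c : 'rV[R]_n) (A : set (n.-tuple RR)) :
  measurable A -> measurable (affine M c @^-1` A : set (n.-tuple RR)).
Proof. by move=> mA; rewrite -[X in measurable X]setTI; apply: measurable_affine. Qed.

Lemma measurable_slice n (A : set (n.+1.-tuple RR)) (x : R) : measurable A ->
  measurable ([set t | A (cons_pair (x, t))] : set (n.-tuple RR)).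
Proof.
move=> mA; rewrite (_ : mkset _ = xsection (@cons_pair R n @^-1` A) x); last first.
  by apply/seteqP; split => t /=; rewrite /xsection /= ?inE.
apply: measurable_xsection.
by rewrite -[X in measurable X]setTI; apply: measurable_cons_pair.
Qed.

Lemma measurable_slice_swap n (A : set (n.+1.-tuple RR)) (t : n.-tuple R) : measurable A ->
  measurable ([set x | A (cons_pair (x, t))] : set RR).
Proof.
move=> mA; rewrite (_ : mkset _ = ysection (@cons_pair R n @^-1` A) t); last first.
  by apply/seteqP; split => x /=; rewrite /ysection /= ?inE.
apply: measurable_ysection.
by rewrite -[X in measurable X]setTI; apply: measurable_cons_pair.
Qed.

Lemma measurable_fun_slice n (A : set (n.+1.-tuple RR)) : measurable A ->
  measurable_fun setT (fun x : RR => lam n [set t | A (cons_pair (x, t))]).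
Proof.
move=> mA; rewrite (_ : (fun x => _) = lam n \o xsection (@cons_pair R n @^-1` A)).
  apply: measurable_fun_xsection.
  by rewrite -[X in measurable X]setTI; apply: measurable_cons_pair.
apply/funext => x /=; congr (lebesgue_tuple R n _).
by apply/seteqP; split => t /=; rewrite /xsection /= ?inE.
Qed.

End Slices.

(** * Lebesgue measure under affine maps *)

Section LinearChange.
Variable R : realType.
Local Notation RR := (measurableTypeR R).
Local Notation mu := (@lebesgue_measure R).
Local Notation lam n := (lebesgue_tuple R n).

Lemma affine_upper n (a x : R) (b c : 'rV[R]_n) (c0 : R) (D : 'M[R]_n) t :
  affine (block_mx (a%:M : 'M[R]_1) b 0 D : 'M[R]_n.+1) (row_mx (c0%:M : 'M[R]_1) c)
    (cons_pair (x, t)) =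
  cons_pair (a * x + c0, affine D (x *: b + c) t).
Proof.
rewrite /affine row_of_cons -tuple_of_row_mx; congr tuple_of.
have E := mul_row_block (x%:M : 'M[R]_1) (row_of t) (a%:M : 'M[R]_1) b 0 D.
rewrite [X in X + _]E.
have {}E := add_row_mx (x%:M *m a%:M + row_of t *m 0 : 'M[R]_1)
  (x%:M *m b + row_of t *m D) (c0%:M : 'M[R]_1) c.
rewrite [X in X = _]E.
by rewrite mulmx0 addr0 -scalar_mxM -raddfD /= (mulrC x) mul_scalar_mx addrCA addrA.
Qed.

Lemma affine_shear n (x : R) (cc : 'cV[R]_n) t :
  affine (block_mx (1%:M : 'M[R]_1) 0 cc 1%:M : 'M[R]_n.+1) 0 (cons_pair (x, t)) =
  cons_pair (1 * x + (row_of t *m cc) 0 0, t).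
Proof.
rewrite /affine row_of_cons.
have E := mul_row_block (x%:M : 'M[R]_1) (row_of t) (1%:M : 'M[R]_1) 0 cc 1%:M.
rewrite addr0 [X in tuple_of X]E.
rewrite !mulmx1 mulmx0 add0r mul1r.
rewrite -[X in cons_pair (_, X)](row_ofK t) -tuple_of_row_mx.
congr tuple_of; congr (@row_mx _ 1 1 n _ _).
by rewrite raddfD /= -mx11_scalar.
Qed.

Lemma det_corner_ublock n (a : 'M[R]_1) (b : 'rV_n) (D : 'M[R]_n) :
  \det (block_mx a b 0 D : 'M[R]_n.+1) = \det a * \det D.
Proof. exact: (@det_ublock _ 1 n a b D). Qed.

Lemma det_corner_lblock n (a : 'M[R]_1) (c : 'cV_n) (D : 'M[R]_n) :
  \det (block_mx a 0 c D : 'M[R]_n.+1) = \det a * \det D.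
Proof. exact: (@det_lblock _ 1 n a c D). Qed.

Definition scales_volume n (M : 'M[R]_n) := forall c (A : set (n.-tuple RR)),
  measurable A -> lam n (affine M c @^-1` A) = (`|\det M|^-1%:E * lam n A)%E.

Lemma scales_volume_mul n (M N : 'M[R]_n) :
  scales_volume M -> scales_volume N -> scales_volume (M *m N).
Proof.
move=> hM hN c A mA.
have := affine_comp M N 0 c; rewrite mul0mx add0r => <-.
rewrite comp_preimage hM; last exact: measurable_affine_preimage.
by rewrite hN// muleA -EFinM det_mulmx normrM invfM.
Qed.

Lemma scales_volume_divl n (M N : 'M[R]_n) : \det M != 0 ->
  scales_volume M -> scales_volume (M *m N) -> scales_volume N.
Proof.
move=> dM hM hMN c A mA.
have := hMN c A mA.
have := affine_comp M N 0 c; rewrite mul0mx add0r => <-.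
rewrite comp_preimage hM; last exact: measurable_affine_preimage.
rewrite det_mulmx normrM invfM EFinM -muleA => H.
have K : (`|\det M|%:E * `|\det M|^-1%:E = 1)%E.
  by rewrite -EFinM mulfV ?normr_eq0.
by rewrite -[LHS]mul1e -[RHS]mul1e -K -!muleA H.
Qed.

(** Slicing along the first coordinate: the slice at x of a preimage is the
    preimage, under an affine map with linear part D, of the slice at a x +
    c0. *)
Lemma scales_volume_upper n a (b : 'rV[R]_n) (D : 'M[R]_n) : a != 0 ->
  scales_volume D -> scales_volume (block_mx (a%:M : 'M[R]_1) b 0 D : 'M[R]_n.+1).
Proof.
move=> a0 hD c A mA.
have -> : c = row_mx ((c 0 0)%:M : 'M[R]_1) (rsubmx (c : 'rV_(1 + n))).
  rewrite -[LHS](@hsubmxK _ 1 1 n c); congr (@row_mx _ 1 1 n _ _).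
  by apply/rowP => i; rewrite !mxE ord1 eqxx mulr1n; congr (c _ _); apply/val_inj.
move: (c 0 0) (rsubmx _) => {c} c0 c.
rewrite lebesgue_slice [X in (_ * X)%E]lebesgue_slice.
under eq_integral => x _.
  rewrite [X in lam n X](_ : _ = affine D (x *: b + c) @^-1`
      [set t | A (cons_pair (a * x + c0, t))]); last first.
    by apply/seteqP; split => t /=; rewrite affine_upper.
  rewrite hD; last exact: measurable_slice.
  over.
rewrite ge0_integralZl_EFin ?invr_ge0//; last first.
  apply: (@measurableT_comp _ _ _ _ _ _ (fun y => lam n [set t | A (cons_pair (y, t))])).
    exact: measurable_fun_slice.
  exact: measurable_affine1.
rewrite (@ge0_integral_affine1 R a c0
  (fun y => lam n [set t | A (cons_pair (y, t))]))//; last first.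
  exact: measurable_fun_slice.
by rewrite muleA -EFinM det_corner_ublock det_scalar1 normrM invfM mulrC.
Qed.

(** Slicing along the other coordinates: a shear only translates the lines
    parallel to the first axis. *)
Lemma scales_volume_shear n (cc : 'cV[R]_n) :
  scales_volume (1%:M : 'M[R]_n) ->
  scales_volume (block_mx (1%:M : 'M[R]_1) 0 cc 1%:M : 'M[R]_n.+1).
Proof.
move=> h1.
have h0 (A : set (n.+1.-tuple RR)) : measurable A ->
  lam n.+1 (affine (block_mx (1%:M : 'M[R]_1) 0 cc 1%:M : 'M[R]_n.+1) 0 @^-1` A) = lam n.+1 A.
  move=> mA; rewrite lebesgue_slice_swap ?[RHS]lebesgue_slice_swap //; last first.
    exact: measurable_affine_preimage.
  apply: eq_integral => t _.
  rewrite [X in mu X](_ : _ = (fun x => 1 * x + (row_of t *m cc) 0 0) @^-1`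
      [set x | A (cons_pair (x, t))]); last first.
    by apply/seteqP; split => x /=; rewrite affine_shear.
  rewrite lebesgue_affine1 ?oner_neq0//; last exact: measurable_slice_swap.
  by rewrite normr1 invr1 mul1e.
move=> c A mA.
have := affine_comp (block_mx (1%:M : 'M[R]_1) 0 cc 1%:M : 'M[R]_n.+1) 1%:M 0 c.
rewrite mulmx1 mul0mx add0r => <-.
rewrite comp_preimage h0; last exact: measurable_affine_preimage.
rewrite (_ : 1%:M = block_mx (1%:M : 'M[R]_1) 0 0 1%:M :> 'M[R]_n.+1); last first.
  by rewrite -(@scalar_mx_block _ 1 n).
rewrite scales_volume_upper ?oner_neq0//.
by rewrite det_corner_ublock det_corner_lblock !det1.
Qed.

(** Induction on the size. A matrix with a nonzero corner entry is the
    product of a shear and of a block triangular matrix; a zero corner entry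
    becomes nonzero when a suitable row is added to the first one. *)
Lemma lebesgue_affine n (M : 'M[R]_n) : M \in unitmx -> scales_volume M.
Proof.
elim: n M => [|n IH] M.
  move=> _ c A mA.
  rewrite det_mx00 normr1 invr1 mul1e; congr (lebesgue_tuple R 0 _).
  by apply/seteqP; split => t /=; rewrite [affine _ _ _]tuple0 [t]tuple0.
have h1 := IH _ (unitmx1 _ _).
(* the last block of the triangular factor is the Schur complement of a *)
have corner (a : R) (b : 'rV_n) (c : 'cV_n) (D : 'M[R]_n) : a != 0 ->
    (block_mx (a%:M : 'M[R]_1) b c D : 'M[R]_n.+1) \in unitmx ->
    scales_volume (block_mx (a%:M : 'M[R]_1) b c D : 'M[R]_n.+1).
  move=> a0.
  have -> : (block_mx (a%:M : 'M[R]_1) b c D : 'M[R]_n.+1) =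
     (block_mx (1%:M : 'M[R]_1) 0 (a^-1 *: c) 1%:M : 'M[R]_n.+1) *m
     (block_mx (a%:M : 'M[R]_1) b 0 (D - (a^-1 *: c) *m b) : 'M[R]_n.+1).
    rewrite (@mulmx_block _ 1 n 1 n 1 n) !mul1mx !mul0mx !addr0.
    by rewrite mul_mx_scalar scalerA mulfV// scale1r addrC subrK.
  move=> u; apply: scales_volume_mul; first exact: scales_volume_shear.
  apply: scales_volume_upper => //; apply: IH.
  move: u; rewrite unitmx_mul => /andP[_].
  rewrite !unitmxE det_corner_ublock det_scalar1 unitrM => /andP[] //.
have blockE (N : 'M[R]_n.+1) : N = block_mx ((N 0 0)%:M : 'M[R]_1) (ursubmx (N : 'M[R]_(1 + n)))
   (dlsubmx (N : 'M[R]_(1 + n))) (drsubmx (N : 'M[R]_(1 + n))).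
  rewrite -[LHS](@submxK _ 1 n 1 n); congr (@block_mx _ 1 n 1 n _ _ _ _).
  by apply/matrixP => i j; rewrite !mxE !ord1 eqxx mulr1n; congr (N _ _); apply/val_inj.
have corner' (N : 'M[R]_n.+1) : N 0 0 != 0 -> N \in unitmx -> scales_volume N.
  by move=> N0; rewrite [N]blockE; exact: corner.
move=> uM.
have [M0|] := eqVneq (M 0 0) 0; last by move=> M0; exact: corner'.
have [i Mi] : exists i : 'I_n, M (lift ord0 i) 0 != 0.
  apply/existsP; rewrite -[X in is_true X]negbK; apply/negP => /existsPn H.
  have : (\row_j (j == 0)%:R : 'rV[R]_n.+1) *m M^T = 0.
    apply/rowP => k; rewrite !mxE (bigD1 ord0)//= !mxE eqxx mul1r big1 ?addr0.
      case: (unliftP ord0 k) => [k' ->|->]; last by rewrite M0.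
      by move: (H k'); rewrite negbK => /eqP.
    by move=> j /negPf j0; rewrite mxE j0 mul0r.
  move=> /(congr1 (mulmxr (invmx M^T))) /=.
  rewrite mulmxK ?unitmx_tr// mul0mx => /rowP/(_ 0); rewrite !mxE eqxx.
  by move/eqP; rewrite oner_eq0.
pose S : 'M[R]_n.+1 := block_mx (1%:M : 'M[R]_1) (delta_mx 0 i) 0 1%:M.
have dS : \det S = 1 by rewrite /S det_corner_ublock !det1 mulr1.
apply: (@scales_volume_divl _ S); first by rewrite dS oner_neq0.
  exact: scales_volume_upper (oner_neq0 _) h1.
apply: corner'; last by rewrite unitmx_mul uM unitmxE dS unitr1.
suff -> : (S *m M) 0 0 = M (lift ord0 i) 0 by [].
have SE j : S 0 (lift ord0 j) = (j == i)%:R.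
  transitivity ((delta_mx 0 i : 'rV[R]_n) 0 j); last by rewrite mxE eqxx.
  rewrite -(@block_mxEur R 1 n 1 n 1%:M (delta_mx 0 i) 0 1%:M 0 j) /S.
  by congr (fun_of_matrix _ _ _); apply: val_inj.
rewrite mxE big_ord_recl M0 mulr0 add0r (bigD1 i)//= SE eqxx mul1r.
by rewrite big1 ?addr0// => j /negPf ji; rewrite SE ji mul0r.
Qed.

End LinearChange.

(** * Divided differences *)

Section DividedDifferences.
Variable F : fieldType.
Implicit Types (z : seq F) (f : F -> F).

(** The divided difference of f at pairwise distinct nodes z, in Lagrange's
    symmetric form. *)
Definition divdiff f z : F :=
  \sum_(x <- z) f x / \prod_(w <- z | w != x) (x - w).

Lemma perm_divdiff f z1 z2 : perm_eq z1 z2 -> divdiff f z1 = divdiff f z2.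
Proof.
move=> p; rewrite /divdiff (perm_big _ p) /=; apply: eq_bigr => x _.
by rewrite (perm_big _ p).
Qed.

Lemma divdiff_cons f x z : x \notin z ->
  divdiff f (x :: z) = f x / \prod_(w <- z) (x - w)
   + \sum_(y <- z) f y / ((y - x) * \prod_(w <- z | w != y) (y - w)).
Proof.
move=> xz; rewrite /divdiff big_cons big_cons eqxx /=; congr (_ / _ + _).
  rewrite big_seq_cond [RHS]big_seq_cond; apply: eq_bigl => w.
  rewrite andbT; case wz: (w \in z) => //=.
  by apply: contraNneq xz => <-.
rewrite !big_seq; apply: eq_bigr => y yz; rewrite big_cons.
by rewrite (_ : x != y)//; apply: contraNneq xz => ->.
Qed.

Lemma divdiff_cons2 f x y z : uniq [:: x, y & z] ->
  divdiff f [:: x, y & z] =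
  (divdiff f (x :: z) - divdiff f (y :: z)) / (x - y).
Proof.
move=> /= /and3P[]; rewrite inE negb_or => /andP[xy xz] yz uz.
have xy0 : x - y != 0 by rewrite subr_eq0.
rewrite !divdiff_cons ?inE ?negb_or ?xy ?xz ?yz//.
rewrite !big_cons eqxx /=.
have -> : \prod_(w <- z | w != y) (y - w) = \prod_(w <- z) (y - w).
  rewrite big_seq_cond [RHS]big_seq_cond; apply: eq_bigl => w.
  rewrite andbT; case wz: (w \in z) => //=.
  by apply: contraNneq yz => <-.
have nx : \prod_(w <- z) (x - w) != 0.
  rewrite prodf_seq_neq0; apply/allP => w wz /=; rewrite subr_eq0.
  by apply: contraNneq xz => ->.
have ny : \prod_(w <- z) (y - w) != 0.
  rewrite prodf_seq_neq0; apply/allP => w wz /=; rewrite subr_eq0.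
  by apply: contraNneq yz => ->.
have -> : \sum_(w <- z) f w / ((w - x) * \prod_(j <- y :: z | j != w) (w - j)) =
    (\sum_(w <- z) f w / ((w - x) * \prod_(j <- z | j != w) (w - j)) -
     \sum_(w <- z) f w / ((w - y) * \prod_(j <- z | j != w) (w - j))) / (x - y).
  rewrite -sumrB mulr_suml !big_seq; apply: eq_bigr => w wz.
  have wx : w - x != 0 by rewrite subr_eq0; apply: contraNneq xz => <-.
  have wy : w - y != 0 by rewrite subr_eq0; apply: contraNneq yz => <-.
  rewrite big_cons (_ : y != w); last by rewrite eq_sym -subr_eq0.
  have : \prod_(j <- z | j != w) (w - j) != 0.
    by rewrite prodf_seq_neq0; apply/allP => j jz; apply/implyP; rewrite subr_eq0 eq_sym.
  by move: (\prod_(j <- z | j != w) _) => p p0; field; rewrite xy0 wx wy p0.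
move: (\sum_(w <- z) _) (\sum_(w <- z) _) nx ny => A B nx ny.
have yx0 : y - x != 0 by rewrite -opprB oppr_eq0.
by field; rewrite nx ny xy0 yx0.
Qed.

Lemma divdiff1 x z : uniq (x :: z) -> divdiff (fun=> 1) (x :: z) = (z == [::])%:R.
Proof.
elim: z x => [|y z IH] x u.
  by rewrite divdiff_cons// !big_nil addr0 divr1.
rewrite divdiff_cons2// !IH ?subrr ?mul0r//; first by case/andP: u.
by move: u => /=; rewrite inE negb_or -andbA => /and4P[_ -> _ ->].
Qed.

(** The coefficients of a divided difference with at least two nodes sum to
    0, by [divdiff1]; this gives the coefficient of [f x] on the right-hand
    side. *)
Lemma sum_difference_quotients f x z : uniq (x :: z) -> z != [::] ->
  \sum_(y <- z) (f x - f y) / ((x - y) * \prod_(w <- z | w != y) (y - w)) =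
  divdiff f (x :: z).
Proof.
move=> u z0; have /= /andP[xz uz] := u.
have := divdiff1 u; rewrite (negbTE z0) /= mulr0n divdiff_cons// divdiff_cons//.
move=> /eqP; rewrite addr_eq0 => /eqP E.
rewrite [f x / _](_ : _ = f x * (1 / \prod_(w <- z) (x - w))); last by rewrite mul1r.
rewrite E mulrN mulr_sumr -sumrN -big_split /= !big_seq; apply: eq_bigr => y yz.
have xy : x - y != 0 by rewrite subr_eq0; apply: contraNneq xz => ->.
have : \prod_(w <- z | w != y) (y - w) != 0.
  by rewrite prodf_seq_neq0; apply/allP => j jz; apply/implyP; rewrite subr_eq0 eq_sym.
move: (\prod_(w <- z | w != y) _) => p p0.
have yx : y - x != 0 by rewrite -opprB oppr_eq0.
by field; rewrite p0 xy yx.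
Qed.

End DividedDifferences.

(** * Hyperplanes *)

Section Hyperplanes.
Variable R : realType.
Local Notation RR := (measurableTypeR R).
Local Notation mu := (@lebesgue_measure R).
Local Notation lam n := (lebesgue_tuple R n).

Lemma measurable_dot n (u : 'rV[R]_n) :
  measurable_fun [set: n.-tuple RR] (fun t : n.-tuple RR => dot u (row_of t) : RR).
Proof.
apply: (@measurable_sum _ _ R setT) => i.
rewrite (_ : (fun=> _) = fun t : n.-tuple RR => u 0 i * tnth t i); last first.
  by apply/funext => t; rewrite mxE.
apply: (@measurable_funM _ _ R setT (cst (u 0 i))); first exact: measurable_cst.
exact: measurable_tnth.
Qed.

Lemma measurable_hyperplane n (u : 'rV[R]_n) b :
  measurable ([set t | dot u (row_of t) = b] : set (n.-tuple RR)).
Proof.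
rewrite (_ : mkset _ = (fun t => dot u (row_of t)) @^-1` [set b])//.
by rewrite -[X in measurable X]setTI; apply: measurable_dot.
Qed.

Lemma dot_cons n (u : 'rV[R]_n.+1) x (t : n.-tuple R) :
  dot u (row_of (cons_pair (x, t))) = u 0 0 * x + dot (\row_i u 0 (lift ord0 i)) (row_of t).
Proof.
rewrite /dot big_ord_recl mxE; congr (_ + _).
by apply: eq_bigr => i _; rewrite !mxE tnthS.
Qed.

(** Either the normal vector is parallel to the first axis, and each line
    along this axis meets the hyperplane in one point, or each slice
    orthogonal to this axis is a hyperplane of one dimension less. *)
Lemma lebesgue_hyperplane n (u : 'rV[R]_n) b : u != 0 ->
  lam n [set t | dot u (row_of t) = b] = 0%E.
Proof.
elim: n u b => [|n IH] u b u0; first by rewrite [u]thinmx0 eqxx in u0.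
have mH := measurable_hyperplane u b.
pose u' := \row_i u 0 (lift ord0 i).
have [u'0|u'0] := eqVneq u' 0.
  have u00 : u 0 0 != 0.
    apply: contra u0 => /eqP H; apply/eqP/rowP => i.
    case: (unliftP ord0 i) => [j ->|->]; last by rewrite H mxE.
    by move/rowP: u'0 => /(_ j); rewrite !mxE.
  rewrite lebesgue_slice_swap//; apply: integral0_eq => t _.
  rewrite [X in mu X](_ : _ = [set b / u 0 0]) ?lebesgue_measure_set1//.
  apply/seteqP; split => x /=; rewrite dot_cons -/u' u'0 /dot;
    under eq_bigr do rewrite mxE mul0r; rewrite big1// addr0.
    by move=> <-; rewrite mulrAC mulfV// mul1r.
  by move=> ->; rewrite mulrC divfK.
rewrite lebesgue_slice; apply: integral0_eq => x _.
rewrite [X in lam n X](_ : _ = [set t | dot u' (row_of t) = b - u 0 0 * x]).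
  exact: IH.
by apply/seteqP; split => t /=; rewrite dot_cons -/u'; [move=> <-|move=> ->]; ring.
Qed.

End Hyperplanes.

(** * The standard simplex *)

Section StandardSimplex.
Variable R : realType.
Local Notation RR := (measurableTypeR R).
Local Notation mu := (@lebesgue_measure R).
Local Notation lam n := (lebesgue_tuple R n).

Definition std_simplex n (r : R) : set (n.-tuple RR) :=
  [set t | (forall i, 0 <= tnth t i) /\ \sum_i tnth t i <= r].

Arguments std_simplex n r _ : clear implicits.

Lemma measurable_tnth_ge0 n : measurable ([set t | forall i, 0 <= tnth t i] : set (n.-tuple RR)).
Proof.
rewrite (_ : mkset _ = \bigcap_(i in [set: 'I_n]) ((fun t => tnth t i) @^-1` `[0, +oo[)).
  apply: fin_bigcap_measurable => // i _.
  by rewrite -[X in measurable X]setTI; apply: measurable_tnth.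
apply/seteqP; split => t /= H i; first by move=> _ /=; rewrite in_itv /= andbT.
by have /= := H i Logic.I; rewrite in_itv /= andbT.
Qed.

Lemma measurable_std_simplex n r : measurable (std_simplex n r).
Proof.
apply: measurableI; first exact: measurable_tnth_ge0.
rewrite [X in measurable X](_ : _ = (fun t : n.-tuple RR => \sum_i tnth t i) @^-1` `]-oo, r]).
  rewrite -[X in measurable X]setTI.
  have : measurable_fun setT (fun t : n.-tuple RR => \sum_i tnth t i : RR).
    by apply: (@measurable_sum _ _ R setT) => j; exact: measurable_tnth.
  by apply.
by apply/seteqP; split => t /=; rewrite in_itv.
Qed.

Lemma forall_tnth_cons n (P : R -> Prop) x (t : n.-tuple R) :
  (forall i, P (tnth (cons_pair (x, t)) i)) <-> P x /\ forall i, P (tnth t i).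
Proof.
split => [H|[Px Pt] i].
  split; first exact: (H ord0).
  by move=> i; have := H (lift ord0 i); rewrite tnthS.
by case: (unliftP ord0 i) => [j ->|->]; rewrite ?tnthS.
Qed.

Lemma std_simplex_cons n r x t : std_simplex n.+1 r (cons_pair (x, t)) <->
  0 <= x /\ std_simplex n (r - x) t.
Proof.
have [h1 h2] := forall_tnth_cons (fun z => 0 <= z) x t.
rewrite /std_simplex /= big_ord_recl (_ : tnth _ ord0 = x)//.
rewrite (eq_bigr (tnth t)) => [|i _]; last by rewrite tnthS.
rewrite lerBrDl; split; first by move=> [/h1[]].
by move=> [x0 [t0 xt]]; split=> //; apply: h2.
Qed.

Lemma std_simplex_lt0 n r t : r < 0 -> ~ std_simplex n r t.
Proof.
move=> r0 [t0 tr]; have := le_lt_trans tr r0; rewrite ltNge => /negP; apply.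
exact: sumr_ge0.
Qed.

Definition box n (r : R) : set (n.-tuple RR) := [set t | forall i, 0 <= tnth t i <= r].
Arguments box n r _ : clear implicits.

Lemma measurable_box n r : measurable (box n r).
Proof.
rewrite (_ : box n r = \bigcap_(i in [set: 'I_n]) ((fun t => tnth t i) @^-1` `[0, r])).
  apply: fin_bigcap_measurable => // i _.
  by rewrite -[X in measurable X]setTI; apply: measurable_tnth.
apply/seteqP; split => t /= H i; first by move=> _ /=; rewrite in_itv /=.
by have /= := H i Logic.I; rewrite in_itv.
Qed.

Lemma lebesgue_box n (r : R) : 0 <= r -> lam n (box n r) = (r ^+ n)%:E.
Proof.
move=> r0; elim: n => [|n IH].
  by rewrite expr0 /= diracE mem_set// => -[].
rewrite /= /lebesgue_cons /pushforward.
rewrite (_ : _ @^-1` _ = `[0, r]%classic `*` box n r).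
  rewrite product_measure1E//; last exact: measurable_box.
  rewrite -[X in (X * _)%E]/(mu `[0, r]%classic) -[X in (_ * X)%E]/(lam n (box n r)).
  rewrite lebesgue_measure_itv /= lte_fin sube0 IH.
  move: r0; rewrite le_eqVlt => /predU1P[<-|->]; last by rewrite exprS EFinM.
  by case: ifP => _; rewrite mul0e exprS mul0r.
apply/seteqP; split => -[x t] /=; rewrite in_itv /=.
  exact: (proj1 (forall_tnth_cons (fun z => 0 <= z <= r) x t)).
exact: (proj2 (forall_tnth_cons (fun z => 0 <= z <= r) x t)).
Qed.

Lemma lebesgue_std_simplex_lty n r : (lam n (std_simplex n r) < +oo)%E.
Proof.
have [r0|r0] := leP 0 r; last first.
  rewrite (_ : std_simplex n r = set0) ?measure0//.
  by apply/seteqP; split => t // /(std_simplex_lt0 r0).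
apply: (@le_lt_trans _ _ (lam n (box n r))); last by rewrite lebesgue_box// ltry.
apply: le_measure; rewrite ?inE; [exact: measurable_std_simplex|exact: measurable_box|].
move=> t [t0 tr] i; rewrite t0 /=; apply: le_trans tr.
by rewrite (bigD1 i)//= lerDl sumr_ge0.
Qed.

Lemma lebesgue_std_simplex_gt0 n : (0 < lam n (std_simplex n 1%R))%E.
Proof.
apply: (@lt_le_trans _ _ (lam n (box n (n.+1%:R^-1)))).
  by rewrite lebesgue_box ?invr_ge0 ?ler0n// lte_fin exprn_gt0// invr_gt0 ltr0n.
apply: le_measure; rewrite ?inE; [exact: measurable_box|exact: measurable_std_simplex|].
move=> t bt; split=> [i|]; first by case/andP: (bt i).
apply: (@le_trans _ _ (\sum_(i < n) n.+1%:R^-1)).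
  by apply: ler_sum => i _; case/andP: (bt i).
rewrite sumr_const card_ord -[_ *+ n]mulr_natl ler_pdivrMr ?ltr0n// mul1r ler_nat.
exact: leqnSn.
Qed.

Lemma bounded_horner (p : {poly R}) B : exists C, forall x, `|x| <= B -> `|p.[x]| <= C.
Proof.
exists (\sum_(i < size p) `|p`_i| * B ^+ i) => x xB.
rewrite horner_coef; apply: (le_trans (ler_norm_sum _ _ _)).
apply: ler_sum => i _; rewrite normrM normrX ler_wpM2l// lerXn2r// nnegrE//.
exact: le_trans xB.
Qed.

Lemma integral_deriv (q : {poly R}) (r : R) : 0 <= r ->
  (\int[mu]_(x in `[0%R, r]) (q^`().[x])%:E = (q.[r] - q.[0])%:E)%E.
Proof.
rewrite le_eqVlt => /predU1P[<-|r0].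
  by rewrite set_itv1 integral_set1 subrr.
rewrite (@continuous_FTC2 _ _ (horner q))//.
- by apply: continuous_subspaceT => x; exact: continuous_horner.
- split; first by move=> x _; by have [] := is_derive_poly q x.
  - by apply: cvg_at_right_filter; exact: continuous_horner.
  - by apply: cvg_at_left_filter; exact: continuous_horner.
- by move=> x _; rewrite derive1E; have [] := is_derive_poly q x.
Qed.

Lemma integral_lebesgue_cons n (f : n.+1.-tuple RR -> \bar R) :
  (lam n.+1).-integrable setT f ->
  (\int[lam n.+1]_z f z = \int[mu]_x \int[lam n]_t f (cons_pair (x, t)))%E.
Proof.
move=> intf; have /integrableP[mf foo] := intf.
have mc := @measurable_cons_pair R n.
have mfc : measurable_fun setT (f \o @cons_pair R n) by exact: measurableT_comp.
have ifc : (mu \x lam n)%E.-integrable setT (f \o @cons_pair R n).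
  apply/integrableP; split => //.
  rewrite [ltLHS](_ : _ = \int[mu \x lam n]_(z in @cons_pair R n @^-1` setT)
     ((abse \o f) \o @cons_pair R n) z)%E; last by rewrite preimage_setT.
  rewrite -ge0_integral_pushforward//.
    by apply: measurableT_comp => //; exact: abse_measurable.
  by move=> y _; exact: abse_ge0.
rewrite (integral12_prod_meas1 ifc) /= /lebesgue_cons.
rewrite [RHS](_ : _ = \int[mu \x lam n]_(z in @cons_pair R n @^-1` setT)
     (f \o @cons_pair R n) z)%E; last by rewrite preimage_setT.
by rewrite -integral_pushforward.
Qed.

End StandardSimplex.

(** * The Hermite-Genocchi formula *)

Section SimplexIntegral.
Variable R : realType.
Local Notation RR := (measurableTypeR R).
Local Notation mu := (@lebesgue_measure R).
Local Notation lam n := (lebesgue_tuple R n).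

Lemma measurable_linear_form n (a : R) (y : n.-tuple R) :
  measurable_fun [set: n.-tuple RR]
    (fun t : n.-tuple RR => a + \sum_i tnth t i * tnth y i : RR).
Proof.
apply: (@measurable_funD _ _ R setT (cst a)); first exact: measurable_cst.
apply: (@measurable_sum _ _ R setT) => i.
apply: (@measurable_funM _ _ R setT (fun t : n.-tuple RR => tnth t i) (cst (tnth y i))).
  exact: measurable_tnth.
exact: measurable_cst.
Qed.

Lemma integrable_std_simplex n (p : {poly R}) (a : R) (y : n.-tuple R) r :
  (lam n).-integrable (@std_simplex R n r)
    (EFin \o (fun t : n.-tuple RR => p.[a + \sum_i tnth t i * tnth y i])).
Proof.
apply: measurable_bounded_integrable.
- exact: measurable_std_simplex.
- exact: lebesgue_std_simplex_lty.
- apply: measurable_funTS.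
  apply: (@measurableT_comp _ _ _ _ RR RR (horner p)); first exact: measurable_poly.
  exact: measurable_linear_form.
have [C HC] := bounded_horner p (`|a| + r * \sum_i `|tnth y i|).
exists C; split; first exact: num_real.
move=> C' /ltW CC' t [t0 tr] /=; apply: le_trans CC'; apply: HC.
apply: (le_trans (ler_normD _ _)); rewrite lerD2l.
apply: (le_trans (ler_norm_sum _ _ _)); rewrite mulr_sumr.
apply: ler_sum => i _; rewrite normrM ler_wpM2r//.
rewrite ger0_norm//; apply: le_trans tr.
by rewrite (bigD1 i)//= lerDl sumr_ge0.
Qed.

(** The Hermite-Genocchi formula, by induction on the dimension: the slice
    at x is a simplex of size r - x, where the induction hypothesis gives a
    divided difference. As a function of x, this is the derivative of a
    polynomial q, and the fundamental theorem of calculus yields a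
    difference of two values of q, which is again a divided difference by
    [sum_difference_quotients]. *)
Lemma integral_std_simplex n (g : {poly R}) (a r : R) (y : n.-tuple R) :
  0 <= r -> uniq (0 :: y) ->
  (\int[lam n]_(t in @std_simplex R n r)
     (g^`(n)).[(a + \sum_i tnth t i * tnth y i)%R]%:E =
   (divdiff (fun x => g.[(a + r * x)%R]) (0%R :: y))%:E)%E.
Proof.
elim: n => [|n IH] in g a r y *.
  move=> r0 _; rewrite [y]tuple0 /= (integral_dirac _ (measurable_std_simplex r)); last first.
    by have /integrableP[] := integrable_std_simplex g a [tuple] r.
  rewrite diracE mem_set; last by split; [case|rewrite big_ord0].
  rewrite mul1e big_ord0 addr0 /divdiff big_seq1 big_cons eqxx big_nil /=.
  by rewrite mulr0 addr0 divr1.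
case/tupleP: y => y0 y r0 u.
have uy : uniq (0 :: y) by move: u => /=; rewrite inE negb_or -andbA => /and4P[_ -> _ ->].
have y0Z : y0 \notin (0 :: y).
  by move: u => /=; rewrite !inE !negb_or (eq_sym y0) => /andP[/andP[-> _] /andP[]].
pose Z := 0 :: (y : seq R).
(* an antiderivative of the divided difference that the slice at x contributes *)
pose q : {poly R} := \sum_(z <- Z)
  (((y0 - z) * \prod_(w <- Z | w != z) (z - w))^-1 *: (g \Po ((a + r * z)%:P + (y0 - z) *: 'X))).
have qE x : q.[x] = \sum_(z <- Z) g.[a + r * z + (y0 - z) * x] /
    ((y0 - z) * \prod_(w <- Z | w != z) (z - w)).
  rewrite horner_sum; apply: eq_bigr => z _.
  by rewrite hornerZ horner_comp !hornerE mulrC.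
have q'E x : (q^`()).[x] = divdiff (fun z => g^`().[a + x * y0 + (r - x) * z]) Z.
  rewrite raddf_sum horner_sum /divdiff !big_seq; apply: eq_bigr => z zZ /=.
  rewrite derivZ deriv_comp derivD derivC add0r derivZ derivX.
  rewrite alg_polyC hornerZ hornerM hornerC horner_comp !hornerE.
  have yz : y0 - z != 0 by rewrite subr_eq0; apply: contraNneq y0Z => ->.
  have : \prod_(w <- Z | w != z) (z - w) != 0.
    by rewrite prodf_seq_neq0; apply/allP => j jz; apply/implyP; rewrite subr_eq0 eq_sym.
  move: (\prod_(w <- Z | w != z) _) => p p0.
  rewrite (_ : a + r * z + (y0 - z) * x = a + x * y0 + (r - x) * z); last by ring.
  by move: (g^`().[_]) => G /=; field; rewrite p0 yz.
transitivity (\int[mu]_(x in `[0%R, r]) (q^`().[x])%:E)%E; last first.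
  rewrite integral_deriv// !qE -sumrB; congr (_%:E).
  transitivity (divdiff (fun x => g.[a + r * x]) (y0 :: Z)); last first.
    by apply: perm_divdiff; rewrite /Z/=; apply/permP => p /=; rewrite !addnA (addnC (p y0)).
  rewrite -sum_difference_quotients//; last by rewrite /= y0Z.
  apply: eq_bigr => z _; rewrite -mulrBl; congr ((_ - _) / _).
    by congr (g.[_]); ring.
  by rewrite mulr0 addr0.
rewrite integral_mkcond integral_lebesgue_cons; last first.
  exact/(integrable_mkcond _ (measurable_std_simplex r))/integrable_std_simplex.
rewrite [RHS]integral_mkcond; apply: eq_integral => x _.
rewrite [RHS]patchE.
have [xr|xr] := boolP (x \in `[0%R, r]%classic).
  have {xr} : 0 <= x <= r by move: xr; rewrite inE /= in_itv.
  move=> /andP[x0 xr].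
  rewrite q'E -[in RHS]IH ?subr_ge0// [RHS]integral_mkcond.
  apply: eq_integral => t _; rewrite !patchE.
  rewrite (_ : (cons_pair (x, t) \in _) = (t \in @std_simplex R n (r - x))); last first.
    apply/idP/idP; rewrite !inE => H; last exact/std_simplex_cons.
    by have [] := (@std_simplex_cons R n r x t).1 H.
  case: ifPn => // _; congr (_%:E).
  rewrite derivSn big_ord_recl (_ : tnth _ ord0 = x)// (_ : tnth _ ord0 = y0)// addrA.
  congr (_.[_ + _]); apply: eq_bigr => i _; by rewrite !tnthS.
rewrite integral0_eq// => t _; rewrite patchE; case: ifPn => //.
rewrite inE => /std_simplex_cons[x0 H]; exfalso.
have xr0 : r < x.
  rewrite ltNge; apply/negP => xr1; move: xr; rewrite notin_setE /= in_itv /= x0 xr1.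
  by case.
by apply: std_simplex_lt0 H; rewrite subr_lt0.
Qed.

End SimplexIntegral.

(** * Simplices and cut cones *)

Section Simplices.
Variables (R : realType) (d : nat).
Local Notation RR := (measurableTypeR R).
Local Notation lam := (lebesgue_tuple R d).
Implicit Types (p : 'I_d.+1 -> 'rV[R]_d) (u v x : 'rV[R]_d).

Definition convpts m (p : 'I_m -> 'rV[R]_d) : set 'rV[R]_d :=
  [set x | exists l : 'I_m -> R,
    [/\ forall i, 0 <= l i, \sum_i l i = 1 & x = \sum_i l i *: p i]].

Definition edge_mx p (k : 'I_d.+1) : 'M[R]_d := \matrix_(i < d) (p (lift k i) - p k).

Definition tuples (A : set 'rV[R]_d) : set (d.-tuple RR) := [set t | A (row_of t)].

Lemma row_affine (M : 'M[R]_d) v t : row_of (affine M v t) = row_of t *m M + v.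
Proof. by rewrite /affine tuple_ofK. Qed.

Lemma affine_preimage_image (M : 'M[R]_d) v (S : set (d.-tuple RR)) :
  M \in unitmx -> affine M v @^-1` (affine M v @` S) = S.
Proof.
move=> uM; apply/seteqP; split => t /=; last by move=> St; exists t.
move=> [s Ss /(congr1 (@row_of R d))]; rewrite !row_affine => /addIr.
by move=> /(can_inj (mulmxK uM)) /(can_inj (@row_ofK R d)) <-.
Qed.

Lemma mulmx_edges (c : 'rV[R]_d) (M : 'M[R]_d) : c *m M = \sum_i c 0 i *: row i M.
Proof. exact: mulmx_sum_row. Qed.

Lemma convpts_edges p k :
  tuples (convpts p) = affine (edge_mx p k) (p k) @` @std_simplex R d 1.
Proof.
have E (l : 'I_d.+1 -> R) : \sum_i l i = 1 ->
    \sum_i l i *: p i = (\row_i l (lift k i)) *m edge_mx p k + p k.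
  move=> l1; rewrite mulmx_edges (bigD1_ord k)//=.
  have -> : l k = 1 - \sum_i l (lift k i) by rewrite -l1 (bigD1_ord k)//= addrK.
  rewrite [in RHS](eq_bigr (fun i => l (lift k i) *: p (lift k i) - l (lift k i) *: p k)).
    by rewrite sumrB scalerBl scale1r -scaler_suml [RHS]addrC addrA addrAC.
  by move=> i _; rewrite mxE rowK scalerBr.
apply/seteqP; split => t /=.
  move=> [l [l0 l1 tE]]; exists (tuple_of (\row_i l (lift k i))); last first.
    by apply: (can_inj (@row_ofK R d)); rewrite row_affine tuple_ofK tE E.
  split => [i|]; first by rewrite tnth_mktuple mxE.
  rewrite -l1 (bigD1_ord k)//= (eq_bigr (fun i => l (lift k i))).
    by rewrite lerDr.
  by move=> i _; rewrite tnth_mktuple mxE.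
move=> [s [s0 s1] <-]; rewrite /tuples /= row_affine.
pose l i := if unlift k i is Some j then tnth s j else 1 - \sum_j tnth s j.
have lk : l k = 1 - \sum_j tnth s j by rewrite /l unlift_none.
have ll j : l (lift k j) = tnth s j by rewrite /l liftK.
exists l; split.
- by move=> i; rewrite /l; case: unliftP => [j _|_] //; rewrite subr_ge0.
- by rewrite (bigD1_ord k)//= lk (eq_bigr _ (fun j _ => ll j)) subrK.
rewrite E; last by rewrite (bigD1_ord k)//= lk (eq_bigr _ (fun j _ => ll j)) subrK.
by congr (_ *m _ + _); apply/rowP => j; rewrite !mxE ll.
Qed.

(** This is 1 / d!; it cancels in the comparisons of volumes below. *)
Definition std_volume : R := fine (lam (@std_simplex R d 1)).

Lemma std_volumeE : lam (@std_simplex R d 1) = std_volume%:E.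
Proof.
rewrite fineK// ge0_fin_numE//; exact: lebesgue_std_simplex_lty.
Qed.

Lemma std_volume_gt0 : 0 < std_volume.
Proof. by rewrite -lte_fin -std_volumeE; exact: lebesgue_std_simplex_gt0. Qed.

Lemma measurable_affine_image (M : 'M[R]_d) v S : M \in unitmx ->
  measurable S -> measurable (affine M v @` S).
Proof.
move=> uM mS.
rewrite (_ : _ @` _ = affine (invmx M) (- v *m invmx M) @^-1` S).
  exact: measurable_affine_preimage.
have K : cancel (affine M v) (affine (invmx M) (- v *m invmx M)).
  move=> t; apply: (can_inj (@row_ofK R d)).
  by rewrite !row_affine mulmxDl mulNmx -addrA subrr addr0 mulmxK.
have K' : cancel (affine (invmx M) (- v *m invmx M)) (affine M v).
  move=> t; apply: (can_inj (@row_ofK R d)).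
  by rewrite !row_affine mulmxDl !mulNmx !mulmxKV// subrK.
apply/seteqP; split => t /=; first by move=> [s Ss <-]; rewrite K.
by move=> St; exists (affine (invmx M) (- v *m invmx M) t).
Qed.

Lemma lebesgue_affine_image (M : 'M[R]_d) v S : M \in unitmx -> measurable S ->
  lam (affine M v @` S) = (`|\det M|%:E * lam S)%E.
Proof.
move=> uM mS.
have := lebesgue_affine uM v (measurable_affine_image v uM mS).
rewrite affine_preimage_image// => ->; rewrite muleA -EFinM mulfV ?mul1e//.
by rewrite normr_eq0 -unitfE -unitmxE.
Qed.

Lemma integral_affine_image (M : 'M[R]_d) v S (f : d.-tuple RR -> \bar R) :
  M \in unitmx -> measurable S -> measurable_fun setT f ->
  lam.-integrable S (f \o affine M v) ->
  (\int[lam]_(t in affine M v @` S) f t =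
   `|\det M|%:E * \int[lam]_(t in S) f (affine M v t))%E.
Proof.
move=> uM mS mf intf.
have nM : 0 <= `|\det M|^-1 by rewrite invr_ge0.
have mI := measurable_affine_image v uM mS.
have mA := @measurable_affine R d M v.
have dM : `|\det M| != 0 by rewrite normr_eq0 -unitfE -unitmxE.
have -> : (\int[lam]_(t in S) f (affine M v t) =
   \int[pushforward lam (affine M v)]_(t in affine M v @` S) f t)%E.
  by rewrite integral_pushforward ?affine_preimage_image.
have -> : (\int[pushforward lam (affine M v)]_(t in affine M v @` S) f t =
   \int[mscale (NngNum nM) lam]_(t in affine M v @` S) f t)%E.
  apply: (@eq_measure_integral _ (d.-tuple RR) _ _ (mscale (NngNum nM) lam)
   (measure_function_pushforward__canonical__measure_function_Measure lam mA)) => A mA' _.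
  exact: lebesgue_affine.
have absI : (\int[pushforward lam (affine M v)]_(t in affine M v @` S) `|f t| =
   (`|\det M|^-1)%:E * \int[lam]_(t in affine M v @` S) `|f t|)%E.
  rewrite -[X in X%:E]/((NngNum nM)%:num) -ge0_integral_mscale//; last first.
    by apply: measurableT_comp => //; exact: measurable_funTS.
  apply: (@eq_measure_integral _ (d.-tuple RR) _ _ (mscale (NngNum nM) lam)
   (measure_function_pushforward__canonical__measure_function_Measure lam mA)) => A mA' _.
  exact: lebesgue_affine.
have intfI : lam.-integrable (affine M v @` S) f.
  apply/integrableP; split; first exact: measurable_funTS.
  have : (\int[pushforward lam (affine M v)]_(t in affine M v @` S) `|f t| < +oo)%E.
    rewrite ge0_integral_pushforward//; last first.
      by apply: measurableT_comp => //; exact: measurable_funTS.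
    by rewrite affine_preimage_image//; have /integrableP[] := intf.
  rewrite absI.
  case: (\int[lam]_(t in _) _)%E => [r _||]; rewrite ?ltry ?ltNyr//.
  by rewrite gt0_muley// lte_fin invr_gt0 lt_neqAle eq_sym dM normr_ge0.
rewrite [X in (_ * X)%E]integralE !ge0_integral_mscale//.
- rewrite /= -muleBr//; last exact: integrable_add_def.
  by rewrite muleA -EFinM mulfV// mul1e -integralE.
- exact/measurable_funTS/measurable_funeneg.
- exact/measurable_funTS/measurable_funepos.
Qed.

Lemma measurable_convpts p k : edge_mx p k \in unitmx -> measurable (tuples (convpts p)).
Proof.
move=> u; rewrite (convpts_edges p k); apply: measurable_affine_image => //.
exact: measurable_std_simplex.
Qed.

Lemma lebesgue_convpts p k : edge_mx p k \in unitmx ->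
  lam (tuples (convpts p)) = (`|\det (edge_mx p k)| * std_volume)%:E.
Proof.
move=> u; rewrite (convpts_edges p k) lebesgue_affine_image//.
  by rewrite std_volumeE.
exact: measurable_std_simplex.
Qed.

Lemma measurable_horner_dot (q : {poly R}) u :
  measurable_fun setT (fun t : d.-tuple RR => q.[dot u (row_of t)]%:E).
Proof.
apply/measurable_EFinP.
apply: (@measurableT_comp _ _ _ _ RR RR (horner q)); first exact: measurable_poly.
exact: measurable_dot.
Qed.

Lemma dot_affine u (M : 'M[R]_d) v t :
  dot u (row_of (affine M v t)) =
  dot u v + \sum_i tnth t i * tnth [tuple dot u (row i M) | i < d] i.
Proof.
rewrite row_affine mulmx_edges dotDr dot_sumr addrC; congr (_ + _).
by apply: eq_bigr => i _; rewrite dotZr mxE tnth_mktuple.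
Qed.

Lemma enum_ordS_lift (k : 'I_d.+1) : perm_eq (enum 'I_d.+1) (k :: map (lift k) (enum 'I_d)).
Proof.
apply: uniq_perm; first exact: enum_uniq.
  rewrite /= map_inj_uniq ?enum_uniq ?andbT; last exact: lift_inj.
  by apply/mapP => -[i _ /eqP]; rewrite (negPf (neq_lift _ _)).
move=> i; rewrite mem_enum in_cons; case: (unliftP k i) => [j ->|->].
  by rewrite map_f ?orbT// mem_enum.
by rewrite eqxx.
Qed.

(** The divided difference of f at the points s i, written as a sum over the
    vertices of a simplex; see [divdiff_vertex_sum]. *)
Definition vertex_sum (f : R -> R) (s : 'I_d.+1 -> R) : R :=
  \sum_i f (s i) / \prod_(j | j != i) (s i - s j).

Lemma divdiff_vertex_sum f (s : 'I_d.+1 -> R) k : injective s ->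
  divdiff (fun y => f (s k + 1 * y)) (0 :: [tuple s (lift k i) - s k | i < d]) =
  vertex_sum f s.
Proof.
move=> sI; set z := [seq s i - s k | i <- enum 'I_d.+1].
have -> : divdiff (fun y => f (s k + 1 * y)) (0 :: [tuple s (lift k i) - s k | i < d]) =
          divdiff (fun y => f (s k + 1 * y)) z.
  apply: perm_divdiff; rewrite perm_sym /z.
  apply: (perm_trans (perm_map _ (enum_ordS_lift k))) => /=.
  by rewrite subrr -map_comp.
rewrite /divdiff /z big_map big_enum /=; apply: eq_bigr => i _.
rewrite mul1r addrC subrK; congr (_ / _).
rewrite big_map big_enum_cond /=; apply: eq_big => j.
  by rewrite (inj_eq (addIr _)) (inj_eq sI).
by move=> _; rewrite opprB addrA subrK.
Qed.

Lemma dot_edges u p k : [tuple dot u (row i (edge_mx p k)) | i < d] =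
  [tuple dot u (p (lift k i)) - dot u (p k) | i < d].
Proof. by apply: eq_from_tnth => i; rewrite !tnth_mktuple rowK dotBr. Qed.

Lemma integrable_convpts (q : {poly R}) u p k : edge_mx p k \in unitmx ->
  lam.-integrable (tuples (convpts p)) (fun t => q.[dot u (row_of t)]%:E).
Proof.
move=> uW.
have mC := measurable_convpts uW.
have foo : (lam (tuples (convpts p)) < +oo)%E by rewrite (lebesgue_convpts uW) ltry.
have [C HC] := bounded_horner q (\sum_i `|dot u (p i)|).
apply: (@measurable_bounded_integrable _ _ _ lam (fun t => q.[dot u (row_of t)])) => //.
  apply: measurable_funTS; apply/measurable_EFinP.
  exact: measurable_horner_dot.
exists C; split; first exact: num_real.
move=> C' /ltW CC' t [l [l0 l1 tE]]; apply: le_trans CC'; apply: HC.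
rewrite tE dot_sumr; apply: (le_trans (ler_norm_sum _ _ _)).
apply: ler_sum => i _; rewrite dotZr normrM ger0_norm// ler_piMl//.
by rewrite -l1 (bigD1 i)//= lerDl sumr_ge0.
Qed.

(** The Hermite-Genocchi formula, transported from the standard simplex by
    an affine map. *)
Lemma integral_convpts (g : {poly R}) u p k :
  edge_mx p k \in unitmx -> injective (fun i => dot u (p i)) ->
  (\int[lam]_(t in tuples (convpts p)) (g^`(d)).[dot u (row_of t)]%:E =
   (`|\det (edge_mx p k)| * vertex_sum (horner g) (fun i => dot u (p i)))%:E)%E.
Proof.
move=> uW sI; rewrite (convpts_edges p k).
have mf := measurable_horner_dot g^`(d) u.
pose h (t : d.-tuple R) : R := (g^`(d)).[dot u (p k) +
    \sum_i tnth t i * tnth [tuple dot u (row i (edge_mx p k)) | i < d] i].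
have E t : (g^`(d)).[dot u (row_of (affine (edge_mx p k) (p k) t))] = h t.
  by rewrite dot_affine.
rewrite (integral_affine_image uW (@measurable_std_simplex _ _ _) mf); last first.
  rewrite (_ : _ \o _ = EFin \o h); first exact: integrable_std_simplex.
  by apply/funext => t /=; rewrite E.
transitivity (`|\det (edge_mx p k)|%:E *
    \int[lam]_(t in @std_simplex R d 1%R) (h t)%:E)%E.
  by congr (_ * _)%E; apply: eq_integral => t _; rewrite E.
rewrite integral_std_simplex ?ler01//; last first.
  rewrite dot_edges /= map_inj_uniq ?enum_uniq ?andbT.
    by apply/mapP => -[i _ /esym/eqP]; rewrite subr_eq0 => /eqP/sI/eqP;
       rewrite eq_sym (negPf (neq_lift _ _)).
  by move=> i j /addIr/sI/lift_inj.
by rewrite dot_edges (divdiff_vertex_sum _ _ sI).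
Qed.

(** When u is positive on the rows of W, this is a simplex with apex v,
    whose other vertices are v + eps / <w_i, u> w_i; hence its volume. *)
Definition cone_cut v (W : 'M[R]_d) u (eps : R) : set 'rV[R]_d :=
  [set x | exists c : 'rV[R]_d,
    [/\ forall i, 0 <= c 0 i, x = v + c *m W & dot u (c *m W) <= eps]].

Lemma lebesgue_cone_cut v W u eps : W \in unitmx -> 0 < eps ->
  (forall i, 0 < dot u (row i W)) ->
  lam (tuples (cone_cut v W u eps)) =
  (std_volume * eps ^+ d * (`|\det W| / \prod_i dot u (row i W)))%:E.
Proof.
move=> uW e0 s0.
have n0 i : dot u (row i W) != 0 by rewrite gt_eqF.
pose r : 'rV[R]_d := \row_i (eps / dot u (row i W)).
have r0 i : 0 < r 0 i by rewrite mxE divr_gt0.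
pose D := diag_mx r.
have dD : \det D = eps ^+ d / \prod_i dot u (row i W).
  rewrite det_diag (eq_bigr (fun i => eps / dot u (row i W))) => [|i _]; last by rewrite mxE.
  by rewrite big_split /= prodr_const card_ord prodfV.
have dD0 : 0 < \det D by rewrite dD divr_gt0 ?exprn_gt0// prodr_gt0.
have uD : D \in unitmx by rewrite unitmxE unitfE gt_eqF.
have -> : tuples (cone_cut v W u eps) = affine (D *m W) v @` @std_simplex R d 1.
  have dotc (c : 'rV_d) : dot u (c *m W) = \sum_i c 0 i * dot u (row i W).
    by rewrite mulmx_edges dot_sumr; apply: eq_bigr => i _; rewrite dotZr.
  have tD (t : d.-tuple R) i : (row_of t *m D) 0 i = tnth t i * r 0 i.
    by rewrite mul_mx_diag !mxE.
  apply/seteqP; split => t /=.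
    move=> [c [c0 tE ce]]; exists (tuple_of (\row_i (c 0 i / r 0 i))).
      split=> [i|]; first by rewrite tnth_mktuple mxE divr_ge0// ltW.
      rewrite (eq_bigr (fun i => eps^-1 * (c 0 i * dot u (row i W)))).
        by rewrite -mulr_sumr -dotc ler_pdivrMl// mulr1.
      by move=> i _; rewrite tnth_mktuple !mxE invf_div; field; rewrite gt_eqF.
    apply: (can_inj (@row_ofK R d)); rewrite row_affine tE addrC mulmxA; congr (_ + _ *m _).
    by apply/rowP => i; rewrite tD tnth_mktuple mxE divfK// gt_eqF.
  move=> [s [ss0 s1] <-]; rewrite /tuples /= row_affine mulmxA.
  exists (row_of s *m D); split; first by move=> i; rewrite tD mulr_ge0// ltW.
    by rewrite addrC.
  rewrite dotc (eq_bigr (fun i => eps * tnth s i)).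
    by rewrite -mulr_sumr ler_piMr// ltW.
  by move=> i _; rewrite tD mxE; field.
rewrite lebesgue_affine_image ?unitmx_mul ?uD//; last exact: measurable_std_simplex.
rewrite std_volumeE -EFinM det_mulmx normrM gtr0_norm// dD; congr (_%:E); ring.
Qed.

End Simplices.

(** * Theorem of the alternative *)

Section Gordan.
Variables (R : realType) (d : nat).
Implicit Types (u v w x : 'rV[R]_d).

Lemma small_perturbation (I : finType) (J : {set I}) (f g : I -> R) :
  (forall i, i \in J -> 0 < f i) ->
  exists2 eps, 0 < eps & forall i, i \in J -> 0 < f i + eps * g i.
Proof.
move=> f0; pose S := \sum_(i in J) `|g i| / f i.
have S0 : 0 <= S by apply: sumr_ge0 => i iJ; rewrite divr_ge0// ltW// f0.
exists (1 + S)^-1; first by rewrite invr_gt0 ltr_pwDl.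
move=> i iJ; have fi := f0 i iJ.
have gS : `|g i| < f i * (1 + S).
  rewrite mulrDr mulr1 ltr_pwDl// mulrC -ler_pdivrMr// /S (bigD1 i)//= lerDl.
  by apply: sumr_ge0 => j /andP[jJ _]; rewrite divr_ge0// ltW// f0.
have : - g i <= `|g i| by rewrite -normrN ler_norm.
have S1 : 0 < 1 + S by rewrite ltr_pwDl.
move=> /le_lt_trans /(_ gS) gfS.
rewrite (_ : f i + _ = (f i * (1 + S) + g i) / (1 + S)); last by field; rewrite gt_eqF.
by rewrite divr_gt0//; lra.
Qed.

Definition reject w x : 'rV[R]_d := x - (dot x w / dot w w) *: w.

Lemma dot_rejectl w u x : dot (reject w u) x = dot u (reject w x).
Proof.
by rewrite /reject dotBl dotBr dotZl dotZr (dotC w x); ring.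
Qed.

Lemma reject_id w : w != 0 -> reject w w = 0.
Proof. by move=> w0; rewrite /reject divff ?scale1r ?subrr// gt_eqF// dot_gt0. Qed.

Lemma sum_reject (I : finType) (J : {set I}) (mu : I -> R) (b : I -> 'rV[R]_d) w :
  \sum_(i in J) mu i *: reject w (b i) = 0 ->
  \sum_(i in J) mu i *: b i = (\sum_(i in J) mu i * (dot (b i) w / dot w w)) *: w.
Proof.
move=> H; apply/eqP; rewrite -subr_eq0 scaler_suml -sumrB -[X in _ == X]H; apply/eqP.
by apply: eq_bigr => i _; rewrite /reject scalerBr scalerA.
Qed.

(** Gordan's theorem of the alternative. Remove a vector [b i0], and use the
    induction hypothesis for the others and for their rejections from [b
    i0]. A form which is positive on the rejections, once made slightly
    positive on [b i0], is positive on all the vectors. A relation between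
    the rejections is a relation between the vectors up to a multiple t of
    [b i0], and the sign of t decides between the alternatives. *)
Lemma gordan (I : finType) (J : {set I}) (b : I -> 'rV[R]_d) :
  (exists u, forall i, i \in J -> 0 < dot u (b i)) \/
  (exists mu : I -> R, [/\ forall i, 0 <= mu i, exists2 i, i \in J & 0 < mu i &
     \sum_(i in J) mu i *: b i = 0]).
Proof.
have [n] := ubnP #|J|; elim: n J b => // n IH J b.
have [->|[i0 i0J]] := set_0Vmem J.
  by left; exists 0 => i; rewrite inE.
rewrite (cardsD1 i0) i0J add1n ltnS => Jn.
have extend t (mu : I -> R) : 0 <= t -> (forall i, 0 <= mu i) ->
    (0 < t \/ exists2 i, i \in J :\ i0 & 0 < mu i) ->
    \sum_(i in J :\ i0) mu i *: b i = - t *: b i0 ->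
    (exists mu : I -> R, [/\ forall i, 0 <= mu i, exists2 i, i \in J & 0 < mu i &
     \sum_(i in J) mu i *: b i = 0]).
  move=> t0 mu0 ex S.
  exists (fun i => if i == i0 then t else mu i); split.
  - by move=> i; case: ifP.
  - case: ex => [tt|[i]]; first by exists i0 => //; rewrite eqxx.
    by rewrite !inE => /andP[/negPf ii0 iJ] mi; exists i => //; rewrite ii0.
  - rewrite (big_setD1 i0)//= eqxx (eq_bigr (fun i => mu i *: b i)).
      by rewrite S scaleNr subrr.
    by move=> i; rewrite !inE => /andP[/negPf -> _].
have [[u Hu]|[mu [mu0 ex S]]] := IH (J :\ i0) b Jn; last first.
  by right; apply: (extend 0 mu) => //; [right|rewrite S oppr0 scale0r].
have [b0|b0] := eqVneq (b i0) 0.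
  right; apply: (extend 1 (fun=> 0)) => //; first by left.
  by rewrite b0 scaler0 big1// => i _; rewrite scale0r.
have bb := dot_gt0 b0.
have [[u' Hu']|[mu [mu0 [i1 i1J i1mu] S]]] := IH (J :\ i0) (fun i => reject (b i0) (b i)) Jn.
  left; pose w := reject (b i0) u'.
  have [eps e0 He] := @small_perturbation _ (J :\ i0) (fun i => dot w (b i))
    (fun i => dot (b i0) (b i))
    (fun i iJ => eq_ind_r (fun z => 0 < z) (Hu' i iJ) (dot_rejectl _ _ _)).
  exists (w + eps *: b i0) => i iJ; rewrite dotDl dotZl.
  have [->|ii0] := eqVneq i i0; last by apply: He; rewrite !inE ii0.
  by rewrite dot_rejectl reject_id// dot0r add0r mulr_gt0.
move/sum_reject: S; move: (\sum_(i in _) mu i * _) => t S.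
have [t0|t0] := leP t 0.
  right; apply: (extend (- t) mu); rewrite ?oppr_ge0//; first by right; exists i1.
  by rewrite opprK.
left; exists u => i iJ; have [->|ii0] := eqVneq i i0; last by apply: Hu; rewrite !inE ii0.
rewrite -(pmulr_rgt0 _ t0) -dotZr -S dot_sumr (bigD1 i1)//= dotZr.
rewrite ltr_pwDl ?mulr_gt0 ?Hu//; apply: sumr_ge0 => j /andP[jJ _].
by rewrite dotZr mulr_ge0// ltW// Hu.
Qed.

End Gordan.

(** * Convex hulls and their vertices *)

Section Hulls.
Variables (R : realType) (d : nat).
Implicit Types (u v w x : 'rV[R]_d) (S A P : set 'rV[R]_d).

(** The hull of a subfamily, so that generators can be removed one at a
    time. *)
Definition convon (I : finType) (a : I -> 'rV[R]_d) (J : {set I}) : set 'rV[R]_d :=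
  [set x | exists l : I -> R,
    [/\ forall i, 0 <= l i, \sum_(i in J) l i = 1 & x = \sum_(i in J) l i *: a i]].

Lemma convex_setP S : @convex_set R 'rV[R]_d S <->
  forall x y t, 0 <= t -> t <= 1 -> S x -> S y -> S (t *: x + (1 - t) *: y).
Proof.
split => [H x y t t0 t1 Sx Sy|H x y t].
  have := H x y (Itv01 t0 t1); rewrite !inE => /(_ Sx Sy).
  exact.
by rewrite !inE => Sx Sy; apply: H.
Qed.

Lemma convex_sum (I : finType) (a : I -> 'rV[R]_d) (J : {set I}) (l : I -> R) S :
  @convex_set R 'rV[R]_d S -> (forall i, i \in J -> S (a i)) ->
  (forall i, 0 <= l i) -> \sum_(i in J) l i = 1 -> S (\sum_(i in J) l i *: a i).
Proof.
move=> /convex_setP cS; have [n] := ubnP #|J|; elim: n J l => // n IH J l Jn Sa l0 l1.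
have [J0|[i0 i0J]] := set_0Vmem J.
  by move: l1; rewrite J0 big_set0 => /esym/eqP; rewrite oner_eq0.
move: Jn; rewrite (cardsD1 i0) i0J add1n ltnS => Jn.
move: l1; rewrite (big_setD1 i0)//= => l1; rewrite (big_setD1 i0)//=.
set T := \sum_(i in _) l i in l1.
have T0 : 0 <= T by apply: sumr_ge0.
have lT : l i0 = 1 - T by rewrite -l1 addrK.
have [TT|TT] := eqVneq T 0.
  rewrite big1 ?addr0 ?lT ?TT ?subr0 ?scale1r; first exact: Sa.
  by move=> i iJ; rewrite (psumr_eq0P _ TT) ?scale0r.
have Tgt : 0 < T by rewrite lt_neqAle eq_sym TT.
have -> : \sum_(i in J :\ i0) l i *: a i = T *: \sum_(i in J :\ i0) (l i / T) *: a i.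
  rewrite scaler_sumr; apply: eq_bigr => i _; rewrite scalerA; congr (_ *: _).
  by field.
rewrite -[X in X *: \sum_(i in _) _](subKr 1 T) -lT.
apply: cS => //; first by rewrite lT gerBl.
  exact: Sa.
apply: (IH _ (fun i => l i / T)) => //.
- by move=> i; rewrite !inE => /andP[_]; apply: Sa.
- by move=> i; rewrite divr_ge0.
- by rewrite -mulr_suml divff.
Qed.

Lemma convex_convon (I : finType) (a : I -> 'rV[R]_d) (J : {set I}) :
  @convex_set R 'rV[R]_d (convon a J).
Proof.
apply/convex_setP => x y t t0 t1 [l [l0 l1 ->]] [k [k0 k1 ->]].
exists (fun i => t * l i + (1 - t) * k i); split.
- by move=> i; rewrite addr_ge0 ?mulr_ge0 ?subr_ge0.
- by rewrite big_split /= -!mulr_sumr l1 k1 !mulr1 addrC subrK.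
- rewrite !scaler_sumr -big_split /=; apply: eq_bigr => i _.
  by rewrite [RHS]scalerDl !scalerA.
Qed.

Lemma mem_convon (I : finType) (a : I -> 'rV[R]_d) (J : {set I}) i : i \in J ->
  convon a J (a i).
Proof.
move=> iJ; exists (fun j => (j == i)%:R); split => [j||].
- exact: ler0n.
- rewrite (big_setD1 i)//= eqxx big1 ?addr0// => j.
  by rewrite !inE => /andP[/negPf ->].
- rewrite (big_setD1 i)//= eqxx scale1r big1 ?addr0// => j.
  by rewrite !inE => /andP[/negPf ->]; rewrite scale0r.
Qed.

Lemma convon_sub (I : finType) (a : I -> 'rV[R]_d) (J : {set I}) S :
  @convex_set R 'rV[R]_d S -> (forall i, i \in J -> S (a i)) -> convon a J `<=` S.
Proof. by move=> cS Sa x [l [l0 l1 ->]]; apply: convex_sum. Qed.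

Lemma conv_hull_convon (I : finType) (a : I -> 'rV[R]_d) (J : {set I}) :
  conv_hull [set a i | i in [set` J]] = convon a J.
Proof.
apply/seteqP; split.
  apply: smallest_sub; first exact: convex_convon.
  by move=> _ [i iJ <-]; exact: mem_convon.
move=> x Hx A [cA aA]; apply: (convon_sub cA _ Hx) => i iJ.
by apply: aA; exists i.
Qed.

Lemma convptsE n (a : 'I_n -> 'rV[R]_d) : convpts a = convon a [set: 'I_n]%SET.
Proof.
apply/seteqP; split => x [l [l0 l1 ->]]; exists l; split=> //;
  rewrite -?[RHS]l1; apply: eq_bigl => i; by rewrite inE.
Qed.

Lemma conv_hull2 v w x : conv_hull [set v; w] x <->
  exists t, [/\ 0 <= t, t <= 1 & x = v + t *: (w - v)].
Proof.
split.
  move/(_ [set x | exists t, [/\ 0 <= t, t <= 1 & x = v + t *: (w - v)]]); apply; split.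
    apply/convex_setP => y z s s0 s1 [t [t0 t1 ->]] [t' [t'0 t'1 ->]].
    exists (s * t + (1 - s) * t'); split.
    - by rewrite addr_ge0 ?mulr_ge0 ?subr_ge0.
    - rewrite -[leRHS](_ : s * 1 + (1 - s) * 1 = 1); last by ring.
      by rewrite lerD// ler_wpM2l// subr_ge0.
    by apply/rowP => i; rewrite !mxE; ring.
  move=> y [->|->]; first by exists 0; rewrite lexx ler01 scale0r addr0.
  by exists 1; rewrite lexx ler01 scale1r addrC subrK.
move=> [t [t0 t1 ->]] A [/convex_setP cA vwA].
have -> : v + t *: (w - v) = t *: w + (1 - t) *: v.
  by apply/rowP => i; rewrite !mxE; ring.
by apply: cA => //; apply: vwA; [right|left].
Qed.

(** This is [gordan] for the vectors [a i - x]: a relation between them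
    would exhibit x as a convex combination. *)
Lemma convon_alt (I : finType) (a : I -> 'rV[R]_d) (J : {set I}) x :
  ~ convon a J x -> exists u, forall i, i \in J -> dot u x < dot u (a i).
Proof.
move=> nx; have [[u Hu]|[mu [mu0 [i1 i1J i1mu] S]]] := gordan J (fun i => a i - x).
  by exists u => i iJ; rewrite -subr_gt0 -dotBr Hu.
exfalso; apply: nx; pose T := \sum_(i in J) mu i.
have T0 : 0 < T.
  by rewrite /T (big_setD1 i1)//= ltr_pwDl// sumr_ge0.
exists (fun i => mu i / T); split.
- by move=> i; rewrite divr_ge0// ltW.
- by rewrite -mulr_suml divff// gt_eqF.
have : T *: x = \sum_(i in J) mu i *: a i.
  apply/eqP; rewrite eq_sym -subr_eq0 scaler_suml -sumrB -[X in _ == X]S; apply/eqP.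
  by apply: eq_bigr => i _; rewrite scalerBr.
move=> /(congr1 (fun z => T^-1 *: z)); rewrite scalerA mulVf ?gt_eqF// scale1r => ->.
by rewrite scaler_sumr; apply: eq_bigr => i _; rewrite scalerA mulrC.
Qed.

Lemma convpts_enum (I : finType) (a : I -> 'rV[R]_d) (J : {set I}) :
  convpts (fun i : 'I_#|J| => a (enum_val i)) = convon a J.
Proof.
rewrite convptsE -!conv_hull_convon; congr conv_hull.
apply/seteqP; split => _ [i iJ <-] /=; first by exists (enum_val i) => //; exact: enum_valP.
by exists (enum_rank_in iJ i); rewrite /= ?inE// enum_rankK_in.
Qed.

Definition strictly_exposed n (a : 'I_n -> 'rV[R]_d) :=
  forall i, exists u, forall j, j != i -> dot u (a i) < dot u (a j).

(** In a minimal family of generators, none lies in the hull of the others,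
    so that [convon_alt] separates it from them. *)
Lemma exposed_generators A : finite_set A -> exists n (a : 'I_n -> 'rV[R]_d),
  conv_hull A = convpts a /\ strictly_exposed a.
Proof.
move=> /finite_seqP[s sA].
pose a0 (i : 'I_(size s)) := tnth (in_tuple s) i.
have PA : conv_hull A = convon a0 [set: 'I_(size s)]%SET.
  rewrite -conv_hull_convon sA; congr conv_hull.
  apply/seteqP; split => [x /=|_ [i _ <-] /=]; last exact: mem_tnth.
  by move=> /(tnthP (in_tuple s))[i ->]; exists i => //=; rewrite inE.
have [J0 /minsetP[/asboolP PJ Jmin]] := ex_minset
  (P := fun J : {set 'I_(size s)} => `[< conv_hull A = convon a0 J >])
  (ex_intro _ [set: 'I_(size s)]%SET (introT (asboolP _) PA)).
exists #|J0|, (fun i => a0 (enum_val i)); split; first by rewrite convpts_enum.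
move=> i; pose k := enum_val i; have kJ : k \in J0 by exact: enum_valP.
have nk : ~ convon a0 (J0 :\ k)%SET (a0 k).
  move=> H; suff /Jmin : `[< conv_hull A = convon a0 (J0 :\ k)%SET >].
    move=> /(_ (subsetDl _ _)) E; move: kJ; rewrite -E !inE eqxx //.
  apply/asboolP; rewrite PJ; apply/seteqP; split; apply: convon_sub; try exact: convex_convon.
    move=> j jJ; have [->//|jk] := eqVneq j k.
    by apply: mem_convon; rewrite !inE jk.
  by move=> j; rewrite !inE => /andP[_ jJ]; exact: mem_convon.
have [u Hu] := convon_alt nk; exists u => j ji; apply: Hu.
by rewrite !inE (inj_eq enum_val_inj) ji enum_valP.
Qed.

Lemma strictly_exposed_inj n (a : 'I_n -> 'rV[R]_d) : strictly_exposed a -> injective a.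
Proof.
move=> H i j aij; apply/eqP/negPn/negP => ij; have [u] := H j => /(_ i ij).
by rewrite aij ltxx.
Qed.

Lemma convpts_pt n (a : 'I_n -> 'rV[R]_d) i : convpts a (a i).
Proof. by rewrite convptsE; apply: mem_convon; rewrite inE. Qed.

Lemma convpts_dot_le n (a : 'I_n -> 'rV[R]_d) u b x :
  (forall i, dot u (a i) <= b) -> convpts a x -> dot u x <= b.
Proof.
move=> H [l [l0 l1 ->]]; rewrite dot_sumr -[b]mul1r -l1 mulr_suml.
by apply: ler_sum => i _; rewrite dotZr ler_wpM2l.
Qed.

Lemma convpts_face n (a : 'I_n -> 'rV[R]_d) u b (l : 'I_n -> R) :
  (forall i, dot u (a i) <= b) -> (forall i, 0 <= l i) -> \sum_i l i = 1 ->
  dot u (\sum_i l i *: a i) = b -> forall i, l i != 0 -> dot u (a i) = b.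
Proof.
move=> H l0 l1; rewrite dot_sumr => /eqP.
rewrite -[X in _ == X]mul1r -[X in _ == X * _]l1 mulr_suml -subr_eq0 -sumrB => /eqP E i li.
have := psumr_eq0P (P := xpredT) (F := fun i => l i * (b - dot u (a i))).
move=> /(_ _ _ i isT) K.
have : l i * (b - dot u (a i)) = 0.
  apply: K; first by move=> j _; rewrite mulr_ge0// subr_ge0.
  apply/eqP; rewrite -oppr_eq0 -sumrN -[X in _ == X]E; apply/eqP; apply: eq_bigr => j _.
  by rewrite dotZr; ring.
by move/eqP; rewrite mulf_eq0 (negbTE li) /= subr_eq0 => /eqP.
Qed.

(** By [convpts_face] a nonempty face contains a generator. If the face is a
    single point, it is this generator; conversely, a form that strictly
    exposes [a i] attains its bound only there. *)
Lemma vertices_convpts n (a : 'I_n -> 'rV[R]_d) : strictly_exposed a ->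
  vertices (convpts a) = range a.
Proof.
move=> ea; apply/seteqP; split => [v [u [b [Pb vE]]]|_ [i _ <-]].
  have [Pv vb] : (convpts a `&` [set x | dot u x = b]) v by rewrite -vE.
  have [l [l0 l1 vl]] := Pv.
  have [i li] : exists i, l i != 0.
    apply/existsP; apply: contraPT l1 => /existsPn H; rewrite big1; last first.
      by move=> j _; apply/eqP; have := H j; rewrite negbK.
    by move/esym/eqP; rewrite oner_eq0.
  exists i => //; suff : [set v] (a i) by [].
  rewrite vE; split; first exact: convpts_pt.
  apply: (convpts_face (l := l)) li => //; first by move=> j; apply: Pb; exact: convpts_pt.
  by rewrite -vl.
have [u Hu] := ea i; exists (- u), (dot (- u) (a i)).
have le_i j : dot (- u) (a j) <= dot (- u) (a i).
  by rewrite !dotNl lerN2; have [->//|/Hu/ltW] := eqVneq j i.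
split; first by move=> x Px; exact: convpts_dot_le Px.
apply/seteqP; split => x /=; first by move=> ->; split => //; exact: convpts_pt.
move=> [[l [l0 l1 ->]] E].
have H j : j != i -> l j = 0.
  move=> ji; apply/eqP; apply: contraT => lj.
  have := convpts_face le_i l0 l1 E lj; rewrite !dotNl => /oppr_inj.
  by have /[swap] -> := Hu j ji; rewrite ltxx.
move: l1; rewrite (bigD1 i)//= big1 ?addr0 => [l1|j /H//].
by rewrite (bigD1 i)//= big1 ?addr0 ?l1 ?scale1r// => j /H ->; rewrite scale0r.
Qed.

End Hulls.

(** * Edges and tangent cones *)

Section Edges.
Variables (R : realType) (d : nat).
Implicit Types (u v w x : 'rV[R]_d) (S A P : set 'rV[R]_d).

Definition coneon (I : finType) (b : I -> 'rV[R]_d) (J : {set I}) : set 'rV[R]_d :=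
  [set x | exists c : I -> R, (forall i, 0 <= c i) /\ x = \sum_(i in J) c i *: b i].

Lemma coneon_scale (I : finType) (b : I -> 'rV[R]_d) (J : {set I}) t x :
  0 <= t -> coneon b J x -> coneon b J (t *: x).
Proof.
move=> t0 [c [c0 ->]]; exists (fun i => t * c i); split; first by move=> i; rewrite mulr_ge0.
by rewrite scaler_sumr; apply: eq_bigr => i _; rewrite scalerA.
Qed.

Lemma coneon_add (I : finType) (b : I -> 'rV[R]_d) (J : {set I}) x y :
  coneon b J x -> coneon b J y -> coneon b J (x + y).
Proof.
move=> [c [c0 ->]] [k [k0 ->]]; exists (fun i => c i + k i).
split; first by move=> i; rewrite addr_ge0.
by rewrite -big_split; apply: eq_bigr => i _; rewrite scalerDl.
Qed.

Lemma coneon0 (I : finType) (b : I -> 'rV[R]_d) (J : {set I}) : coneon b J 0.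
Proof. by exists (fun=> 0); split => //; rewrite big1// => i _; rewrite scale0r. Qed.

Lemma mem_coneon (I : finType) (b : I -> 'rV[R]_d) (J : {set I}) i : i \in J ->
  coneon b J (b i).
Proof.
move=> iJ; exists (fun j => (j == i)%:R); split => [j|]; first exact: ler0n.
rewrite (big_setD1 i)//= eqxx scale1r big1 ?addr0// => j.
by rewrite !inE => /andP[/negPf ->]; rewrite scale0r.
Qed.

Lemma coneon_sub (I : finType) (b : I -> 'rV[R]_d) (J K : {set I}) :
  (forall i, i \in J -> coneon b K (b i)) -> coneon b J `<=` coneon b K.
Proof.
move=> H x [c [c0 ->]]; apply: (big_ind (coneon b K)).
- exact: coneon0.
- exact: coneon_add.
- by move=> i iJ; apply: coneon_scale => //; exact: H.
Qed.

Section AtVertex.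
Variables (n : nat) (a : 'I_n -> 'rV[R]_d) (i : 'I_n).
Hypothesis ea : strictly_exposed a.
Let P := convpts a.
Let b k := a k - a i.

Lemma vertex_convpts k : vertices P (a k).
Proof. by rewrite /P vertices_convpts//; exists k. Qed.

(** The face of P exposed by w is the segment from [a i] to the farthest
    generator on the ray of [b l], hence an edge. *)
Lemma exposed_ray_neighbour w l :
  l != i -> dot w (b l) = 0 -> (forall m, 0 <= dot w (b m)) ->
  (forall m, dot w (b m) = 0 -> exists2 g, 0 <= g & b m = g *: b l) ->
  exists2 m, neighbours P (a i) (a m) & exists2 t, 0 <= t & b l = t *: b m.
Proof.
move=> li wl w0 ray.
have al : a l != a i by rewrite (inj_eq (strictly_exposed_inj ea)).
have bl0 : b l != 0 by rewrite subr_eq0.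
pose M := [set m | dot w (b m) == 0]%SET.
have lM : l \in M by rewrite inE wl.
pose g m := dot (b m) (b l) / dot (b l) (b l).
have bb := dot_gt0 bl0.
have gE m : m \in M -> b m = g m *: b l /\ 0 <= g m.
  rewrite inE => /eqP /ray[t t0 bm]; rewrite /g bm dotZl mulfK ?gt_eqF//.
have gl : g l = 1 by rewrite /g divff ?gt_eqF.
pose m := [arg max_(m > l in M) g m]%O.
have [mM mmax] : m \in M /\ forall k, k \in M -> g k <= g m.
  by rewrite /m; case: arg_maxP.
have gm : 1 <= g m by rewrite -gl; exact: mmax.
have gm0 : 0 < g m by apply: lt_le_trans gm.
have [bmE _] := gE m mM.
exists m; last first.
  exists (g m)^-1; first by rewrite invr_ge0 ltW.
  by rewrite bmE scalerA mulVf ?scale1r// gt_eqF.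
have wle k : dot (- w) (a k) <= dot (- w) (a i).
  by rewrite !dotNl lerN2 -subr_ge0 -dotBr w0.
split; first exact: vertex_convpts.
  by rewrite -subr_eq0 -/(b m) bmE scaler_eq0 negb_or gt_eqF.
exists (- w), (dot (- w) (a i)); split.
  by move=> x Px; exact: convpts_dot_le Px.
apply/seteqP; split => x.
  move=> /conv_hull2[t [t0 t1 ->]]; split.
    have /convex_setP cP : @convex_set R 'rV[R]_d P by rewrite /P convptsE; exact: convex_convon.
    rewrite (_ : _ + _ = t *: a m + (1 - t) *: a i); last first.
      by apply/rowP => k; rewrite !mxE; ring.
    by apply: cP => //; exact: convpts_pt.
  rewrite /= dotDr dotZr -/(b m) (dotNl _ (b m)).
  by move: mM; rewrite inE => /eqP ->; rewrite oppr0 mulr0 addr0.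
move=> [[l' [l0 l1 xE]] /= xw].
have supp k : k \notin M -> l' k = 0.
  move=> kM; apply/eqP; apply: contraNT kM => lk; rewrite inE dotBr subr_eq0.
  rewrite xE in xw.
  by have := convpts_face wle l0 l1 xw lk; rewrite !dotNl => /oppr_inj ->.
pose th := \sum_k l' k * g k.
have xE' : x = a i + th *: b l.
  rewrite xE /th scaler_suml -[X in X + _]scale1r -l1 scaler_suml -big_split /=.
  apply: eq_bigr => k _; rewrite -scalerA.
  have [kM|/supp ->] := boolP (k \in M); last by rewrite !scale0r addr0.
  by have [<- _] := gE k kM; rewrite -scalerDr /b addrC subrK.
apply/conv_hull2; exists (th / g m); split.
- rewrite divr_ge0 ?(ltW gm0)//; apply: sumr_ge0 => k _.
  have [kM|/supp ->] := boolP (k \in M); last by rewrite mul0r.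
  by rewrite mulr_ge0//; have [] := gE k kM.
- rewrite ler_pdivrMr// -l1 mulr_suml; apply: ler_sum => k _.
  have [kM|/supp ->] := boolP (k \in M); last by rewrite !mul0r.
  by rewrite ler_wpM2l// mmax.
- by rewrite -/(b m) bmE scalerA divfK ?gt_eqF.
Qed.

(** Take a minimal set of generators spanning the tangent cone. None of its
    vectors is a combination of the others, so that [gordan], applied to the
    rejections from one vector, gives a form that exposes the ray of this
    vector: in the other alternative, a multiple of this vector is a
    combination of the others, with a positive factor because of the form
    that exposes the vertex. *)
Lemma cone_neighbours j :
  coneon b [set k | `[< neighbours P (a i) (a k) >]]%SET (b j).
Proof.
have [u0 Hu0] := ea i.
have u0b k : k != i -> 0 < dot u0 (b k) by move=> /Hu0; rewrite dotBr subr_gt0.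
have bi : b i = 0 by rewrite /b subrr.
pose Q (J : {set 'I_n}) := (i \notin J) && `[< forall j, coneon b J (b j) >].
have Q0 : exists J, Q J.
  exists (~: [set i])%SET; rewrite /Q !inE eqxx; apply/asboolP => k.
  have [->|ki] := eqVneq k i; first by rewrite bi; exact: coneon0.
  by apply: mem_coneon; rewrite !inE.
have [J /minsetP[/andP[iJ /asboolP PJ] Jmin]] := ex_minset Q0.
apply: coneon_sub (PJ j) => l lJ.
have li : l != i by apply: contraNneq iJ => <-.
have bl0 : b l != 0.
  by apply/eqP => E; have := u0b l li; rewrite E dot0r ltxx.
have bb := dot_gt0 bl0.
have nl : ~ coneon b (J :\ l)%SET (b l).
  move=> H; suff /Jmin : Q (J :\ l)%SET.
    by move=> /(_ (subsetDl _ _)) E; move: lJ; rewrite -E !inE eqxx.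
  apply/andP; split; first by rewrite !inE negb_and iJ orbT.
  apply/asboolP => k; apply: coneon_sub (PJ k) => m mJ.
  have [->//|ml] := eqVneq m l.
  by apply: mem_coneon; rewrite !inE ml.
have [[u' Hu']|[mu [mu0 [m1 m1J m1mu] S]]] :=
    gordan (J :\ l) (fun k => reject (b l) (b k)); last first.
  move/sum_reject: S; move: (\sum_(i in _) mu i * _) => t S.
  have sumu : 0 < dot u0 (t *: b l).
    rewrite -S dot_sumr (big_setD1 m1)//= dotZr ltr_pwDl//.
      rewrite mulr_gt0// u0b//; apply: contraNneq iJ => <-.
      by move: m1J; rewrite !inE => /andP[].
    apply: sumr_ge0 => k; rewrite !inE => /and3P[_ _ kJ].
    by rewrite dotZr mulr_ge0// ltW// u0b//; apply: contraNneq iJ => <-.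
  rewrite dotZr pmulr_lgt0 ?u0b// in sumu.
  exfalso; apply: nl; exists (fun k => t^-1 * mu k); split.
    by move=> k; rewrite mulr_ge0// invr_ge0 ltW.
  rewrite (eq_bigr (fun k => t^-1 *: (mu k *: b k))); last by move=> k _; rewrite scalerA.
  by rewrite -scaler_sumr S scalerA mulVf ?scale1r// gt_eqF.
pose w := reject (b l) u'.
have wl : dot w (b l) = 0 by rewrite dot_rejectl reject_id ?dot0r.
have wJ k : k \in (J :\ l)%SET -> 0 < dot w (b k) by move=> /Hu'; rewrite dot_rejectl.
have decomp m : exists2 c : 'I_n -> R, forall k, 0 <= c k &
    b m = c l *: b l + \sum_(k in (J :\ l)%SET) c k *: b k.
  by have [c [c0 ->]] := PJ m; exists c => //; rewrite (big_setD1 l).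
have w0 m : 0 <= dot w (b m).
  have [c c0 ->] := decomp m; rewrite dotDr dotZr wl mulr0 add0r dot_sumr.
  by apply: sumr_ge0 => k kJ; rewrite dotZr mulr_ge0// ltW// wJ.
have ray m : dot w (b m) = 0 -> exists2 g, 0 <= g & b m = g *: b l.
  have [c c0 ->] := decomp m; rewrite dotDr dotZr wl mulr0 add0r dot_sumr => E.
  exists (c l) => //; rewrite [X in _ + X]big1 ?addr0// => k kJ.
  have pos q : q \in (J :\ l)%SET -> 0 <= dot w (c q *: b q).
    by move=> qJ; rewrite dotZr mulr_ge0// ltW// wJ.
  have := psumr_eq0P pos E kJ; rewrite dotZr => /eqP.
  by rewrite mulf_eq0 (gt_eqF (wJ k kJ)) orbF => /eqP ->; rewrite scale0r.
have [m nm [t t0 ->]] := exposed_ray_neighbour li wl w0 ray.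
apply: coneon_scale => //; apply: mem_coneon; rewrite inE; exact/asboolP.
Qed.
End AtVertex.

Definition edge_matrix (e : 'rV[R]_d -> 'I_d -> 'rV[R]_d) v : 'M[R]_d :=
  \matrix_(k < d) edge_vector e v k.

(** All that is needed from the geometry of P. The d edge vectors at a
    vertex span the tangent cone; they are linearly independent because P
    lies in no hyperplane. *)
Lemma simple_polytope_structure P e :
  convex_polytope P -> edge_labelling P e ->
  exists n (a : 'I_n -> 'rV[R]_d), [/\ P = convpts a, strictly_exposed a,
   (forall u b, u != 0 -> exists i, dot u (a i) != b),
   (forall i, edge_matrix e (a i) \in unitmx /\
      forall k, exists2 j, j != i & e (a i) k = a j) &
   (forall i j, exists2 c : 'rV[R]_d, forall k, 0 <= c 0 k &
        a j = a i + c *m edge_matrix e (a i))].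
Proof.
move=> [A [fA PA nH]] eP.
have [n [a [Aa ea]]] := exposed_generators fA; exists n, a.
have Pa : P = convpts a by rewrite PA.
have vP : vertices P = range a by rewrite Pa vertices_convpts.
have eN i k : neighbours P (a i) (e (a i) k).
  have [H _ _] : set_bij [set: 'I_d] (neighbours P (a i)) (e (a i)).
    by apply: eP; rewrite vP; exists i.
  exact: H.
have cone i j : exists2 c : 'rV[R]_d, forall k, 0 <= c 0 k &
    a j = a i + c *m edge_matrix e (a i).
  have [H1 _ H3] : set_bij [set: 'I_d] (neighbours P (a i)) (e (a i)).
    by apply: eP; rewrite vP; exists i.
  suff [c [c0 H]] : coneon (fun k : 'I_d => edge_vector e (a i) k) [set: 'I_d]%SET (a j - a i).
    exists (\row_k c k) => [k|]; first by rewrite mxE.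
    rewrite mulmx_edges -[LHS](subrK (a i)) addrC H; congr (_ + _).
    by apply: eq_big => k; rewrite ?inE// => _; rewrite mxE rowK.
  have [c [c0 ->]] := cone_neighbours i ea j.
  apply: (big_ind (coneon _ _)); [exact: coneon0|exact: coneon_add|].
  move=> k; rewrite inE -Pa => /asboolP /H3[m _ mE].
  apply: coneon_scale => //; rewrite -mE; apply: mem_coneon; by rewrite inE.
have spans u b : u != 0 -> exists i, dot u (a i) != b.
  move=> u0; apply: contrapT => H.
  have /nH : affine_hyperplane [set x | dot u x = b] by exists u, b.
  apply => x Ax; have : convpts a x.
    by rewrite -Aa => M [_ AM]; exact: AM.
  move=> [l [l0 l1 ->]] /=; rewrite dot_sumr -[RHS]mul1r -l1 mulr_suml.
  apply: eq_bigr => i _; rewrite dotZr; congr (_ * _).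
  by apply/eqP/negPn/negP => ui; apply: H; exists i.
split => // i; split.
- rewrite -unitmx_tr -row_free_unit -kermx_eq0.
  apply/negPn/negP => /rowV0Pn[u /sub_kermxP uW u0].
  have [j] := spans u (dot u (a i)) u0; have [c _ ->] := cone i j.
  rewrite dotDr [dot u (_ *m _)]dotE trmx_mul mulmxA uW mul0mx mxE addr0 eqxx //.
- move=> k; have [vk ka _] := eN i k.
  move: vk ka; rewrite vP => -[j _ <-]; rewrite (inj_eq (strictly_exposed_inj ea)) => ji.
  by exists j.
Qed.

End Edges.

(** * Exchange of basis vectors *)

Section Exchange.
Variables (R : realType) (m n : nat) (b : 'I_n -> 'rV[R]_m) (h : 'I_n -> R).
Implicit Types (s : {ffun 'I_m -> 'I_n}) (y : 'rV[R]_m).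

Definition basis_mx s : 'M[R]_m := \matrix_(k < m) b (s k).
Definition basis s := basis_mx s \in unitmx.
Definition coords s y := y *m invmx (basis_mx s).
Definition in_cone s y := [forall k, 0 <= coords s y 0 k].
(** The value at y of the linear function with the values h on the basis s. *)
Definition cost s y := \sum_k coords s y 0 k * h (s k).

Lemma coordsD s y z : coords s (y + z) = coords s y + coords s z.
Proof. exact: mulmxDl. Qed.
Lemma coordsZ s c y : coords s (c *: y) = c *: coords s y.
Proof. by rewrite /coords scalemxAl. Qed.
Lemma coordsDZ s y c z k :
  coords s (y + c *: z) 0 k = coords s y 0 k + c * coords s z 0 k.
Proof. by rewrite coordsD coordsZ mxE [X in _ + X]mxE. Qed.
Lemma costD s y z : cost s (y + z) = cost s y + cost s z.
Proof.
by rewrite /cost coordsD -big_split; apply: eq_bigr => k _; rewrite mxE mulrDl.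
Qed.
Lemma costZ s c y : cost s (c *: y) = c * cost s y.
Proof.
by rewrite /cost coordsZ mulr_sumr; apply: eq_bigr => k _; rewrite mxE mulrA.
Qed.
Lemma cost0 s : cost s 0 = 0.
Proof. by rewrite -(scale0r (0 : 'rV[R]_m)) costZ mul0r. Qed.
Lemma cost_sum s (I : finType) (f : I -> 'rV[R]_m) : cost s (\sum_i f i) = \sum_i cost s (f i).
Proof. by apply: (big_morph (cost s)); [exact: costD|exact: cost0]. Qed.

Lemma coords_comb s y : basis s -> y = \sum_k coords s y 0 k *: b (s k).
Proof.
move=> bs; rewrite -[LHS](mulmxKV bs) mulmx_sum_row.
by apply: eq_bigr => k _; rewrite rowK.
Qed.

Lemma comb_coords s (c : 'I_m -> R) : basis s ->
  coords s (\sum_k c k *: b (s k)) = \row_k c k.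
Proof.
move=> bs; rewrite (_ : \sum_k _ = (\row_k c k) *m basis_mx s) ?[LHS]mulmxK//.
by rewrite mulmx_sum_row; apply: eq_bigr => k _; rewrite mxE rowK.
Qed.

Lemma cost_comb s (c : 'I_m -> R) : basis s ->
  cost s (\sum_k c k *: b (s k)) = \sum_k c k * h (s k).
Proof. by move=> bs; rewrite /cost comb_coords//; apply: eq_bigr => k _; rewrite mxE. Qed.

Definition swap s k i : {ffun 'I_m -> 'I_n} := [ffun l => if l == k then i else s l].

Lemma basis_swap s k i : basis s -> coords s (b i) 0 k != 0 -> basis (swap s k i).
Proof.
move=> bs gk; rewrite /basis -row_free_unit -kermx_eq0.
apply/negPn/negP => /rowV0Pn[u /sub_kermxP uB u0]; move/negP: u0; apply.
pose c l := (if l == k then 0 else u 0 l) + u 0 k * coords s (b i) 0 l.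
have : \sum_l c l *: b (s l) = 0.
  rewrite -[RHS]uB mulmx_sum_row (bigD1 k)//= [RHS](bigD1 k)//= rowK ffunE eqxx.
  rewrite [in RHS](coords_comb (b i) bs) [in RHS](bigD1 k)//= scalerDr scalerA.
  rewrite {1}/c eqxx add0r -addrA; congr (_ + _).
  rewrite scaler_sumr -big_split /=; apply: eq_bigr => l lk.
  by rewrite /c (negbTE lk) rowK ffunE (negbTE lk) scalerDl scalerA addrC.
move=> /(congr1 (coords s)); rewrite comb_coords// /coords mul0mx => /rowP c0.
have uk : u 0 k = 0.
  by have := c0 k; rewrite !mxE /c eqxx add0r => /eqP; rewrite mulf_eq0 (negbTE gk) orbF => /eqP.
apply/eqP/rowP => l; rewrite mxE; have [->//|lk] := eqVneq l k.
by have := c0 l; rewrite !mxE /c (negbTE lk) uk mul0r addr0.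
Qed.

Definition improves s' y v := [/\ basis s', in_cone s' y & cost s' y <= v].

(** A pivot of the simplex method: [y + x *: b i] lies in the facet opposite
    to [b (s k)], where the swap changes no coordinate, and the remaining
    multiple [t - x] of [b i] costs [h i] per unit. *)
Lemma exchange_step s y i k (t x : R) : basis s ->
  coords s (b i) 0 k != 0 ->
  coords s y 0 k + x * coords s (b i) 0 k = 0 ->
  (forall l, 0 <= coords s y 0 l + x * coords s (b i) 0 l) ->
  x <= t -> x * (cost s (b i) - h i) <= 0 ->
  improves (swap s k i) (y + t *: b i) (cost s y + t * h i).
Proof.
move=> bs gk ck c0 xt xc.
have bs' := basis_swap bs gk.
pose c l := if l == k then t - x else coords s y 0 l + x * coords s (b i) 0 l.
have E : y + x *: b i = \sum_(l | l != k) c l *: b (swap s k i l).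
  rewrite [LHS](coords_comb _ bs) (bigD1 k)//= coordsDZ ck scale0r add0r.
  by apply: eq_bigr => l lk; rewrite /c (negbTE lk) ffunE (negbTE lk) coordsDZ.
have rep : y + t *: b i = \sum_l c l *: b (swap s k i l).
  rewrite (bigD1 k)//= -E /c eqxx ffunE eqxx scalerBl.
  by rewrite [X in _ = _ + X]addrC addrA subrK addrC.
split => //.
  apply/forallP => l; rewrite rep comb_coords// mxE /c.
  by case: ifP => _; rewrite ?subr_ge0 ?c0.
rewrite rep cost_comb// (bigD1 k)//= /c eqxx ffunE eqxx.
have -> : \sum_(l | l != k) (if l == k then t - x else
    coords s y 0 l + x * coords s (b i) 0 l) * h (swap s k i l) = cost s y + x * cost s (b i).
  rewrite -costZ -costD /cost [RHS](bigD1 k)//= coordsDZ ck mul0r add0r.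
  by apply: eq_bigr => l lk; rewrite (negbTE lk) ffunE (negbTE lk) coordsDZ.
by move: xc; lra.
Qed.

(** The index k is the one whose coordinate vanishes first when x grows in
    be + x de. *)
Lemma ratio_test (be de : 'I_m -> R) l0 : (forall l, 0 <= be l) -> de l0 < 0 ->
  exists k, de k < 0 /\ forall l, 0 <= be l + (be k / - de k) * de l.
Proof.
move=> be0 dl0.
case: (@arg_minP _ _ _ l0 (fun l => de l < 0) (fun l => be l / - de l)) => // k dk kmin.
exists k; split => // l; have [dl|dl] := ltP (de l) 0.
  have := kmin l dl; rewrite ler_pdivlMr ?oppr_gt0// mulrN => H.
  by rewrite -lerBlDr sub0r.
by rewrite addr_ge0// mulr_ge0// divr_ge0// oppr_ge0 ltW.
Qed.

Variable f : 'cV[R]_m.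
Hypothesis bf : forall i, (b i *m f) 0 0 = 1.

(** If [b i] is at most as expensive in s as [h i], keep s as far as
    possible on the way from y to [y + t *: b i], and pivot at the exit of
    the cone. Otherwise it pays to go backwards and to pivot where [y - x *:
    b i] leaves the cone; it does leave it, because the coordinates of [b i]
    sum to 1. *)
Lemma exchange s y i t : basis s -> in_cone s y -> 0 <= t ->
  exists s', improves s' (y + t *: b i) (cost s y + t * h i).
Proof.
move=> bs /forallP y0 t0; pose g l := coords s (b i) 0 l.
have [ci|ci] := leP (cost s (b i)) (h i).
  have [/forallP all0|] := boolP [forall l, 0 <= coords s y 0 l + t * g l].
    exists s; split => //; last by rewrite costD costZ lerD2l ler_wpM2l.
    by apply/forallP => l; rewrite coordsDZ.
  rewrite negb_forall => /existsP[l0]; rewrite -ltNge => l0t.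
  have gl0 : g l0 < 0.
    rewrite ltNge; apply/negP => gl; move: l0t; rewrite ltNge => /negP; apply.
    by rewrite addr_ge0// mulr_ge0.
  have [k [gk H]] := ratio_test (be := fun l => coords s y 0 l) y0 gl0.
  set x := _ / _ in H.
  have x0 : 0 <= x by rewrite divr_ge0// oppr_ge0 ltW.
  have xt : x <= t.
    have : (x - t) * g l0 >= 0 by have := H l0; rewrite /= mulrBl; lra.
    by rewrite nmulr_lge0// subr_le0.
  exists (swap s k i); apply: (exchange_step (x := x)) => //.
  - by rewrite lt_eqF.
  - by rewrite /x -/(g k) invrN mulrN mulNr divfK ?subrr// lt_eqF.
  - by rewrite mulr_ge0_le0// subr_le0.
have [l0 gl0] : exists l, 0 < g l.
  apply/existsP; apply: contraT; rewrite negb_exists => /forallP H.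
  have : \sum_l g l <= 0 by apply: sumr_le0 => l _; rewrite leNgt.
  rewrite leNgt => /negP[]; rewrite (_ : \sum_l g l = 1) ?ltr01// -(bf i).
  rewrite [in RHS](coords_comb (b i) bs) mulmx_suml summxE.
  by apply: eq_bigr => l _; rewrite -scalemxAl mxE bf mulr1.
have [k [gk H]] := ratio_test (be := fun l => coords s y 0 l) (de := fun l => - g l) (l0 := l0)
  y0 (eq_ind_r (fun z => is_true z) gl0 (oppr_lt0 (g l0))).
rewrite opprK in H; set x := _ / _ in H; rewrite oppr_lt0 in gk.
have x0 : 0 <= x by rewrite divr_ge0// ltW.
exists (swap s k i); apply: (exchange_step (x := - x)) => //.
- by rewrite gt_eqF.
- by rewrite /x -/(g k) mulNr divfK ?subrr// gt_eqF.
- by move=> l; rewrite mulNr -mulrN.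
- by apply: (le_trans _ t0); rewrite oppr_le0.
- by rewrite mulNr oppr_le0 mulr_ge0// subr_ge0 ltW.
Qed.

(** Caratheodory's theorem; the terms are added one by one with [exchange]. *)
Lemma cone_basis s0 (I : Type) (r : seq I) (l : I -> R) (p : I -> 'I_n) : basis s0 ->
  (forall i, 0 <= l i) -> exists2 s, basis s & in_cone s (\sum_(i <- r) l i *: b (p i)).
Proof.
move=> bs0 l0; elim: r => [|i r [s bs cs]].
  exists s0 => //; rewrite big_nil; apply/forallP => k.
  by rewrite /coords mul0mx mxE.
have [s' [bs' cs' _]] := exchange (p i) bs cs (l0 i).
by exists s' => //; rewrite big_cons addrC.
Qed.

(** Take the cheapest basis s whose cone contains y. If y is interior, then
    [y - eps *: b i] still belongs to the cone; putting [eps *: b i] back by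
    an exchange costs at most eps [h i] and cannot undercut s. *)
Lemma optimal_basis y : (exists2 s, basis s & in_cone s y) ->
  exists s, [/\ basis s, in_cone s y &
    (forall k, 0 < coords s y 0 k) -> forall i, cost s (b i) <= h i].
Proof.
move=> [s0 bs0 cs0].
have := @arg_minP _ _ _ s0 (fun s => basis s && in_cone s y) (fun s => cost s y).
rewrite bs0 cs0 => /(_ isT) [s /andP[bs cs] smin].
exists s; split => // pos i.
have [eps e0 He] := @small_perturbation R _ [set: 'I_m]%SET (fun k => coords s y 0 k)
  (fun k => - coords s (b i) 0 k) (fun k _ => pos k).
have cy' : in_cone s (y - eps *: b i).
  apply/forallP => k; rewrite -scaleNr coordsDZ mulNr -mulrN ltW//.
  exact: He.
have [s' [bs' cs' cost']] := exchange i bs cy' (ltW e0).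
rewrite subrK in cs' cost'.
have := smin s'; rewrite bs' cs' => /(_ isT) /le_trans /(_ cost').
rewrite -scaleNr costD costZ => H.
by rewrite -(ler_pM2l e0); move: H; lra.
Qed.

End Exchange.

(** * Regular triangulations *)

Section GenericHeights.
Variable R : realType.

Lemma poly_nonroot_seq (p : {poly R}) (g : nat -> R) : injective g -> p != 0 ->
  exists k, p.[g k] != 0.
Proof.
move=> gI p0; apply: contrapT => H.
have := @max_poly_roots _ p [seq g i | i <- iota 0 (size p)] p0.
rewrite size_map size_iota ltnn => K; apply: notF; apply: K.
  apply/allP => _ /mapP[k _ ->]; apply/negPn/negP => px; apply: H; exists k; exact: px.
by rewrite map_inj_uniq ?iota_uniq.
Qed.

Lemma poly_nonroot (p : {poly R}) : p != 0 -> exists x, p.[x] != 0.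
Proof.
have natI : injective (fun k => k%:R : R) by move=> i j /eqP; rewrite eqr_nat => /eqP.
by move=> /(poly_nonroot_seq natI)[k pk]; exists k%:R.
Qed.

(** The heights are x ^+ i, where x is not a root of the nonzero polynomials
    that express the coincidences to be avoided. *)
Lemma generic_heights m n (b : 'I_n -> 'rV[R]_m) : exists h : 'I_n -> R,
  forall s, basis b s -> forall i, cost b h s (b i) = h i -> exists k, i = s k.
Proof.
pose q (s : {ffun 'I_m -> 'I_n}) (i : 'I_n) : {poly R} :=
  'X^i - \sum_k coords b s (b i) 0 k *: 'X^(s k).
pose Q : {poly R} := \prod_(si : {ffun 'I_m -> 'I_n} * 'I_n | q si.1 si.2 != 0) q si.1 si.2.
have Q0 : Q != 0 by apply/prodf_neq0 => i.
have [x Qx] := poly_nonroot Q0; exists (fun i => x ^+ i) => s bs i E.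
have [/existsP[k /eqP]|] := boolP [exists k, i == s k]; first by exists k.
rewrite negb_exists => /forallP H; exfalso.
have qx : (q s i).[x] = 0.
  rewrite /q hornerD hornerN hornerXn horner_sum -[X in X - _]E /cost.
  by apply/eqP; rewrite subr_eq0; apply/eqP; apply: eq_bigr => k _; rewrite hornerZ hornerXn.
have qn : q s i != 0.
  apply/eqP => /polyP/(_ i)/eqP; rewrite coef0 coefB coefXn eqxx coef_sum big1 ?subr0 ?oner_eq0//.
  by move=> k _; rewrite coefZ coefXn (inj_eq val_inj) (negbTE (H k)) mulr0.
by move: Qx; rewrite /Q horner_prod (bigD1 (s, i))//= qx mul0r eqxx.
Qed.

End GenericHeights.

Section Triangulation.
Variables (R : realType) (d n : nat) (a : 'I_n -> 'rV[R]_d).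
Local Notation RR := (measurableTypeR R).
Local Notation lam := (lebesgue_tuple R d).
Hypothesis spans : forall u b, u != 0 -> exists i, dot u (a i) != b.

(** Affine combinations become linear ones, and simplices become cones. *)
Definition homogenize (x : 'rV[R]_d) : 'rV[R]_d.+1 :=
  \row_k (if unlift ord0 k is Some j then x 0 j else 1).
Let b i := homogenize (a i).
Let f : 'cV[R]_d.+1 := delta_mx 0 0.
Local Notation simplex s := (convpts (fun k => a (s k))).

Lemma homogenize0 x : homogenize x 0 0 = 1.
Proof. by rewrite mxE unlift_none. Qed.

Lemma homogenizeS x k : homogenize x 0 (lift ord0 k) = x 0 k.
Proof. by rewrite mxE liftK. Qed.

Lemma homogenize_f i : (b i *m f) 0 0 = 1.
Proof.
rewrite mxE (bigD1 ord0)//= big1 ?addr0.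
  by rewrite homogenize0 mxE !eqxx mulr1.
by move=> j /negPf j0; rewrite !mxE j0 mulr0.
Qed.

Lemma homogenize_comb (I : finType) (l : I -> R) (p : I -> 'rV[R]_d) :
  \sum_i l i = 1 -> \sum_i l i *: homogenize (p i) = homogenize (\sum_i l i *: p i).
Proof.
move=> l1; apply/rowP => k; rewrite summxE.
case: (unliftP ord0 k) => [j ->|->].
  by rewrite homogenizeS summxE; apply: eq_bigr => i _; rewrite [LHS]mxE homogenizeS [RHS]mxE.
by rewrite homogenize0 -l1; apply: eq_bigr => i _; rewrite mxE homogenize0 mulr1.
Qed.

Lemma homogenize_comb_inv (I : finType) (l : I -> R) (p : I -> 'rV[R]_d) x :
  \sum_i l i *: homogenize (p i) = homogenize x -> \sum_i l i = 1 /\ x = \sum_i l i *: p i.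
Proof.
move=> E.
have l1 : \sum_i l i = 1.
  rewrite -(homogenize0 x) -E summxE; apply: eq_bigr => i _.
  by rewrite mxE homogenize0 mulr1.
split => //; apply/rowP => k; rewrite -homogenizeS -E homogenize_comb// homogenizeS //.
Qed.

Lemma in_simplexP s x : basis b s -> simplex s x <-> in_cone b s (homogenize x).
Proof.
move=> bs; split.
  move=> [l [l0 l1 ->]]; rewrite -homogenize_comb//; apply/forallP => k.
  by rewrite (comb_coords _ bs) mxE.
move=> /forallP c0.
have [l1 xE] := homogenize_comb_inv (esym (coords_comb (homogenize x) bs)).
by exists (fun k => coords b s (homogenize x) 0 k).
Qed.

Lemma basis_edges s k : basis b s -> edge_mx (fun k => a (s k)) k \in unitmx.
Proof.
move=> bs; rewrite -row_free_unit -kermx_eq0.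
apply/negPn/negP => /rowV0Pn[u /sub_kermxP uW u0]; move/negP: u0; apply.
pose c i := if unlift k i is Some j then u 0 j else - \sum_j u 0 j.
have ck : c k = - \sum_j u 0 j by rewrite /c unlift_none.
have cl j : c (lift k j) = u 0 j by rewrite /c liftK.
have : \sum_i c i *: b (s i) = 0.
  rewrite (bigD1_ord k)//= ck scaleNr scaler_suml -sumrN -big_split /=.
  apply/rowP => i; rewrite summxE [RHS]mxE; case: (unliftP ord0 i) => [j ->|->]; last first.
    by apply: big1 => q _; rewrite cl !mxE !unlift_none !mulr1 addNr.
  transitivity ((u *m edge_mx (fun k => a (s k)) k) 0 j); last by rewrite uW mxE.
  rewrite mxE; apply: eq_bigr => q _.
  by rewrite cl !mxE !liftK; ring.
move=> /(congr1 (coords b s)); rewrite (comb_coords _ bs) /coords mul0mx => /rowP c0.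
by apply/eqP/rowP => j; have := c0 (lift k j); rewrite !mxE cl.
Qed.

Lemma exists_basis : (0 < n)%N -> exists s, basis b s.
Proof.
move=> n0; pose B := \matrix_(i < n) b i.
have fB : row_full B.
  rewrite -cokermx_eq0; apply/negPn/negP => B0.
  have [j Bj] : exists j, col j (cokermx B) != 0.
    apply: contrapT => H; move/negP: B0; apply; apply/eqP/matrixP => i j; rewrite mxE.
    have : col j (cokermx B) = 0 by apply/eqP/negPn/negP => ?; apply: H; exists j.
    by move/colP/(_ i); rewrite !mxE.
  pose v := col j (cokermx B).
  have Bv i : (b i *m v) 0 0 = 0.
    have : B *m v = 0 by rewrite /v colE mulmxA mulmx_coker mul0mx.
    by move=> /(congr1 (row i)); rewrite row_mul rowK row0 => ->; rewrite mxE.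
  pose u : 'rV[R]_d := \row_k v (lift ord0 k) 0.
  have bv i : (b i *m v) 0 0 = v 0 0 + dot u (a i).
    rewrite mxE big_ord_recl homogenize0 mul1r /dot; congr (_ + _).
    by apply: eq_bigr => k _; rewrite homogenizeS mulrC [u 0 k]mxE.
  have [u0|u0] := eqVneq u 0.
    have v0 : v 0 0 = 0 by rewrite -(Bv (Ordinal n0)) bv u0 dot0l addr0.
    move/negP: Bj; apply; apply/eqP/colP => k; rewrite [RHS]mxE -/v.
    case: (unliftP ord0 k) => [i ->|->//].
    by move/rowP: u0 => /(_ i); rewrite !mxE.
  have [i] := spans (- v 0 0) u0.
  by rewrite -subr_eq0 opprK addrC -bv Bv eqxx.
exists (finfun (fullrankfun fB)).
rewrite /basis (_ : basis_mx _ _ = rowsub (fullrankfun fB) B).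
  exact: fullrowsub_unit.
by apply/matrixP => i j; rewrite !mxE ffunE.
Qed.

(** A hyperplane through the points with indices in [S] if there is one, and
    the empty set 0 = 1 otherwise. Any choice will do, since it contains the
    affine hull of these points. *)
Definition hyperplane_through (S : {set 'I_n}) : 'rV[R]_d * R :=
  if pselect (exists ub : 'rV[R]_d * R,
     ub.1 != 0 /\ forall i, i \in S -> dot ub.1 (a i) = ub.2) is left e
  then projT1 (cid e) else (0, 1).

Definition degenerate : set (d.-tuple RR) :=
  \big[setU/set0]_(S : {set 'I_n})
    [set t | dot (hyperplane_through S).1 (row_of t) = (hyperplane_through S).2].

Lemma negligible_degenerate : lam.-negligible degenerate.
Proof.
apply: (big_ind (fun A => lam.-negligible A)).
- exact: negligible_set0.
- by move=> A B; exact: negligibleU.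
move=> S _; eexists; split; [ | | exact: subset_refl].
  exact: measurable_hyperplane.
rewrite /hyperplane_through; case: pselect => [e|_] /=.
  by apply: lebesgue_hyperplane; have [] := projT2 (cid e).
rewrite (_ : mkset _ = set0) ?measure0//; apply/seteqP; split => t //=.
by rewrite dot0l => /esym/eqP; rewrite oner_eq0.
Qed.

(** Otherwise the points with nonzero coefficient would lie in a hyperplane,
    hence t would lie in the one chosen for their set of indices. *)
Lemma nondegenerate_spans t (I : finType) (l : I -> R) (p : I -> 'I_n) u c :
  ~ degenerate t -> \sum_i l i = 1 -> row_of t = \sum_i l i *: a (p i) -> u != 0 ->
  exists2 i, l i != 0 & dot u (a (p i)) != c.
Proof.
move=> nt l1 tE u0; apply: contrapT => H; apply: nt.
pose S := [set p i | i in [set i | l i != 0]%SET]%SET.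
rewrite /degenerate (bigD1 S)//=; left; rewrite /= /hyperplane_through.
case: pselect => [e|]; last first.
  case; exists (u, c); split => //= _ /imsetP[i + ->]; rewrite inE => li.
  by apply/eqP/negPn/negP => ui; apply: H; exists i.
have [_ HS] := projT2 (cid e); move: (projT1 _) HS => [u' c'] /= HS.
rewrite tE dot_sumr -[RHS]mul1r -l1 mulr_suml; apply: eq_bigr => i _.
rewrite dotZr; have [->|li] := eqVneq (l i) 0; first by rewrite !mul0r.
by rewrite HS// imset_f// inE.
Qed.

Lemma coords_gt0 t s : ~ degenerate t -> basis b s -> in_cone b s (homogenize (row_of t)) ->
  forall k, 0 < coords b s (homogenize (row_of t)) 0 k.
Proof.
move=> nt bs /forallP c0 k; rewrite lt_neqAle c0 andbT eq_sym; apply/eqP => ck.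
have E := coords_comb (homogenize (row_of t)) bs.
have [l1 tE] := homogenize_comb_inv (esym E).
(* the facet opposite to the vertex k lies on a hyperplane *)
pose v := col k (invmx (basis_mx b s)).
have bv l : (b (s l) *m v) 0 0 = (l == k)%:R.
  have : basis_mx b s *m v = col k 1%:M by rewrite /v !colE mulmxA mulmxV// mul1mx.
  by move=> /colP/(_ l); rewrite -[b (s l)](rowK (fun l => b (s l))) -row_mul !mxE eq_sym => ->.
pose u : 'rV[R]_d := \row_q v (lift ord0 q) 0.
have bvE i : (b i *m v) 0 0 = v 0 0 + dot u (a i).
  rewrite mxE big_ord_recl homogenize0 mul1r /dot; congr (_ + _).
  by apply: eq_bigr => q _; rewrite homogenizeS mulrC [u 0 q]mxE.
have [u0|u0] := eqVneq u 0.
  have : v 0 0 + dot u (row_of t) = 0.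
    rewrite tE dot_sumr -[v 0 0]mul1r -l1 mulr_suml -big_split /= big1// => l _.
    rewrite dotZr -mulrDr -bvE bv; have [->|] := eqVneq l k; last by rewrite mulr0.
    by rewrite ck mul0r.
  rewrite u0 dot0l addr0 => v0.
  by have := bv k; rewrite bvE u0 dot0l addr0 v0 eqxx => /esym/eqP; rewrite oner_eq0.
have [l cl] := nondegenerate_spans (- v 0 0) nt l1 tE u0.
rewrite -subr_eq0 opprK addrC -bvE bv; have [lk|] := eqVneq l k; last by rewrite eqxx.
by move: cl; rewrite lk ck eqxx.
Qed.

(** The simplices come from the lower envelope of a generic lifting: the
    interpolation of the heights on such a simplex stays below the heights.
    Two interpolations agree at a common point t of their simplices, since
    each is below the other there; as the coordinates of t are positive,
    each of them attains the heights at the vertices of the other simplex,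
    and the heights are so generic that both simplices have the same
    vertices. Among the orderings of these vertices, [rep] selects one. *)
Lemma regular_triangulation : exists T : {set {ffun 'I_d.+1 -> 'I_n}},
  (forall s, s \in T -> basis b s) /\
  forall t, ~ degenerate t -> convpts a (row_of t) ->
    exists s, [/\ s \in T, simplex s (row_of t) &
      forall s', s' \in T -> simplex s' (row_of t) -> s' = s].
Proof.
have [h hgen] := generic_heights b.
pose T0 : pred {ffun 'I_d.+1 -> 'I_n} :=
  fun s => basis b s && [forall i, cost b h s (b i) <= h i].
pose same (s s' : {ffun 'I_d.+1 -> 'I_n}) := (s @: setT == s' @: setT)%SET.
pose rep s := choose (fun s' => T0 s' && same s' s) s.
exists [set s | T0 s && (rep s == s)]%SET; split.
  by move=> s; rewrite inE => /andP[/andP[]].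
move=> t nt tP.
have unique s s' : T0 s -> T0 s' -> simplex s (row_of t) -> simplex s' (row_of t) ->
    (s @: setT \subset s' @: setT)%SET.
  move=> /andP[bs /forallP hs] /andP[bs' /forallP hs'].
  move=> /(in_simplexP _ bs) cs /(in_simplexP _ bs') cs'.
  have le q q' : basis b q -> (forall i, cost b h q' (b i) <= h i) ->
      in_cone b q (homogenize (row_of t)) ->
      cost b h q' (homogenize (row_of t)) <= cost b h q (homogenize (row_of t)).
    move=> bq hq' /forallP cq.
    rewrite [X in cost b h q' X](coords_comb (homogenize (row_of t)) bq) cost_sum.
    by apply: ler_sum => k _; rewrite costZ ler_wpM2l.
  have E : cost b h s' (homogenize (row_of t)) = cost b h s (homogenize (row_of t)).
    by apply/eqP; rewrite eq_le !le.
  have pos := coords_gt0 nt bs cs.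
  apply/fintype.subsetP => _ /imsetP[k _ ->].
  have /(hgen _ bs')[k' ->] : cost b h s' (b (s k)) = h (s k); last by apply: imset_f; rewrite inE.
  have S0 : \sum_k coords b s (homogenize (row_of t)) 0 k *
      (h (s k) - cost b h s' (b (s k))) = 0.
    rewrite -[RHS](subrr (cost b h s (homogenize (row_of t)))) -[X in _ = _ - X]E.
    rewrite [X in cost b h s' X](coords_comb (homogenize (row_of t)) bs) cost_sum.
    rewrite [X in _ = X - _]/cost -sumrB; apply: eq_bigr => l _.
    by rewrite costZ mulrBr.
  have nn l : predT l -> 0 <= coords b s (homogenize (row_of t)) 0 l *
      (h (s l) - cost b h s' (b (s l))).
    by move=> _; rewrite mulr_ge0 ?subr_ge0// ltW.
  have /eqP := psumr_eq0P nn S0 (isT : predT k).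
  by rewrite mulf_eq0 gt_eqF//= subr_eq0 => /eqP.
have n0 : (0 < n)%N.
  move: tP; rewrite lt0n; apply: contraPneq => n0 [l [_ + _]].
  rewrite big1 => [/esym/eqP|i _]; first by rewrite oner_eq0.
  by move: (ltn_ord i); rewrite [X in (_ < X)%N]n0.
have [s0 bs0] := exists_basis n0.
have [l [l0 l1 tE]] := tP.
have [s1 bs1 cs1] := cone_basis h homogenize_f (index_enum 'I_n) id bs0 l0.
have yE : \sum_i l i *: b i = homogenize (row_of t) by rewrite tE homogenize_comb.
rewrite yE in cs1.
have [s [bs cs hs]] := optimal_basis h homogenize_f (ex_intro2 _ _ s1 bs1 cs1).
have Ts : T0 s.
  by rewrite /T0 bs; apply/forallP => i; apply: hs; exact: coords_gt0.
have sim : simplex s (row_of t) by apply/in_simplexP.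
have ex : T0 s && same s s by rewrite Ts /same eqxx.
have [Tr sr] : T0 (rep s) /\ same (rep s) s
  by apply/andP; exact: (@chooseP _ (fun s' => T0 s' && same s' s) s ex).
have repE s' : same s' s -> T0 s' -> rep s' = rep s.
  move=> ss' Ts'; rewrite /rep.
  rewrite (@eq_choose _ _ (fun s'' => T0 s'' && same s'' s)); last first.
    by move=> s'' /=; rewrite /same (eqP ss').
  by apply: choose_id => //; apply/andP.
have bsr : basis b (rep s) by have /andP[] := Tr.
have simr : simplex (rep s) (row_of t).
  have : (s @: setT \subset rep s @: setT)%SET by rewrite (eqP sr).
  move=> /fintype.subsetP sub; move: sim; rewrite !convptsE.
  apply: convon_sub; first exact: convex_convon.
  move=> k _; have /imsetP[k' _ ->] := sub _ (imset_f s (in_setT k)).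
  by apply: (mem_convon (fun k => a (rep s k))); rewrite inE.
exists (rep s); split => //.
  by rewrite inE Tr; apply/eqP; apply: repE.
move=> s'; rewrite inE => /andP[Ts' /eqP rs'] sim'; rewrite -rs'.
by apply: repE => //; rewrite /same finset.eqEsubset; apply/andP; split; apply: unique.
Qed.

End Triangulation.

(** * Rational functions and their values *)

Section Density.
Variables (R : realType) (d : nat).
Implicit Types (p q : {mpoly R[d]}) (u : 'rV[R]_d) (U : set 'rV[R]_d).

Definition ev u p : R := p.@[fun i => u 0 i].

(** The weights are the k ^ i, where k is not a root of finitely many
    polynomials, one for each pair of monomials. *)
Lemma separating_weights (s : seq 'X_{1..d}) : exists w : 'I_d -> nat,
  {in s &, injective (fun m : 'X_{1..d} => \sum_i w i * m i)%N}.
Proof.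
pose q (m m' : 'X_{1..d}) : {poly R} := \poly_(i < d) (if insub i is Some j then
   (m j)%:R - (m' j)%:R else 0).
pose Q : {poly R} := \prod_(mm <- [seq (m, m') | m <- s, m' <- s] | q mm.1 mm.2 != 0) q mm.1 mm.2.
have Q0 : Q != 0 by rewrite prodf_seq_neq0; apply/allP => i _; exact/implyP.
have natI : injective (fun k => k%:R : R) by move=> i j /eqP; rewrite eqr_nat => /eqP.
have [k Qk] := poly_nonroot_seq natI Q0.
exists (fun i => k ^ i)%N => m m' ms ms' E.
have qk : (q m m').[k%:R] = 0.
  rewrite horner_poly.
  rewrite (eq_bigr (fun i : 'I_d => ((k ^ i * m i)%N%:R - (k ^ i * m' i)%N%:R))).
    by rewrite sumrB -!natr_sum E subrr.
  by move=> i _; rewrite valK !natrM natrX; ring.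
have [q0|q0] := eqVneq (q m m') 0; last first.
  move: Qk; rewrite horner_prod prodf_seq_neq0 => /allP/(_ (m, m')).
  by rewrite allpairs_f// => /(_ isT); rewrite q0 /= qk eqxx.
apply/mnmP => i; apply/eqP; rewrite -(eqr_nat R) -subr_eq0.
by move/polyP: q0 => /(_ i); rewrite coef_poly ltn_ord coef0 valK => ->.
Qed.

(** Along the curve with coordinates x ^ w i, the monomials of p become
    distinct powers of x. *)
Lemma mpoly_eval_eq0 p : (forall u, ev u p = 0) -> p = 0.
Proof.
move=> H; apply/eqP/negPn/negP => p0.
have [w wI] := separating_weights (msupp p).
pose W (m : 'X_{1..d}) := (\sum_i w i * m i)%N.
pose P : {poly R} := \sum_(m <- msupp p) p@_m *: 'X^(W m).
have [m mp] : exists m, m \in msupp p.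
  by exists (mlead p); exact: mlead_supp.
have P0 : P != 0.
  apply/eqP => /polyP/(_ (W m))/eqP; rewrite coef0 coef_sum (bigD1_seq m)//=.
  rewrite coefZ coefXn eqxx mulr1 big1_seq ?addr0; first by rewrite mcoeff_eq0 mp.
  move=> m' /andP[m'm m'p]; rewrite coefZ coefXn; case: eqP => [/wI E|_]; last by rewrite mulr0.
  by rewrite E ?eqxx // in m'm.
have [x] := poly_nonroot P0; rewrite -[0](H (\row_i x ^+ w i)) => /negP; apply; apply/eqP.
rewrite /ev mevalE horner_sum; apply: eq_bigr => m' _.
rewrite hornerZ hornerXn; congr (_ * _); rewrite -prodrXr; apply: eq_bigr => i _.
by rewrite mxE exprM.
Qed.

Definition zariski_dense U := forall p, (forall u, U u -> ev u p = 0) -> p = 0.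

(** The segment from a point u0 of the cone towards any u starts inside the
    cone, and a polynomial that vanishes on the beginning of a segment
    vanishes at its end. *)
Lemma zariski_dense_open_cone (W : 'M[R]_d) : W \in unitmx ->
  zariski_dense [set u | forall k, 0 < dot u (row k W)].
Proof.
move=> uW p Hp; apply: mpoly_eval_eq0 => u.
pose u0 : 'rV[R]_d := (invmx W *m const_mx 1)^T.
have u0W k : dot u0 (row k W) = 1.
  rewrite dotC dotE trmxK -row_mul mulmxA mulmxV// mul1mx !mxE //.
have [eps e0 He] := @small_perturbation R _ [set: 'I_d]%SET (fun k => dot u0 (row k W))
  (fun k => dot (u - u0) (row k W)) (fun k _ => eq_ind_r (fun z => 0 < z) ltr01 (u0W k)).
pose P : {poly R} := mmap (polyC : R -> {poly R})
  (fun i => (u0 0 i)%:P + (u 0 i - u0 0 i)%:P * 'X) p.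
have PE s : P.[s] = ev (u0 + s *: (u - u0)) p.
  rewrite /P /mmap horner_sum /ev mevalE; apply: eq_bigr => m _.
  rewrite hornerM hornerC; congr (_ * _); rewrite horner_prod; apply: eq_bigr => i _.
  by rewrite horner_exp !hornerE !mxE mulrC.
suff P0 : P = 0.
  by have := PE 1; rewrite P0 horner0 scale1r addrC subrK => <-.
apply/eqP/negPn/negP => P0.
pose g k : R := eps / k.+1%:R.
have gI : injective g.
  move=> i j /eqP; rewrite /g (inj_eq (mulfI (lt0r_neq0 e0))) (inj_eq invr_inj) eqr_nat.
  by move/eqP => [].
have [k /eqP] := poly_nonroot_seq gI P0; apply; rewrite PE; apply: Hp => l.
rewrite dotDl dotZl u0W /=.
have th : 0 < k.+1%:R :> R by rewrite ltr0n.
have := He l (finset.in_setT l); rewrite u0W => H1.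
rewrite (_ : 1 + _ = (1 - k.+1%:R^-1) + k.+1%:R^-1 * (1 + eps * dot (u - u0) (row l W))).
  rewrite ltr_wpDl ?mulr_gt0 ?invr_gt0//.
  by rewrite subr_ge0 invf_le1// ler1n.
by rewrite /g; field; rewrite gt_eqF.
Qed.

Lemma zariski_denseI U q : zariski_dense U -> q != 0 ->
  zariski_dense (U `&` [set u | ev u q != 0]).
Proof.
move=> dU q0 p Hp; have /eqP : p * q = 0.
  apply: dU => u Uu; rewrite /ev mevalM -!/(ev _ _).
  have [->|qu] := eqVneq (ev u q) 0; first by rewrite mulr0.
  by rewrite Hp ?mul0r.
by rewrite mulf_eq0 (negbTE q0) orbF => /eqP.
Qed.

Lemma zariski_denseT : zariski_dense setT.
Proof. by move=> p H; apply: mpoly_eval_eq0 => u; exact: H. Qed.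

(** Identities of rational functions will be deduced from identities between
    their values. *)
Definition evaluates U (r : ratfun R d) (F : 'rV[R]_d -> R) :=
  exists p q, [/\ q != 0, r = tofrac p / tofrac q &
    forall u, U u -> ev u q != 0 /\ F u = ev u p / ev u q].

Lemma evaluates_tofrac U p : evaluates U (tofrac p) (ev^~ p).
Proof.
exists p, 1; rewrite oner_neq0 tofrac1 divr1; split => // u _.
by rewrite /ev meval1 oner_neq0 divr1.
Qed.

Lemma evaluatesM U r1 r2 F1 F2 : evaluates U r1 F1 -> evaluates U r2 F2 ->
  evaluates U (r1 * r2) (fun u => F1 u * F2 u).
Proof.
move=> [p1 [q1 [q10 -> H1]]] [p2 [q2 [q20 -> H2]]]; exists (p1 * p2), (q1 * q2).
split; [by rewrite mulf_neq0|by rewrite !tofracM invfM mulrACA|].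
move=> u Uu; have [q1u ->] := H1 u Uu; have [q2u ->] := H2 u Uu.
by rewrite /ev !mevalM mulf_neq0//; split => //; rewrite invfM mulrACA.
Qed.

Lemma evaluatesD U r1 r2 F1 F2 : evaluates U r1 F1 -> evaluates U r2 F2 ->
  evaluates U (r1 + r2) (fun u => F1 u + F2 u).
Proof.
move=> [p1 [q1 [q10 -> H1]]] [p2 [q2 [q20 -> H2]]].
exists (p1 * q2 + p2 * q1), (q1 * q2); split; first by rewrite mulf_neq0.
  by rewrite addf_div ?tofrac_eq0// tofracD !tofracM.
move=> u Uu; have [q1u ->] := H1 u Uu; have [q2u ->] := H2 u Uu.
by rewrite /ev mevalD !mevalM mulf_neq0//; split => //; rewrite addf_div.
Qed.

Lemma evaluatesV U r F : r != 0 -> (forall u, U u -> F u != 0) -> evaluates U r F ->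
  evaluates U r^-1 (fun u => (F u)^-1).
Proof.
move=> r0 F0 [p [q [q0 rE H]]]; exists q, p.
have p0 : p != 0.
  by apply: contraNneq r0 => p0; rewrite rE p0 tofrac0 mul0r.
split => //; first by rewrite rE invf_div.
move=> u Uu; have := F0 u Uu; have [qu ->] := H u Uu.
by rewrite mulf_eq0 negb_or invf_div => /andP[-> _].
Qed.

Lemma evaluates_sum U (I : Type) (s : seq I) (Q : pred I) r F :
  (forall i, Q i -> evaluates U (r i) (F i)) ->
  evaluates U (\sum_(i <- s | Q i) r i) (fun u => \sum_(i <- s | Q i) F i u).
Proof.
move=> H; elim: s => [|i s IH].
  have := evaluates_tofrac U 0; rewrite tofrac0 => -[p [q [q0 E K]]].
  exists p, q; rewrite big_nil; split => // u /K[qu <-].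
  by rewrite big_nil /ev meval0.
rewrite big_cons; case: ifPn => Qi.
  have [p [q [q0 -> K]]] := evaluatesD (H i Qi) IH.
  by exists p, q; split => // u /K; rewrite big_cons Qi.
have [p [q [q0 -> K]]] := IH.
by exists p, q; split => // u /K; rewrite big_cons (negbTE Qi).
Qed.

Lemma evaluates_prod U (I : Type) (s : seq I) (Q : pred I) r F :
  (forall i, Q i -> evaluates U (r i) (F i)) ->
  evaluates U (\prod_(i <- s | Q i) r i) (fun u => \prod_(i <- s | Q i) F i u).
Proof.
move=> H; elim: s => [|i s IH].
  have := evaluates_tofrac U 1; rewrite tofrac1 => -[p [q [q0 E K]]].
  exists p, q; rewrite big_nil; split => // u /K[qu <-].
  by rewrite big_nil /ev meval1.
rewrite big_cons; case: ifPn => Qi.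
  have [p [q [q0 -> K]]] := evaluatesM (H i Qi) IH.
  by exists p, q; split => // u /K; rewrite big_cons Qi.
have [p [q [q0 -> K]]] := IH.
by exists p, q; split => // u /K; rewrite big_cons (negbTE Qi).
Qed.

(** After multiplication by the denominators, this is an identity of
    polynomials. *)
Lemma evaluates_inj U r1 r2 F1 F2 : zariski_dense U ->
  evaluates U r1 F1 -> evaluates U r2 F2 -> (forall u, U u -> F1 u = F2 u) -> r1 = r2.
Proof.
move=> dU [p1 [q1 [q10 -> H1]]] [p2 [q2 [q20 -> H2]]] E.
apply/eqP; rewrite eqr_div ?tofrac_eq0// -!tofracM tofrac_eq -subr_eq0; apply/eqP.
apply: dU => u Uu; have [q1u F1u] := H1 u Uu; have [q2u F2u] := H2 u Uu.
have := E u Uu; rewrite F1u F2u => /eqP; rewrite eqr_div// => /eqP K.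
by rewrite /ev mevalB !mevalM -!/(ev _ _) K subrr.
Qed.

Definition linform (v : 'rV[R]_d) : {mpoly R[d]} := \sum_i v 0 i *: 'X_i.

Lemma ev_linform u v : ev u (linform v) = dot u v.
Proof.
rewrite /ev /linform raddf_sum /dot; apply: eq_bigr => i _ /=.
by rewrite mevalZ mevalXU mulrC.
Qed.

Lemma linform_neq0 v : v != 0 -> linform v != 0.
Proof.
move=> v0; apply: contraTneq (dot_gt0 v0) => H.
by rewrite -ev_linform H /ev meval0 ltxx.
Qed.

Lemma rat_formE v : rat_form v = tofrac (linform v).
Proof. by []. Qed.

Lemma evaluates_form U v : evaluates U (rat_form v) (fun u => dot u v).
Proof.
have [p [q [q0 E K]]] := evaluates_tofrac U (linform v).
by exists p, q; split => // u Uu; have [] := K u Uu; rewrite ev_linform.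
Qed.

Lemma evaluates_const U c : evaluates U (rat_const d c) (fun=> c).
Proof.
have [p [q [q0 E K]]] := evaluates_tofrac U c%:MP.
by exists p, q; split => // u Uu; have [] := K u Uu; rewrite /ev mevalC.
Qed.

End Density.

(** * Brion's formula *)

Section Cuts.
Variables (R : realType) (d : nat).
Implicit Types (p : 'I_d.+1 -> 'rV[R]_d) (u x : 'rV[R]_d).

Lemma convpts_edgesP p k x : convpts p x <->
  exists c : 'rV[R]_d, [/\ forall l, 0 <= c 0 l, \sum_l c 0 l <= 1 &
    x = p k + c *m edge_mx p k].
Proof.
have -> : convpts p x = tuples (convpts p) (tuple_of x).
  by rewrite /tuples /= tuple_ofK.
rewrite (convpts_edges p k); split => [[t [t0 t1] tx]|[c [c0 c1 ->]]].
  exists (row_of t); split => [l||]; first by rewrite mxE.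
    by rewrite (eq_bigr (tnth t))// => l _; rewrite mxE.
  by rewrite -(tuple_ofK x) -tx row_affine addrC.
exists (tuple_of c); last by rewrite /affine tuple_ofK addrC.
by split => [l|]; [|rewrite (eq_bigr (fun l => c 0 l))// => l _]; rewrite tnth_mktuple.
Qed.

(** The vertices other than [p k] lie on or beyond the cutting hyperplane;
    hence the cut bounds the sum of the coordinates by 1. *)
Lemma cut_simplex p k u eps : 0 < eps ->
  (forall l, eps <= dot u (row l (edge_mx p k))) ->
  convpts p `&` [set x | dot u (x - p k) <= eps] = cone_cut (p k) (edge_mx p k) u eps.
Proof.
move=> e0 He; apply/seteqP; split => x.
  move=> [/(convpts_edgesP p k)[c [c0 c1 xE]] /= ux]; exists c; split => //.
  by move: ux; rewrite xE addrAC subrr add0r.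
move=> [c [c0 xE ce]]; split; last by rewrite /= xE addrAC subrr add0r.
apply/(convpts_edgesP p k); exists c; split => //.
rewrite -(ler_pM2l e0) mulr1 mulr_sumr; apply: le_trans ce.
rewrite mulmx_edges dot_sumr; apply: ler_sum => l _.
by rewrite dotZr mulrC ler_wpM2l.
Qed.

End Cuts.

Section SimplePolytope.
Variables (R : realType) (d n : nat) (a : 'I_n -> 'rV[R]_d).
Variables (W : 'I_n -> 'M[R]_d) (nb : 'I_n -> 'I_d -> 'I_n).
Local Notation RR := (measurableTypeR R).
Local Notation lam := (lebesgue_tuple R d).
Local Notation simplex s := (convpts (fun k => a (s k))).
Local Notation basis s := (basis (fun i => homogenize (a i)) s).
Hypothesis uW : forall i, W i \in unitmx.
Hypothesis nbi : forall i k, nb i k != i.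
Hypothesis WE : forall i k, row k (W i) = a (nb i k) - a i.
Hypothesis coneW : forall i j,
  exists2 c : 'rV[R]_d, forall k, 0 <= c 0 k & a j = a i + c *m W i.
Let P := convpts a.
Implicit Types s : {ffun 'I_d.+1 -> 'I_n}.

Lemma polytope_in_cone i x : P x ->
  exists2 c : 'rV[R]_d, forall k, 0 <= c 0 k & x = a i + c *m W i.
Proof.
move=> [l [l0 l1 ->]].
have /choice[c cP] j : exists c : 'rV[R]_d, (forall k, 0 <= c 0 k) /\ a j = a i + c *m W i.
  by have [c c0 E] := coneW i j; exists c.
exists (\sum_j l j *: c j) => [k|].
  by rewrite summxE; apply: sumr_ge0 => j _; rewrite mxE mulr_ge0//; have [] := cP j.
rewrite mulmx_suml -[X in X + _]scale1r -l1 scaler_suml -big_split /=.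
by apply: eq_bigr => j _; rewrite -scalemxAl -scalerDr; have [_ <-] := cP j.
Qed.

(** A form that separates x from P has its minimum over P at some vertex; it
    is nonnegative on the edges at this vertex, hence on the tangent cone. *)
Lemma cones_in_polytope x : (0 < n)%N ->
  (forall i, exists2 c : 'rV[R]_d, forall k, 0 <= c 0 k & x = a i + c *m W i) -> P x.
Proof.
move=> n0 H; apply: contrapT; rewrite /P convptsE => /convon_alt[u Hu].
have [i _ imin] := @arg_minP _ _ _ (Ordinal n0) predT (fun i => dot u (a i)) isT.
have [c c0 xE] := H i; have := Hu i (finset.in_setT i).
rewrite xE dotDr gtrDl ltNge => /negP; apply.
rewrite mulmx_edges dot_sumr; apply: sumr_ge0 => k _.
by rewrite dotZr mulr_ge0// WE dotBr subr_ge0 imin.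
Qed.

(** P is the intersection of the tangent cones at its vertices. *)
Lemma measurable_polytope : measurable (tuples P).
Proof.
have [n0|n0] := posnP n.
  rewrite (_ : tuples P = set0) //; apply/seteqP; split => t // [l [_ + _]].
  rewrite big1 => [/esym/eqP|i _]; first by rewrite oner_eq0.
  by move: (ltn_ord i); rewrite [X in (_ < X)%N]n0.
rewrite (_ : tuples P = \bigcap_(i in [set: 'I_n])
    (affine (invmx (W i)) (- a i *m invmx (W i)) @^-1` [set t | forall k, 0 <= tnth t k])).
  apply: fin_bigcap_measurable => // i _; apply: measurable_affine_preimage.
  exact: measurable_tnth_ge0.
have E i (t : d.-tuple R) : row_of (affine (invmx (W i)) (- a i *m invmx (W i)) t) =
    (row_of t - a i) *m invmx (W i).
  by rewrite row_affine mulmxBl mulNmx.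
apply/seteqP; split => t.
  move=> Pt i _ k; have [c c0 tE] := polytope_in_cone i Pt.
  have /rowP/(_ k) := E i t; rewrite mxE => /= ->.
  by rewrite tE addrAC subrr add0r mulmxK.
move=> Ht; apply: cones_in_polytope => // i.
exists ((row_of t - a i) *m invmx (W i)) => [k|]; last by rewrite mulmxKV// addrC subrK.
by have := Ht i Logic.I k; rewrite -E mxE.
Qed.

Lemma simplex_sub_polytope s : simplex s `<=` P.
Proof.
rewrite /P !convptsE; apply: convon_sub; first exact: convex_convon.
by move=> k _; apply: mem_convon; rewrite inE.
Qed.

Variable T : {set {ffun 'I_d.+1 -> 'I_n}}.
Hypothesis bT : forall s, s \in T -> basis s.
Hypothesis triT : forall t, ~ degenerate a t -> P (row_of t) ->
    exists s, [/\ s \in T, simplex s (row_of t) &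
      forall s', s' \in T -> simplex s' (row_of t) -> s' = s].

Lemma measurable_simplex s : s \in T -> measurable (tuples (simplex s)).
Proof. by move=> /bT bs; apply: (measurable_convpts (k := ord0)); exact: basis_edges. Qed.

Lemma integral_triangulation (f : d.-tuple RR -> \bar R) :
  measurable_fun setT f ->
  (forall s, s \in T -> lam.-integrable (tuples (simplex s)) f) ->
  (\int[lam]_(t in tuples P) f t =
   \sum_(s in T) \int[lam]_(t in tuples (simplex s)) f t)%E.
Proof.
move=> mf intf.
have mP := measurable_polytope.
pose fs s := if s \in T then f \_ (tuples (simplex s)) else cst 0%E.
have ifs s : lam.-integrable setT (fs s).
  rewrite /fs; case: ifPn => sT; last exact: integrable0.
  by apply/(integrable_mkcond _ (measurable_simplex sT)); exact: intf.
transitivity (\int[lam]_t (\sum_(s in T) fs s t))%E; last first.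
  rewrite integral_sum//; apply: eq_bigr => s sT.
  by rewrite [RHS]integral_mkcond /fs sT.
rewrite integral_mkcond; apply: ae_eq_integral => //.
- by apply/(measurable_restrictT _ mP); exact: measurable_funTS.
- have := @integrable_sum _ _ _ lam setT measurableT _ (index_enum _)
    (fun s => s \in T) fs (fun s _ => ifs s).
  by move=> /integrableP[]; exact.
have [N [mN N0 sN]] := negligible_degenerate a.
exists N; split => //; apply: subset_trans sN => t /= nt; apply: contrapT => tD.
apply: nt => _; rewrite patchE.
have [|tP] := boolP (t \in tuples P).
  rewrite inE => tP; have [s [sT ss uniq]] := triT tD tP.
  rewrite (bigD1 s)//= {1}/fs sT patchE mem_set// big1 ?adde0// => s' /andP[s'T s's].
  rewrite /fs s'T patchE memNset// => /(uniq _ s'T) E.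
  by rewrite E eqxx in s's.
rewrite big1// => s sT; rewrite /fs sT patchE memNset// => ss.
by move: tP; rewrite notin_setE; apply; exact: simplex_sub_polytope ss.
Qed.

Lemma dot_edge_gt0 u i j : (forall k, 0 < dot u (row k (W i))) -> injective a ->
  j != i -> 0 < dot u (a j - a i).
Proof.
move=> u0 ai ji; have [c c0 E] := coneW i j.
have Ec : a j - a i = c *m W i by rewrite E addrAC subrr add0r.
have [k ck] : exists k, c 0 k != 0.
  apply/existsP; apply: contraT => /existsPn H.
  suff c00 : c = 0.
    by move: ji; rewrite -(inj_eq ai) -subr_eq0 Ec c00 mul0mx eqxx.
  by apply/rowP => k; rewrite mxE; apply/eqP; have := H k; rewrite negbK.
rewrite Ec mulmx_edges dot_sumr (bigD1 k)//= dotZr ltr_pwDl//.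
  by rewrite mulr_gt0// lt_neqAle eq_sym ck c0.
by apply: sumr_ge0 => l _; rewrite dotZr mulr_ge0// ltW.
Qed.

Lemma basis_inj s : basis s -> injective s.
Proof.
move=> bs k l E.
have H q : coords (fun i => homogenize (a i)) s (homogenize (a (s q))) = \row_r (r == q)%:R.
  rewrite -(comb_coords _ bs); congr coords.
  rewrite (bigD1 q)//= eqxx scale1r big1 ?addr0// => r /negPf ->.
  by rewrite scale0r.
have := H k; rewrite E H => /rowP/(_ k); rewrite !mxE eqxx.
by case: (eqVneq k l) => // _ /esym/eqP; rewrite oner_eq0.
Qed.

(** The neighbours lie on or beyond the cutting hyperplane, so that the cut
    of the cone is contained in the simplex of the vertex and its
    neighbours. *)
Lemma cut_polytope u i eps : 0 < eps -> (forall k, eps <= dot u (row k (W i))) ->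
  P `&` [set x | dot u (x - a i) <= eps] = cone_cut (a i) (W i) u eps.
Proof.
move=> e0 He; apply/seteqP; split => x.
  move=> [/(polytope_in_cone i)[c c0 xE] /= ux]; exists c; split => //.
  by move: ux; rewrite xE addrAC subrr add0r.
pose p (k : 'I_d.+1) := if unlift ord0 k is Some l then a (nb i l) else a i.
have p0 : p ord0 = a i by rewrite /p unlift_none.
have EW : edge_mx p ord0 = W i.
  by apply/row_matrixP => l; rewrite rowK /p liftK unlift_none WE.
rewrite -EW -{1}p0 -cut_simplex ?EW// => -[px] /=; rewrite p0; split => //.
move: px; rewrite /P !convptsE; apply: convon_sub; first exact: convex_convon.
by move=> k _; rewrite /p; case: unlift => [l|]; apply: mem_convon; rewrite inE.
Qed.

Lemma measurable_cut u v eps :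
  measurable ([set t | dot u (row_of t - v) <= eps] : set (d.-tuple RR)).
Proof.
rewrite (_ : mkset _ = (fun t : d.-tuple RR => dot u (row_of t)) @^-1` `]-oo, (eps + dot u v)]).
  by rewrite -[X in measurable X]setTI; apply: measurable_dot.
by apply/seteqP; split => t /=; rewrite in_itv /= dotBr lerBlDr.
Qed.

Lemma volume_triangulation B : measurable B ->
  lam (tuples P `&` B) = (\sum_(s in T) lam (tuples (simplex s) `&` B))%E.
Proof.
move=> mB.
transitivity (\int[lam]_(t in tuples P) (\1_B t)%:E)%E.
  rewrite integral_indic//; [by rewrite setIC|exact: measurable_polytope].
rewrite integral_triangulation.
- apply: eq_bigr => s sT; rewrite integral_indic//; first by rewrite setIC.
  exact: measurable_simplex.
- exact/measurable_EFinP/measurable_indic.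
move=> s sT; apply: (@measurable_bounded_integrable _ _ _ lam \1_B).
- exact: measurable_simplex.
- have bs := basis_edges ord0 (bT sT).
  by move: (lebesgue_convpts bs) => /= ->; rewrite ltry.
- exact: measurable_indic.
exists 1; split; first exact: num_real.
move=> c /ltW c1 t _; apply: le_trans c1; rewrite /= indicE.
by case: (t \in B); rewrite /= ?normr1// normr0.
Qed.

Definition simplex_det s := `|\det (edge_mx (fun k => a (s k)) ord0)|.

(** Up to the volume of the standard simplex, both sides are the volume of
    the simplex. *)
Lemma simplex_detE s k : basis s ->
  `|\det (edge_mx (fun k => a (s k)) k)| = simplex_det s.
Proof.
move=> bs; have := lebesgue_convpts (basis_edges k bs).
rewrite (lebesgue_convpts (basis_edges ord0 bs)) => -[].
by move/(mulIf (lt0r_neq0 (std_volume_gt0 R d))) => <-.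
Qed.

(** Cut P near the vertex by a hyperplane <x - a_i, u> = eps. Both P and the
    simplices with this vertex become cut cones, with volumes given by
    [lebesgue_cone_cut]; the other simplices do not meet the cut. *)
Lemma local_volumes u i : injective a -> (forall k, 0 < dot u (row k (W i))) ->
  `|\det (W i)| / \prod_k dot u (row k (W i)) =
  \sum_(s in T) \sum_(k | s k == i)
    simplex_det s / \prod_l dot u (a (s (lift k l)) - a (s k)).
Proof.
move=> ai u0.
have gap j : j \in (~: [set i])%SET -> 0 < dot u (a j - a i).
  by rewrite !inE; exact: dot_edge_gt0.
have [eps e0 He] := small_perturbation (fun=> -1) gap.
have {}He j : j != i -> eps < dot u (a j - a i).
  by move=> ji; have := He j; rewrite !inE ji mulrN1 subr_gt0; apply.
pose B := [set t : d.-tuple RR | dot u (row_of t - a i) <= eps].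
have := volume_triangulation (measurable_cut u (a i) eps); rewrite -/B.
have -> : tuples P `&` B =
    tuples (cone_cut (a i) (W i) u eps).
  rewrite -cut_polytope// => k; first by rewrite WE; apply/ltW/He.
rewrite lebesgue_cone_cut//.
have -> : (\sum_(s in T) lam (tuples (simplex s) `&` B) =
   \sum_(s in T) (std_volume R d * eps ^+ d * \sum_(k | s k == i)
    simplex_det s / \prod_l dot u (a (s (lift k l)) - a (s k)))%:E)%E.
  apply: eq_bigr => s sT; have bs := bT sT; have sI := basis_inj bs.
  have [/existsP[k /eqP ki]|ni] := boolP [exists k, s k == i].
    have Hk l : eps < dot u (row l (edge_mx (fun k => a (s k)) k)).
      rewrite rowK ki; apply: He; rewrite -ki (inj_eq sI).
      by rewrite eq_sym neq_lift.
    have -> : tuples (simplex s) `&` B =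
       tuples (cone_cut (a (s k)) (edge_mx (fun k => a (s k)) k) u eps).
      by rewrite -cut_simplex// => [|l]; [rewrite ki|exact/ltW].
    rewrite lebesgue_cone_cut//; last first.
    - by move=> l; apply: lt_trans (Hk l).
    - exact: basis_edges.
    rewrite (big_pred1 k) => [|l]; last by rewrite -ki (inj_eq sI).
    rewrite simplex_detE//; congr (_ * (_ / _))%:E.
    by apply: eq_bigr => l _; rewrite rowK.
  rewrite big_pred0 => [|k]; last by apply/negbTE; apply: contra ni => ki; apply/existsP; exists k.
  rewrite mulr0 (_ : _ `&` _ = set0) ?measure0//; apply/seteqP; split => t // -[].
  move=> [l [l0 l1 tE]] ; rewrite /B /= leNgt => /negP; apply.
  have -> : row_of t - a i = \sum_k l k *: (a (s k) - a i).
    rewrite tE -[X in _ - X]scale1r -l1 scaler_suml -sumrB.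
    by apply: eq_bigr => k _; rewrite scalerBr.
  rewrite dot_sumr -[X in X < _]mul1r -l1 mulr_suml.
  have [k lk] : exists k, l k != 0.
    apply/existsP; apply: contraT => /existsPn H.
    move/eqP: l1; rewrite big1 ?(eq_sym 0) ?oner_eq0// => k _.
    by apply/eqP; have := H k; rewrite negbK.
  have nk q : s q != i by apply: contra ni => sq; apply/existsP; exists q.
  rewrite (bigD1 k)//= [ltRHS](bigD1 k)//= dotZr ltr_leD//.
    by rewrite ltr_pM2l ?He// lt_neqAle eq_sym lk l0.
  by apply: ler_sum => q _; rewrite dotZr ler_wpM2l// ltW// He.
rewrite sumEFin => -[]; rewrite -mulr_sumr.
by move/(mulfI (mulf_neq0 (lt0r_neq0 (std_volume_gt0 R d)) (expf_neq0 d (lt0r_neq0 e0)))).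
Qed.

Definition rat_simplex s k : ratfun R d :=
  rat_const d (simplex_det s) / \prod_l rat_form (a (s (lift k l)) - a (s k)).

Definition rat_vertex i : ratfun R d :=
  rat_const d `|\det (W i)| / \prod_k rat_form (row k (W i)).

Lemma evaluates_quotient (U : set 'rV[R]_d) c (v : 'I_d -> 'rV[R]_d) :
  (forall k, v k != 0) -> (forall u, U u -> forall k, dot u (v k) != 0) ->
  evaluates U (rat_const d c / \prod_k rat_form (v k)) (fun u => c / \prod_k dot u (v k)).
Proof.
move=> v0 Uv; apply: (evaluatesM (evaluates_const U c)); apply: evaluatesV.
- by apply/prodf_neq0 => k _; rewrite rat_formE tofrac_eq0 linform_neq0.
- by move=> u Uu; apply/prodf_neq0 => k _; exact: Uv.
- by apply: evaluates_prod => k _; exact: evaluates_form.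
Qed.

Hypothesis ai : injective a.

Lemma diff_neq0 i j : j != i -> a j - a i != 0.
Proof. by move=> ji; rewrite subr_eq0 (inj_eq ai). Qed.

Lemma simplex_diff_neq0 s k l : s \in T -> s (lift k l) != s k.
Proof. by move=> /bT/basis_inj sI; rewrite (inj_eq sI) eq_sym neq_lift. Qed.

(** The values agree by [local_volumes] on the forms that are positive on
    the edges at the vertex. *)
Lemma rat_vertexE i :
  rat_vertex i = \sum_(s in T) \sum_(k | s k == i) rat_simplex s k.
Proof.
pose U := [set u : 'rV[R]_d | forall k, 0 < dot u (row k (W i))].
apply: (@evaluates_inj _ _ U).
- exact: zariski_dense_open_cone.
- apply: evaluates_quotient => [k|u Uu k]; first by rewrite WE diff_neq0.
  by rewrite gt_eqF.
- apply: evaluates_sum => s sT; apply: evaluates_sum => k /eqP ki.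
  apply: evaluates_quotient => [l|u Uu l]; first by rewrite diff_neq0// simplex_diff_neq0.
  by rewrite ki gt_eqF// dot_edge_gt0// -ki simplex_diff_neq0.
by move=> u Uu; exact: local_volumes.
Qed.

Lemma vertex_sum_edges (f : R -> R) u s : vertex_sum f (fun k => dot u (a (s k))) =
  (-1) ^+ d * \sum_k f (dot u (a (s k))) / \prod_l dot u (a (s (lift k l)) - a (s k)).
Proof.
rewrite /vertex_sum mulr_sumr; apply: eq_bigr => k _.
rewrite mulrCA; congr (_ * _).
have -> : \prod_(j | j != k) (dot u (a (s k)) - dot u (a (s j))) =
   (-1) ^+ d * \prod_l dot u (a (s (lift k l)) - a (s k)).
  rewrite big_mkcond (bigD1_ord k)//= eqxx mul1r -[d in (-1) ^+ d]card_ord -prodrN.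
  by apply: eq_bigr => l _; rewrite eq_sym neq_lift -dotBr -dotNr opprB.
by rewrite invfM invr_sign.
Qed.

Lemma integral_polytope (g : {poly R}) u : (forall i j, j != i -> dot u (a j - a i) != 0) ->
  (\int[lam]_(t in tuples P) (g^`(d)).[dot u (row_of t)]%:E =
   (\sum_(s in T) simplex_det s * vertex_sum (horner g) (fun k => dot u (a (s k))))%:E)%E.
Proof.
move=> ugen; rewrite integral_triangulation; last 2 first.
- exact: measurable_horner_dot.
- by move=> s sT; apply: integrable_convpts; exact: basis_edges ord0 (bT sT).
rewrite -sumEFin; apply: eq_bigr => s sT; have bs := bT sT.
rewrite (integral_convpts g (basis_edges ord0 bs))//.
move=> k l /eqP; rewrite -subr_eq0 -dotBr => /eqP E; apply: (basis_inj bs).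
by apply/eqP; apply: contraT => /ugen; rewrite E eqxx.
Qed.

(** The values agree where u takes distinct values at the vertices: each
    simplex of the triangulation contributes a divided difference, and the
    contributions with the same vertex add up to [rat_vertex] by
    [rat_vertexE]. *)
Lemma brion m (G : {mpoly R[d]}) :
  (forall u, (ev u G)%:E =
     \int[lam]_(t in tuples P) ('X^m^`(d)).[dot u (row_of t)]%:E)%E ->
  tofrac G = (-1) ^+ d * \sum_i rat_vertex i * rat_form (a i) ^+ m.
Proof.
move=> HG.
have -> : \sum_i rat_vertex i * rat_form (a i) ^+ m =
    \sum_(s in T) \sum_k rat_simplex s k * rat_form (a (s k)) ^+ m.
  under eq_bigr => i _ do rewrite rat_vertexE mulr_suml.
  rewrite exchange_big /=; apply: eq_bigr => s sT.
  rewrite [RHS](partition_big s predT)//=; apply: eq_bigr => i _.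
  by rewrite mulr_suml; apply: eq_bigr => k /eqP ->.
pose D : {mpoly R[d]} := \prod_(ij : 'I_n * 'I_n | ij.2 != ij.1) linform (a ij.2 - a ij.1).
have D0 : D != 0 by apply/prodf_neq0 => ij ji; rewrite linform_neq0// diff_neq0.
pose U := setT `&` [set u : 'rV[R]_d | ev u D != 0].
have Ugen u : U u -> forall i j, j != i -> dot u (a j - a i) != 0.
  move=> [_ /= Du] i j ji; apply: contraNneq Du => uij.
  by rewrite /ev rmorph_prod (bigD1 (i, j))//= -/(ev u _) ev_linform uij mul0r.
apply: (@evaluates_inj _ _ U _ _ _
  (fun u => (-1) ^+ d * \sum_(s in T) \sum_k (simplex_det s /
     \prod_l dot u (a (s (lift k l)) - a (s k))) * dot u (a (s k)) ^+ m)).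
- exact: zariski_denseI (@zariski_denseT R d) D0.
- exact: evaluates_tofrac.
- have evX r F k : evaluates U r F -> evaluates U (r ^+ k) (fun u => F u ^+ k).
    move=> H; rewrite -[k in r ^+ k]card_ord -prodr_const.
    have [p [q [q0 E K]]] := evaluates_prod (index_enum 'I_k) (Q := predT) (fun _ _ => H).
    exists p, q; split => // u /K[qu <-]; split => //.
    by rewrite prodr_const card_ord.
  apply: evaluatesM.
    have := evX _ _ d (evaluates_tofrac U (-1)).
    rewrite tofracN tofrac1 => -[p [q [q0 E K]]]; exists p, q; split => // u /K[qu <-].
    by split => //; rewrite /ev mevalN meval1.
  apply: evaluates_sum => s sT; apply: evaluates_sum => k _.
  apply: evaluatesM; last exact/evX/evaluates_form.
  apply: evaluates_quotient => [l|u Uu l]; first by rewrite diff_neq0// simplex_diff_neq0.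
  exact/Ugen/simplex_diff_neq0.
move=> u Uu; have [] : (ev u G)%:E = (\sum_(s in T) simplex_det s *
    vertex_sum (horner 'X^m) (fun k => dot u (a (s k))))%:E.
  by rewrite HG integral_polytope//; exact: Ugen.
move=> ->; rewrite mulr_sumr; apply: eq_bigr => s sT.
rewrite vertex_sum_edges mulrCA; congr (_ * _); rewrite mulr_sumr.
by apply: eq_bigr => k _; rewrite hornerXn mulrAC mulrA.
Qed.

End SimplePolytope.

(** * The multinomial theorem *)

Section Multinomial.
Variables (R : realType) (d : nat).
Implicit Types (u v : 'rV[R]_d) (I m : 'X_{1..d}).

Lemma linform_homog v : linform v \is 1.-homog.
Proof.
by apply: rpred_sum => i _; apply: dhomogZ; rewrite dhomogX; apply/eqP; exact: mdeg1.
Qed.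

Lemma mderiv_linformX v i k :
  (linform v ^+ k.+1)^`M(i) = (k.+1%:R * v 0 i) *: linform v ^+ k.
Proof.
have dl : (linform v)^`M(i) = (v 0 i)%:MP.
  rewrite /linform raddf_sum (bigD1 i)//= big1 ?addr0 => [|j ji].
    rewrite mderivZ mderivX mnm1E eqxx scale1r.
    rewrite (_ : (U_(i) - U_(i))%MM = 0%MM) ?mpolyX0; last first.
      by apply/mnmP => j; rewrite mnmBE mnm0E subnn.
    by rewrite -mul_mpolyC mulr1.
  by rewrite mderivZ mderivX mnm1E (negbTE ji) scale0r scaler0.
elim: k => [|k IH].
  by rewrite expr1 dl expr0 mul1r -mul_mpolyC mulr1.
rewrite exprS mderivM dl IH mul_mpolyC -scalerAr -exprS -scalerDl.
by congr (_ *: _); rewrite -[k.+2%:R]natr1; ring.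
Qed.

Definition mfact (m : 'X_{1..d}) : nat := \prod_i (m i)`!.

(** Induction on k; deriving with respect to a variable that occurs in m
    lowers the degree by one. *)
Lemma mcoeff_linformX v k m : mdeg m = k ->
  (linform v ^+ k)@_m = k`!%:R / (mfact m)%:R * \prod_i v 0 i ^+ m i.
Proof.
elim: k m => [|k IH] m mk.
  have -> : m = 0%MM by apply/eqP; rewrite -mdeg_eq0 mk.
  rewrite expr0 mcoeff1 eqxx /mfact !big1 ?divr1 ?mulr1// => i _; by rewrite mnm0E.
have [i mi] : exists i, m i != 0%N.
  apply/existsP; apply: contra_eqT mk; rewrite negb_exists => /forallP H.
  rewrite mdegE big1// => i _; by apply/eqP; have := H i; rewrite negbK.
pose m' := (m - U_(i))%MM.
have mE : m = (m' + U_(i))%MM by rewrite submK// lep1mP.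
have m'k : mdeg m' = k by move: mk; rewrite mE mdegD mdeg1 addn1 => -[].
have := mcoeff_deriv i m' (linform v ^+ k.+1).
rewrite -mE mderiv_linformX mcoeffZ IH//.
have m'i : m i = (m' i).+1 by rewrite mE mnmDE mnm1E eqxx addn1.
have m'j j : j != i -> m j = m' j by move=> ji; rewrite mE mnmDE mnm1E eq_sym (negbTE ji) addn0.
have fE : mfact m = ((m' i).+1 * mfact m')%N.
  rewrite /mfact (bigD1 i)//= [in RHS](bigD1 i)//= m'i factS mulnA; congr (_ * _)%N.
  by apply: eq_bigr => j ji; rewrite m'j.
have vE : \prod_j v 0 j ^+ m j = v 0 i * \prod_j v 0 j ^+ m' j.
  rewrite (bigD1 i)//= [in RHS](bigD1 i)//= m'i exprS mulrA; congr (_ * _).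
  by apply: eq_bigr => j ji; rewrite m'j.
rewrite fE vE factS !natrM -[(linform v ^+ k.+1)@_m *+ _]mulr_natr => H.
have n0 : (m' i).+1%:R != 0 :> R by rewrite pnatr_eq0.
have f0 : (mfact m')%:R != 0 :> R.
  by rewrite pnatr_eq0 -lt0n prodn_gt0// => j; exact: fact_gt0.
apply: (mulIf n0); rewrite -H; move: n0 f0.
move: ((m' i).+1%:R : R) ((mfact m')%:R : R) => z y z0 y0.
by field; rewrite z0 y0.
Qed.

Lemma homog_sum (p : {mpoly R[d]}) k : p \is k.-homog ->
  p = \sum_(m : 'X_{1..d < k.+1} | mdeg m == k) p@_m *: 'X_[m].
Proof.
move=> hp; have sp : (msize p <= k.+1)%N.
  rewrite msizeE; apply/bigmax_leqP_seq => m mp _.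
  by have E : mdeg m = k := dhomog_mf hp mp; rewrite E.
rewrite {1}(mpolywE sp) (bigID (fun m : 'X_{1..d < k.+1} => mdeg m == k))/=.
rewrite [X in _ + X]big1 ?addr0// => m mk.
by rewrite (dhomog_nemf_coeff hp mk) scale0r.
Qed.

Lemma ev_monomial u (m : 'X_{1..d}) : ev u 'X_[m] = \prod_i u 0 i ^+ m i.
Proof. by rewrite /ev mevalX. Qed.

Lemma multinomial u v k : dot u v ^+ k =
  \sum_(m : 'X_{1..d < k.+1} | mdeg m == k)
    k`!%:R / (mfact m)%:R * (\prod_i v 0 i ^+ m i) * (\prod_i u 0 i ^+ m i).
Proof.
transitivity (ev u (linform v ^+ k)); first by rewrite /ev rmorphXn /= -/(ev u _) ev_linform.
have hk : linform v ^+ k \is k.-homog.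
  by have := dhomogMn k (linform_homog v); rewrite mul1n.
rewrite (homog_sum hk) /ev raddf_sum /=; apply: eq_bigr => m /eqP mk.
by rewrite mevalZ -/(ev u _) ev_monomial mcoeff_linformX.
Qed.
End Multinomial.

(** * Expansion of sums of geometric fractions *)

Section SyntheticDivision.
Variable M : comNzRingType.

Lemma coef_mul_linear (c : M) (B : {poly M}) m :
  ((1 - c *: 'X) * B)`_m.+1 = B`_m.+1 - c * B`_m.
Proof. by rewrite mulrBl mul1r -scalerAl coefB coefZ coefXM. Qed.

(** Dividing by 1 - c X is multiplying by the geometric series of c X. *)
Lemma synthetic_division (c : M) (B : {poly M}) m :
  \sum_(j < m.+1) ((1 - c *: 'X) * B)`_j * c ^+ (m - j) = B`_m.
Proof.
elim: m => [|m IH].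
  by rewrite big_ord_recl big_ord0 addr0 subn0 expr0 mulr1 mulrBl mul1r -scalerAl
    coefB coefZ coefXM mulr0 subr0.
rewrite big_ord_recr /= subnn expr0 mulr1 coef_mul_linear.
rewrite (eq_bigr (fun j : 'I_m.+1 => c * (((1 - c *: 'X) * B)`_j * c ^+ (m - j)))).
  by rewrite -mulr_sumr IH addrC subrK.
by move=> j _; rewrite subSn -1?ltnS// exprS mulrCA.
Qed.

Lemma size_prod_linear (I : finType) (P : pred I) (c : I -> M) :
  (size (\prod_(i | P i) (1 - c i *: 'X) : {poly M})%R <= #|P|.+1)%N.
Proof.
have sz i : (size (1 - c i *: 'X : {poly M})%R <= 2)%N.
  rewrite (leq_trans (size_polyD _ _))// geq_max size_poly1 size_polyN /=.
  by rewrite (leq_trans (size_scale_leq _ _))// size_polyX.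
rewrite -sum1_card.
elim/big_rec2: _ => [|i k p _ IH]; first by rewrite size_poly1.
rewrite (leq_trans (size_polyMleq _ _))// -subn1 leq_subLR.
by rewrite (leq_trans (leq_add (sz i) IH)).
Qed.

End SyntheticDivision.

Lemma one_sub_form_neq0 (R : realType) d (l : {mpoly R[d]}) :
  l \is 1.-homog -> 1 - tofrac l != 0.
Proof.
move=> l1; rewrite -tofrac1 -tofracB tofrac_eq0; apply/eqP => /(congr1 (mcoeff 0%MM)).
rewrite mcoeffB mcoeff1 eqxx mcoeff0 (dhomog_nemf_coeff l1) ?subr0 /= ?mdeg0//.
by move/eqP; rewrite oner_eq0.
Qed.

Section GradedExpansion.
Variables (R : realType) (d n : nat) (l : 'I_n -> {mpoly R[d]}).
Hypothesis l_homog : forall i, l i \is 1.-homog.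

(** The variable of B marks the degree, so that the value at 1 has the
    coefficients of B as homogeneous parts; see [mcoeff_horner1]. *)
Definition graded (B : {poly {mpoly R[d]}}) := forall j, B`_j \is j.-homog.

Lemma gradedM A B : graded A -> graded B -> graded (A * B).
Proof.
move=> hA hB j; rewrite coefM; apply: rpred_sum => i _.
by have := dhomogM (hA i) (hB (j - i)%N); rewrite subnKC// leq_ord.
Qed.

Lemma graded_prod (P : pred 'I_n) : graded (\prod_(i | P i) (1 - l i *: 'X)).
Proof.
apply: big_ind => [||i _]; last 2 first.
- exact: gradedM.
- case => [|[|j]]; rewrite coefB coef1 coefZ coefX /= ?mulr0 ?mulr1 ?subr0 ?sub0r ?oppr0.
  + exact: dhomog1.
  + by rewrite dhomogN.
  + exact: dhomog0.
by case => [|j]; rewrite coef1; [exact: dhomog1|exact: dhomog0].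
Qed.

Let den : {poly {mpoly R[d]}} := \prod_i (1 - l i *: 'X).
Let den_off i : {poly {mpoly R[d]}} := \prod_(k | k != i) (1 - l k *: 'X).

Lemma denE i : den = (1 - l i *: 'X) * den_off i.
Proof. by rewrite /den (bigD1 i). Qed.

Lemma den_off_coef_eq0 i m : (n <= m)%N -> (den_off i)`_m = 0.
Proof.
move=> nm; apply: nth_default; apply: leq_trans nm.
apply: (leq_trans (size_prod_linear _ _)).
by rewrite cardC1 card_ord prednK// (leq_ltn_trans _ (ltn_ord i)).
Qed.

Lemma mcoeff_horner1 (B : {poly {mpoly R[d]}}) : graded B ->
  forall m, (B.[1])@_m = (B`_(mdeg m))@_m.
Proof.
move=> gB m; rewrite (horner_coef_wide _ (leq_maxl (size B) (mdeg m).+1)).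
have lt : (mdeg m < maxn (size B) (mdeg m).+1)%N by rewrite leq_max ltnSn orbT.
rewrite raddf_sum (bigD1 (Ordinal lt))//= expr1n mulr1 big1 ?addr0// => j jm.
rewrite expr1n mulr1; apply: dhomog_nemf_coeff (gB j) _.
by apply: contra jm => /eqP E; apply/eqP/val_inj.
Qed.

Variables (f : 'X_{1..d} -> R) (c : 'I_n -> ratfun R d).
Definition homog_part k : {mpoly R[d]} :=
  \sum_(m : 'X_{1..d < k.+1} | mdeg m == k) f m *: 'X_[m].

Lemma mcoeff_homog_part k (m : 'X_{1..d}) :
  (homog_part k)@_m = if mdeg m == k then f m else 0.
Proof.
rewrite /homog_part raddf_sum /=; case: eqP => mk.
  have lt : (mdeg m < k.+1)%N by rewrite mk.
  rewrite (bigD1 (BMultinom lt)) /=; last by rewrite mk.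
  rewrite mcoeffZ mcoeffX eqxx mulr1 big1 ?addr0// => m' /andP[_ m'm].
  rewrite mcoeffZ mcoeffX; case: eqP => [E|_]; last by rewrite mulr0.
  by move: m'm; rewrite -(inj_eq val_inj) /= E eqxx.
rewrite big1// => m' /eqP m'k; rewrite mcoeffZ mcoeffX; case: eqP => [E|_]; last by rewrite mulr0.
by rewrite -E in mk.
Qed.

Hypothesis fE : forall k,
  tofrac (homog_part k) = (-1) ^+ d * \sum_i c i * tofrac (l i) ^+ (k + d).

(** The part of degree k of the product of the series f by the common
    denominator. *)
Let num_part k := \sum_(j < k.+1) den`_j * homog_part (k - j).

Lemma tofrac_num_part k : tofrac (num_part k) =
  (-1) ^+ d * \sum_i c i * tofrac (l i) ^+ d * tofrac (den_off i)`_k.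
Proof.
rewrite /num_part raddf_sum /=.
under eq_bigr => j _ do rewrite tofracM fE mulrCA mulr_sumr.
rewrite -mulr_sumr exchange_big /=; congr (_ * _); apply: eq_bigr => i _.
rewrite -(synthetic_division (l i) (den_off i) k) -denE raddf_sum mulr_sumr /=.
apply: eq_bigr => j _; rewrite tofracM tofracXn exprD; ring.
Qed.

Lemma num_part_eq0 k : (n <= k)%N -> num_part k = 0.
Proof.
move=> nk; apply/eqP; rewrite -tofrac_eq0 tofrac_num_part big1 ?mulr0// => i _.
by rewrite den_off_coef_eq0// tofrac0 mulr0.
Qed.

Lemma mcoeff_num_part k m : (num_part k)@_m = if mdeg m == k then
  \sum_(m' : 'X_{1..d < (mdeg m).+1} | (m' <= m)%MM) (den.[1])@_m' * f (m - m')%MM else 0.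
Proof.
have gQ := graded_prod predT; rewrite -/den in gQ.
case: eqP => [mk|mk].
  rewrite /num_part raddf_sum /=.
  under eq_bigr => j _ do rewrite (mcoeff_poly_mul_lin _ _ (ltnSn (mdeg m))).
  rewrite exchange_big /=; apply: eq_bigr => m' m'm.
  have lt : (mdeg m' < k.+1)%N by rewrite -mk; exact: bmdeg.
  rewrite (bigD1 (Ordinal lt))//= big1 ?addr0.
    rewrite (mcoeff_horner1 gQ) mcoeff_homog_part.
    have -> : mdeg (m - m')%MM = (k - mdeg m')%N.
      have E := congr1 (@mdeg d) (submK m'm); rewrite mdegD in E.
      by apply/eqP; rewrite -(eqn_add2r (mdeg m')) subnK//; apply/eqP; exact: etrans E mk.
    by rewrite eqxx.
  move=> j jm'; rewrite (dhomog_nemf_coeff (gQ j)) ?mul0r//.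
  by apply: contra jm' => /eqP E; apply/eqP/val_inj.
apply: (@dhomog_nemf_coeff _ _ _ k); last by move/eqP: mk; exact.
apply: rpred_sum => j _.
have hF : homog_part (k - j) \is (k - j).-homog.
  by apply: rpred_sum => m' /eqP m'k; apply: dhomogZ; rewrite dhomogX; apply/eqP.
by have := dhomogM (gQ j) hF; rewrite subnKC// leq_ord.
Qed.

(** Both sides have the common denominator [den.[1]], the product of the 1 -
    l_i. In its product with f, the geometric series telescope and leave in
    degree k the coefficient of [tofrac_num_part], which is zero for k >= n,
    so that the product is a polynomial. *)
Lemma graded_expansion : expansion_at0 f
  ((-1) ^+ d * \sum_i c i * tofrac (l i) ^+ d * (1 / (1 - tofrac (l i)))).
Proof.
exists (\sum_(k < n) num_part k), den.[1]; split.
- rewrite /den horner_prod rmorph_prod /=; apply/prodf_neq0 => i _.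
  rewrite hornerD hornerN hornerZ hornerX hornerC mulr1 mcoeffB mcoeff1 eqxx.
  by rewrite (dhomog_nemf_coeff (l_homog i)) ?subr0 ?oner_neq0//= mdeg0.
- have l1 i : 1 - tofrac (l i) != 0 by exact: one_sub_form_neq0.
  rewrite raddf_sum /=.
  under [in RHS]eq_bigr do rewrite tofrac_num_part.
  rewrite -mulr_sumr exchange_big /= -mulrA mulr_suml; congr (_ * _).
  apply: eq_bigr => i _; rewrite -mulr_sumr -[RHS]mulrA; congr (_ * _).
  have hw : (size (den_off i) <= n)%N.
    apply: (leq_trans (size_prod_linear _ _)).
    by rewrite cardC1 card_ord prednK// (leq_ltn_trans _ (ltn_ord i)).
  have -> : \sum_(k < n) tofrac (den_off i)`_k = tofrac (den_off i).[1].
    rewrite (horner_coef_wide _ hw) raddf_sum /=; apply: eq_bigr => k _.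
    by rewrite expr1n mulr1.
  have q0 : tofrac (den_off i).[1] != 0.
    rewrite /den_off horner_prod rmorph_prod /=; apply/prodf_neq0 => k _.
    by rewrite hornerD hornerN hornerZ hornerX hornerC mulr1 tofracB tofrac1.
  rewrite (denE i) hornerM hornerD hornerN hornerZ hornerX hornerC mulr1 tofracM tofracB tofrac1.
  by rewrite invfM mulrCA divff// mulr1 mul1r.
move=> m; rewrite raddf_sum /=.
under [in RHS]eq_bigr do rewrite mcoeff_num_part.
have [mn|mn] := ltnP (mdeg m) n.
  rewrite [RHS](bigD1 (Ordinal mn))//= eqxx [X in _ = _ + X]big1 ?addr0// => k km.
  by case: eqP => // E; move: km; rewrite -(inj_eq val_inj) /= E eqxx.
rewrite [RHS]big1; last first.
  by move=> k _; case: eqP => // E; move: (ltn_ord k); rewrite -E ltnNge mn.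
have := congr1 (mcoeff m) (num_part_eq0 mn).
by rewrite mcoeff_num_part eqxx mcoeff0.
Qed.

End GradedExpansion.

(** * Moments of a bounded set *)

Section Moments.
Variables (R : realType) (d : nat) (P : set 'rV[R]_d) (B : R).
Local Notation RR := (measurableTypeR R).
Local Notation lam := (lebesgue_tuple R d).
Hypothesis mP : measurable (tuples P).
Hypothesis finP : (lam (tuples P) < +oo)%E.
Hypothesis B0 : 0 <= B.
Hypothesis bP : forall x i, P x -> `|x 0 i| <= B.

Definition monomial (m : 'X_{1..d}) (t : d.-tuple R) : R := \prod_i tnth t i ^+ m i.

Lemma measurable_monomial m :
  measurable_fun setT (monomial m : d.-tuple RR -> RR).
Proof.
apply: (@measurable_prod _ _ R setT) => i _.
by apply: measurable_funX; exact: measurable_tnth.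
Qed.

Lemma monomial_le m t : tuples P t -> `|monomial m t| <= B ^+ mdeg m.
Proof.
move=> Pt; rewrite /monomial normr_prod mdegE -prodrXr.
apply: ler_prod => i _; rewrite normr_ge0 normrX lerXn2r ?nnegrE//=.
by have := bP i Pt; rewrite mxE.
Qed.

Lemma integrable_monomial m : lam.-integrable (tuples P) (EFin \o monomial m).
Proof.
apply: measurable_bounded_integrable => //.
  by apply: measurable_funTS; exact: measurable_monomial.
exists (B ^+ mdeg m); split; first exact: num_real.
move=> C /ltW BC t Pt; apply: le_trans BC; exact: monomial_le.
Qed.

Lemma momentE m : ((moment P m)%:E = \int[lam]_(t in tuples P) (monomial m t)%:E)%E.
Proof.
rewrite /moment /Rintegral fineK//.
exact: (integrable_fin_num mP (integrable_monomial m)).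
Qed.

Lemma moment_le m : `|moment P m| <= B ^+ mdeg m * fine (lam (tuples P)).
Proof.
apply: (le_trans (le_normr_Rintegral mP (integrable_monomial m))).
rewrite -Rintegral_cst//; apply: le_Rintegral => //.
- by have := integrable_abse (integrable_monomial m).
- apply: (@measurable_bounded_integrable _ _ _ lam (cst (B ^+ mdeg m))) => //.
  exists (B ^+ mdeg m); split; first exact: num_real.
  by move=> C /ltW BC t Pt; apply: le_trans BC; rewrite /= ger0_norm// exprn_ge0.
- by move=> t; exact: monomial_le.
Qed.

(** The multinomial theorem under the integral sign: (k + d)! / k! times <x,
    u>^k is the d-th derivative of X^(k + d) at <x, u>. *)
Lemma ev_homog_part k u :
  (ev u (homog_part (nmgf_coef P) k))%:E =
  (\int[lam]_(t in tuples P) ('X^(k + d)^`(d)).[dot u (row_of t)]%:E)%E.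
Proof.
pose c (m : 'X_{1..d}) : R := (mdeg m + d)`!%:R / (mfact m)%:R * \prod_i u 0 i ^+ m i.
transitivity (\int[lam]_(t in tuples P)
   \sum_(m : 'X_{1..d < k.+1} | mdeg m == k) (c m * monomial m t)%:E)%E; last first.
  apply: eq_integral => t _; rewrite sumEFin; congr (_%:E).
  rewrite derivnXn hornerMn hornerXn addnK multinomial -mulr_natr mulr_suml.
  apply: eq_bigr => m /eqP mk; rewrite /c mk.
  have := @ffact_fact (k + d) d (leq_addl _ _); rewrite addnK => /(congr1 (fun n => n%:R : R)).
  rewrite natrM => <-.
  have -> : \prod_i row_of t 0 i ^+ m i = monomial m t by apply: eq_bigr => i _; rewrite mxE.
  by ring.
have icm m : lam.-integrable (tuples P) (fun t => (c m * monomial m t)%:E).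
  rewrite (_ : (fun t => _) = (fun t => ((c m)%:E * (EFin \o monomial m) t)%E)); last first.
    by apply/funext => t; rewrite EFinM.
  by apply: integrableZl => //; exact: integrable_monomial.
rewrite (integral_sum mP); last by move=> m; exact: icm.
rewrite /homog_part.
have -> : forall F : 'X_{1..d < k.+1} -> {mpoly R[d]},
    ev u (\sum_(m : 'X_{1..d < k.+1} | mdeg m == k) F m) =
    \sum_(m : 'X_{1..d < k.+1} | mdeg m == k) ev u (F m).
  by move=> F; rewrite /ev raddf_sum.
rewrite -sumEFin; apply: eq_bigr => m _ /=.
under eq_integral do rewrite EFinM.
rewrite integralZl//; last exact: integrable_monomial.
rewrite -momentE -EFinM {1}/ev mevalZ -/(ev u _) ev_monomial /nmgf_coef /c /mfact natr_prod.
by congr (_%:E); ring.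
Qed.

End Moments.

(** * Convergence *)

Section Convergence.
Variables (R : realType) (d : nat).
Implicit Types m : 'X_{1..d}.

Lemma geometric_sum_le N : \sum_(k < N) (2^-1 : R) ^+ k <= 2.
Proof.
suff -> : \sum_(k < N) (2^-1 : R) ^+ k = 2 - 2 * 2^-1 ^+ N.
  by rewrite gerBl mulr_ge0// exprn_ge0// invr_ge0.
elim: N => [|N IH]; first by rewrite big_ord0 expr0; ring.
by rewrite big_ord_recr IH exprS /=; field.
Qed.

(** The sum is a part of the expanded product of d geometric series. *)
Lemma sum_half_mdeg_le (s : seq 'X_{1..d}) : uniq s ->
  \sum_(m <- s) (2^-1 : R) ^+ mdeg m <= 2 ^+ d.
Proof.
move=> us; pose N := \max_(m <- s) mdeg m.
have le_N m i : m \in s -> (m i <= N)%N.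
  move=> ms; apply: (@leq_trans (mdeg m)); last exact: leq_bigmax_seq.
  by rewrite mdegE (bigD1 i)//= leq_addr.
pose phi m : {ffun 'I_d -> 'I_N.+1} := [ffun i => inord (m i)].
pose F (g : {ffun 'I_d -> 'I_N.+1}) : R := \prod_i 2^-1 ^+ g i.
have F0 g : 0 <= F g by apply: prodr_ge0 => i _; rewrite exprn_ge0// invr_ge0.
have phiK m i : m \in s -> phi m i = m i :> nat.
  by move=> ms; rewrite ffunE inordK// ltnS le_N.
have uphi : uniq [seq phi m | m <- s].
  rewrite map_inj_in_uniq// => m m' ms ms' /ffunP E; apply/mnmP => i.
  by rewrite -(phiK m)// -(phiK m')// E.
have -> : \sum_(m <- s) (2^-1 : R) ^+ mdeg m = \sum_(g <- [seq phi m | m <- s]) F g.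
  rewrite big_map big_seq [RHS]big_seq; apply: eq_bigr => m ms.
  by rewrite mdegE -prodrXr; apply: eq_bigr => i _; rewrite phiK.
rewrite big_uniq//=; apply: (@le_trans _ _ (\sum_g F g)).
  by rewrite [leRHS](bigID (mem [seq phi m | m <- s]))/= lerDl sumr_ge0.
rewrite /F -(bigA_distr_bigA (fun (i : 'I_d) (k : 'I_N.+1) => 2^-1 ^+ k)).
apply: (@le_trans _ _ (\prod_(i < d) 2)); last by rewrite prodr_const card_ord.
apply: ler_prod => i _; rewrite geometric_sum_le andbT.
by apply: sumr_ge0 => k _; rewrite exprn_ge0// invr_ge0.
Qed.

Lemma summable_geometric (f : 'X_{1..d} -> R) (C : R) :
  (forall m, `|f m| <= C * 2^-1 ^+ mdeg m) ->
  summable [set: 'X_{1..d}] (fun m => (f m)%:E).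
Proof.
move=> fC; have C0 : 0 <= C.
  by have := le_trans (normr_ge0 _) (fC 0%MM); rewrite mdeg0 expr0 mulr1.
apply: (@le_lt_trans _ _ (C * 2 ^+ d)%:E); last exact: ltry.
apply: ge_ereal_sup => _ [A [finA _] <-].
rewrite fsbig_finite//= sumEFin lee_fin.
set s : seq 'X_{1..d} := finmap.enum_fset _.
apply: (@le_trans _ _ (\sum_(m <- s) C * 2^-1 ^+ mdeg m)); first exact: ler_sum.
by rewrite -mulr_sumr ler_wpM2l// sum_half_mdeg_le// finmap.fset_uniq.
Qed.

Lemma fact_addn_le k : ((k + d)`! <= 2 ^ (k + d) * (d`! * k`!))%N.
Proof.
rewrite -(@bin_fact (k + d) d) ?leq_addl// addnK leq_mul2r; apply/orP; right.
rewrite -[X in (_ <= X ^ _)%N](add1n 1) Pascal (bigD1 (inord d : 'I_(k + d).+1))//=.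
by rewrite !exp1n !muln1 inordK ?ltnS ?leq_addl// leq_addr.
Qed.

(** The left-hand side is a term of the multinomial expansion of (1 + ... +
    1)^k. *)
Lemma multinomial_le m : ((mdeg m)`!%:R / (mfact m)%:R : R) <= d%:R ^+ mdeg m.
Proof.
pose o : 'rV[R]_d := const_mx 1.
have -> : d%:R = dot o o.
  by rewrite /dot (eq_bigr (fun=> 1)) => [|i _]; rewrite ?mxE ?mulr1// sumr_const card_ord.
rewrite multinomial (bigD1 (BMultinom (ltnSn (mdeg m))))//=.
have p1 (m' : 'X_{1..d}) : \prod_i o 0 i ^+ m' i = 1.
  by apply: big1 => i _; rewrite mxE expr1n.
by rewrite !p1 !mulr1 lerDl; apply: sumr_ge0 => m' _; rewrite !p1 !mulr1 divr_ge0.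
Qed.

Variables (P : set 'rV[R]_d) (B : R).
Local Notation lam := (lebesgue_tuple R d).
Hypothesis mP : measurable (tuples P).
Hypothesis finP : (lam (tuples P) < +oo)%E.
Hypothesis B0 : 0 <= B.
Hypothesis bP : forall x i, P x -> `|x 0 i| <= B.

Lemma nmgf_coef_le m : `|nmgf_coef P m| <=
  ((2 ^ d * d`!)%:R * fine (lam (tuples P))) * (2 * d%:R * B) ^+ mdeg m.
Proof.
have V0 : 0 <= fine (lam (tuples P)) by apply: fine_ge0; exact: measure_ge0.
set k := mdeg m.
rewrite /nmgf_coef normrM ger0_norm ?divr_ge0 -?natr_prod// -/(mfact m) -/k.
apply: (@le_trans _ _ (((2 ^ (k + d) * d`!)%:R * (k`!%:R / (mfact m)%:R)) *
    (B ^+ k * fine (lam (tuples P))))).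
  apply: ler_pM => //; last exact: moment_le.
  rewrite mulrA ler_wpM2r ?invr_ge0// -natrM ler_nat -mulnA; exact: fact_addn_le.
have := multinomial_le m; rewrite -/k => Hk.
apply: (@le_trans _ _ (((2 ^ (k + d) * d`!)%:R * d%:R ^+ k) *
    (B ^+ k * fine (lam (tuples P))))).
  by rewrite ler_wpM2r ?mulr_ge0 ?exprn_ge0// ler_wpM2l.
rewrite !exprMn expnD !natrM !natrX le_eqVlt; apply/orP; left; apply/eqP.
by ring.
Qed.

Lemma nmgf_converges : converges_near0 (nmgf_coef P).
Proof.
(* so that 2 d B eps <= 1 / 2, also for d = 0 or B = 0 *)
pose eps : R := (4 * (d%:R + 1) * (B + 1))^-1.
have eps0 : 0 < eps by rewrite invr_gt0 !mulr_gt0 ?ltr_wpDl.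
apply/nbhs_ballP; exists eps => //= u [_ uB].
apply: (summable_geometric (C := (2 ^ d * d`!)%:R * fine (lam (tuples P)))) => m.
have V0 : 0 <= fine (lam (tuples P)) by apply: fine_ge0; exact: measure_ge0.
have ule i : `|u 0 i| <= eps.
  by have := uB ord0 i; rewrite /ball /= mxE sub0r normrN => /ltW.
rewrite normrM; apply: (le_trans (ler_wpM2r (normr_ge0 _) (nmgf_coef_le m))).
rewrite -[leLHS]mulrA ler_wpM2l ?mulr_ge0// normr_prod.
apply: (@le_trans _ _ ((2 * d%:R * B) ^+ mdeg m * eps ^+ mdeg m)).
  rewrite ler_wpM2l ?exprn_ge0 ?mulr_ge0// [X in eps ^+ X]mdegE -prodrXr.
  by apply: ler_prod => i _; rewrite normr_ge0 normrX lerXn2r ?nnegrE// ltW.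
rewrite -exprMn lerXn2r ?nnegrE ?invr_ge0 ?mulr_ge0 ?(ltW eps0)//.
rewrite /eps ler_pdivrMr ?mulr_gt0 ?ltr_wpDl//.
rewrite (_ : 2^-1 * _ = 2 * ((d%:R + 1) * (B + 1))); last by field.
by rewrite -mulrA ler_wpM2l// ler_pM// lerDl.
Qed.

End Convergence.

(** * Moment generating function of a simple polytope *)

Lemma convpts_bounded (R : realType) (d n : nat) (a : 'I_n -> 'rV[R]_d) x i :
  convpts a x -> `|x 0 i| <= \sum_j \sum_k `|a j 0 k|.
Proof.
move=> [l [l0 l1 ->]]; rewrite summxE.
apply: (le_trans (ler_norm_sum _ _ _)); apply: ler_sum => j _.
rewrite mxE normrM ger0_norm//; apply: (@le_trans _ _ `|a j 0 i|).
  by rewrite ler_piMl// -l1 (bigD1 j)//= lerDl sumr_ge0.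
by rewrite (bigD1 i)//= lerDl sumr_ge0.
Qed.

Lemma fsbig_range (V : nmodType) (T : choiceType) n (a : 'I_n -> T) (F : T -> V) :
  injective a -> \sum_(v \in range a) F v = \sum_i F (a i).
Proof.
move=> aI; rewrite (@fsbigE _ _ _ _ _ [seq a i | i <- enum 'I_n]).
- rewrite big_map big_enum_cond /=; apply: eq_bigl => i.
  by apply/mem_set; exists i.
- by rewrite map_inj_uniq ?enum_uniq.
- by move=> _ /mapP[i _ ->]; exists i.
- by move=> _ [i _ <-]; rewrite map_f// mem_enum.
Qed.

Lemma geometric_fraction (F : fieldType) (x c : F) d : 1 - x != 0 ->
  c * (x ^+ d * (1 / (1 - x))) = c * (1 / (1 - x)) - \sum_(k < d) c * x ^+ k.
Proof.
move=> x1; rewrite -mulr_sumr -mulrBr; congr (_ * _).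
set S := \sum_(k < d) x ^+ k.
have SE : S * (1 - x) = 1 - x ^+ d by rewrite -opprB mulrN mulrC -subrX1 opprB.
by apply: (mulIf x1); rewrite mulrBl SE !div1r mulfVK// mulVf// subKr.
Qed.

Section SimplePolytopeSeries.
Variables (R : realType) (d n : nat) (a : 'I_n -> 'rV[R]_d) (W : 'I_n -> 'M[R]_d).
Local Notation lam := (lebesgue_tuple R d).
Variable nb : 'I_n -> 'I_d -> 'I_n.
Hypothesis aI : injective a.
Hypothesis spans : forall u b, u != 0 -> exists i, dot u (a i) != b.
Hypothesis uW : forall i, W i \in unitmx.
Hypothesis nbi : forall i k, nb i k != i.
Hypothesis WE : forall i k, row k (W i) = a (nb i k) - a i.
Hypothesis coneW : forall i j,
  exists2 c : 'rV[R]_d, forall k, 0 <= c 0 k & a j = a i + c *m W i.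

Local Notation P := (convpts a).

Let mP : measurable (tuples P). Proof. exact: measurable_polytope uW WE coneW. Qed.

Let finP : (lam (tuples P) < +oo)%E.
Proof.
have [T [bT triT]] := regular_triangulation spans.
have := volume_triangulation uW WE coneW bT triT measurableT; rewrite setIT => ->.
apply/lte_sum_pinfty => s sT; rewrite setIT (lebesgue_convpts (k := ord0)) ?ltry//.
exact/basis_edges/bT.
Qed.

Let B : R := \sum_j \sum_k `|a j 0 k|.
Let B0 : 0 <= B. Proof. by apply: sumr_ge0 => j _; apply: sumr_ge0. Qed.

Lemma polytope_nmgf_converges : converges_near0 (nmgf_coef P).
Proof. exact: (nmgf_converges mP finP B0 (@convpts_bounded _ _ _ a)). Qed.

(** The d-th derivative of X^k vanishes. *)
Lemma brion_vanishing k : (k < d)%N ->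
  \sum_i rat_vertex W i * rat_form (a i) ^+ k = 0.
Proof.
move=> kd; have [T [bT triT]] := regular_triangulation spans.
have /esym/eqP : tofrac (0 : {mpoly R[d]}) =
    (-1) ^+ d * \sum_i rat_vertex W i * rat_form (a i) ^+ k.
  apply: (brion uW nbi WE coneW bT triT aI) => u.
  rewrite /ev meval0; apply/esym/integral0_eq => t _.
  by rewrite derivnXn ffact_small// mulr0n horner0.
by rewrite tofrac0 mulf_eq0 signr_eq0 => /eqP.
Qed.

(** This is [brion] for the exponent k + d, by [ev_homog_part]. *)
Lemma brion_moments k : tofrac (homog_part (nmgf_coef P) k) =
  (-1) ^+ d * \sum_i rat_vertex W i * rat_form (a i) ^+ (k + d).
Proof.
have [T [bT triT]] := regular_triangulation spans.
apply: (brion uW nbi WE coneW bT triT aI) => u.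
exact: (ev_homog_part mP finP B0 (@convpts_bounded _ _ _ a)).
Qed.

Lemma polytope_nmgf_expansion : expansion_at0 (nmgf_coef P)
  ((-1) ^+ d * \sum_i rat_vertex W i * rat_form (a i) ^+ d * (1 / (1 - rat_form (a i)))).
Proof.
have := @graded_expansion R d n (fun i => linform (a i)) _ (nmgf_coef P) (rat_vertex W).
apply; [by move=> i; exact: linform_homog|exact: brion_moments].
Qed.

(** By [geometric_fraction] the two sides differ by the sums of
    [brion_vanishing]. *)
Lemma rat_vertex_numerators :
  \sum_i rat_vertex W i * (rat_form (a i) ^+ d * (1 / (1 - rat_form (a i)))) =
  \sum_i rat_vertex W i * (1 / (1 - rat_form (a i))).
Proof.
under eq_bigr do rewrite geometric_fraction ?one_sub_form_neq0 ?linform_homog//.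
rewrite sumrB exchange_big /= [X in _ - X]big1 ?subr0// => k _.
exact: brion_vanishing.
Qed.

End SimplePolytopeSeries.

Theorem theorem2 (R : realType) (d : nat) (P : set 'rV[R]_d)
    (e : 'rV[R]_d -> 'I_d -> 'rV[R]_d)
    (P_polytope : convex_polytope P) (P_simple : simple_polytope P)
    (e_edges : edge_labelling P e) :
  let rhs1 : ratfun R d :=
    (-1) ^+ d * \sum_(v \in vertices P)
      (rat_form v ^+ d * rat_const d (absdetK e v)
        / \prod_(j < d) rat_form (edge_vector e v j))
      * (1 / (1 - rat_form v)) in
  let rhs2 : ratfun R d :=
    (-1) ^+ d * \sum_(v \in vertices P)
      (rat_const d (absdetK e v)
        / \prod_(j < d) rat_form (edge_vector e v j))
      * (1 / (1 - rat_form v)) in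
  [/\ converges_near0 (nmgf_coef P),
      expansion_at0 (nmgf_coef P) rhs1 &
      rhs1 = rhs2].
Proof.
have [n [a [PE exa spans star coneW]]] := simple_polytope_structure P_polytope e_edges.
have aI := strictly_exposed_inj exa.
pose W i := edge_matrix e (a i).
have uW i : W i \in unitmx by have [] := star i.
have /choice[nb nbP] i : exists f : 'I_d -> 'I_n, forall k, f k != i /\ e (a i) k = a (f k).
  have /choice[f fP] k : exists j, j != i /\ e (a i) k = a j.
    by have [_ /(_ k)[j ji E]] := star i; exists j.
  by exists f.
have nbi i k : nb i k != i by have [] := nbP i k.
have WE i k : row k (W i) = a (nb i k) - a i.
  by rewrite rowK /edge_vector; have [_ ->] := nbP i k.
have vE i : rat_vertex W i = rat_const d (absdetK e (a i))
    / \prod_(j < d) rat_form (edge_vector e (a i) j).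
  by rewrite /rat_vertex; congr (_ / _); apply: eq_bigr => k _; rewrite rowK.
have VE : vertices P = range a by rewrite PE vertices_convpts.
move=> rhs1 rhs2.
have E1 : rhs1 = (-1) ^+ d * \sum_i rat_vertex W i *
    (rat_form (a i) ^+ d * (1 / (1 - rat_form (a i)))).
  rewrite /rhs1 VE fsbig_range//; congr (_ * _); apply: eq_bigr => i _.
  by rewrite vE [RHS]mulrA; congr (_ * _); rewrite [RHS]mulrAC; congr (_ / _); exact: mulrC.
have E2 : rhs2 = (-1) ^+ d * \sum_i rat_vertex W i * (1 / (1 - rat_form (a i))).
  by rewrite /rhs2 VE fsbig_range//; congr (_ * _); apply: eq_bigr => i _; rewrite vE.
split; rewrite ?PE.
- exact: polytope_nmgf_converges spans uW WE coneW.
- rewrite E1; under eq_bigr do rewrite mulrA.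
  exact: polytope_nmgf_expansion aI spans uW nbi WE coneW.
- by rewrite E1 E2 (rat_vertex_numerators aI spans uW nbi WE coneW).
Qed.
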